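(* Let $G$ be an abelian group, let $\mathcal D$ be a finite-dimensional real $G$-graded division algebra with $Z(\mathcal D)=\mathbb R$, let $\varphi_0$ be a degree-preserving involution on $\mathcal D$ restricting to the conjugation on $\mathcal D_e$, and let $\delta\in\{\pm1\}$. Let $(g_0,\kappa,\sigma),(g_0',\kappa',\sigma')\in\mathsf X(G,\mathcal D,\varphi_0,\delta)$. Then the graded algebras with involution $M(\mathcal D,\varphi_0,g_0,\kappa,\sigma,\delta)$ and $M(\mathcal D,\varphi_0,g_0',\kappa',\sigma',\delta)$ are isomorphic if and only if $(g_0,\kappa,\sigma)$ and $(g_0',\kappa',\sigma')$ are in the same $G\times\{\pm1\}$-orbit.
   Context: $G$ is written multiplicatively, with identity $e$. A graded division algebra is a unital (nonzero) associative $G$-graded algebra in which every nonzero homogeneous element is invertible; its support $T$ is a subgroup of $G$. Here $\mathcal D_e\cong\mathbb R,\mathbb C$ or $\mathbb H$. Isomorphisms of graded algebras with involution preserve degrees and intertwine the involutions. Conjugation on $\mathcal D_e=\mathbb R$ means the identity. Notation. $K=T$ if $\mathcal D_e=\mathbb R$ or $\mathcal D_e\cong\mathbb H$, and $K=\{t\in T\mid \mathcal D_t \text{ commutes elementwise with }\mathcal D_e\}$ if $\mathcal D_e\cong\mathbb C$. For each $t\in T$ fix $0\ne X_t\in\mathcal D_t$ such that: $X_t$ commutes with $\mathcal D_e$ if $\mathcal D_e\cong\mathbb H$; $\varphi_0(X_t)=\delta X_t$ if $\mathcal D_e\cong\mathbb C$ and $t\in K$ (such choices exist). Then $\varphi_0(X_t)=\eta(t)X_t$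 with $\eta(t)\in\{\pm1\}$. Fix a section $\xi:G/T\to G$ of the quotient map. For $g_0\in G$ let $(G/T)_{g_0}=\{gT\mid g_0g^2\in T\}$ and $\tau(x)=g_0\xi(x)^2\in T$ for $x\in(G/T)_{g_0}$. Admissible multiplicity function (for $g_0$): a map $\kappa:G/T\to\mathbb Z_{\ge0}$ (not identically zero) with finite support such that $\kappa(g_0^{-1}x^{-1})=\kappa(x)$ for all $x$; if $\mathcal D_e=\mathbb R$, $\kappa(x)$ is even whenever $x\in(G/T)_{g_0}$ and $\eta(\tau(x))=-\delta$; if $\mathcal D_e\cong\mathbb C$, $\kappa(x)$ is even whenever $x\in(G/T)_{g_0}$, $\tau(x)\in T\setminus K$ and $\eta(\tau(x))=-\delta$. Write $|\kappa|=\sum_x\kappa(x)$. Signature function for $(g_0,\kappa)$: a map $\sigma:G/T\to\mathbb Z$ with $|\sigma(x)|\le\kappa(x)$ for all $x$, and: if $\mathcal D_e=\mathbb R$ or $\cong\mathbb H$, then $\sigma(x)\equiv\kappa(x)\pmod 2$ when $x\in(G/T)_{g_0}$ and $\eta(\tau(x))=\delta$, and $\sigma(x)=0$ otherwise; if $\mathcal D_e\cong\mathbb C$, then $\sigma(x)\equiv\kappa(x)\pmod2$ when $x\in(G/T)_{g_0}$ and $\tau(x)\in K$, and $\sigma(x)=0$ otherwise. $\mathsf X(G,\mathcal D,\varphi_0,\delta)$ is the set of triples $(g_0,\kappa,\sigma)$ with $g_0\in G$, $\kappa$ an admissible multiplicity function for $g_0$, $\sigma$ a signature function for $(g_0,\kappa)$.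 $M(\mathcal D,\varphi_0,g_0,\kappa,\sigma,\delta)$: let $x_1,\dots,x_s$ be the distinct elements of the support of $\kappa$, ordered so that $x_1,\dots,x_m\in(G/T)_{g_0}$ and the others come in pairs with $x_{m+2j-1}x_{m+2j}=g_0^{-1}T$, $j=1,\dots,r$, $m+2r=s$. Let $g_i=\xi(x_i)$, $k_i=\kappa(x_i)$, $k=|\kappa|$. The algebra is $M_k(\mathcal D)=M_k(\mathbb R)\otimes\mathcal D$, partitioned into $s^2$ blocks according to $k=k_1+\dots+k_s$, with $\deg(E\otimes d)=g_itg_j^{-1}$ for a matrix unit $E$ in the $(i,j)$ block and $d\in\mathcal D_t$. The involution is $\varphi(X)=\Phi^{-1}\varphi_0(X^T)\Phi$ ($\varphi_0$ applied entrywise), where $\Phi=X_{t_1}S_1\oplus\dots\oplus X_{t_{m+r}}S_{m+r}$ with: for $1\le j\le r$, $t_{m+j}=g_0g_{m+2j-1}g_{m+2j}$ and $S_{m+j}=\begin{pmatrix}0&I_{k_{m+2j}}\\ \delta\eta(t_{m+j})I_{k_{m+2j}}&0\end{pmatrix}$; for $1\le i\le m$, $t_i=\tau(x_i)$ and - if $\mathcal D_e=\mathbb R$ or $\cong\mathbb H$ with $\eta(t_i)=\delta$, or $\mathcal D_e\cong\mathbb C$ with $t_i\in K$: $S_i=\mathrm{diag}(I_{p_i},-I_{q_i})$ with $p_i=\frac12(\kappa(x_i)+\sigma(x_i))$, $q_i=\frac12(\kappa(x_i)-\sigma(x_i))$; - if $\mathcal D_e=\mathbb R$ with $\eta(t_i)=-\delta$,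 or $\mathcal D_e\cong\mathbb C$ with $t_i\in T\setminus K$, $\eta(t_i)=-\delta$: $S_i=\begin{pmatrix}0&I_{k_i/2}\\-I_{k_i/2}&0\end{pmatrix}$; - if $\mathcal D_e\cong\mathbb C$ with $t_i\in T\setminus K$, $\eta(t_i)=\delta$: $S_i=I_{k_i}$; - if $\mathcal D_e\cong\mathbb H$ with $\eta(t_i)=-\delta$: $S_i=\mathbf i I_{k_i}$, $\mathbf i$ a fixed imaginary unit in $\mathcal D_e$. Actions on $\mathsf X(G,\mathcal D,\varphi_0,\delta)$: $\epsilon\in\{\pm1\}$ acts by $\epsilon\cdot(g_0,\kappa,\sigma)=(g_0,\kappa,\epsilon\sigma)$; $g\in G$ acts by $g\cdot(g_0,\kappa,\sigma)=(g^{-2}g_0,g\cdot\kappa,\underline\sigma)$, where $(g\cdot\kappa)(x)=\kappa(g^{-1}x)$ and $\underline\sigma(x)=\eta(u)\,\mathrm{sign}\big(X_{tu^2}^{-1}X_uX_tX_u\big)\sigma(g^{-1}x)$, with $t=g_0\xi(g^{-1}x)^2$ and $u=\xi(g^{-1}x)^{-1}g^{-1}\xi(x)\in T$ (if $\sigma(g^{-1}x)=0$ then $\underline\sigma(x)=0$; otherwise $t\in K$ and the element whose sign is taken is a nonzero real number). *)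

(* Defs.v *)
From HB Require Import structures.
From mathcomp Require Import all_boot all_order all_algebra all_field.
From mathcomp Require Import boolp classical_sets cardinality reals.

Set Implicit Arguments.
Unset Strict Implicit.
Unset Printing Implicit Defensive.

Import Order.TTheory GRing.Theory Num.Theory.
Local Open Scope ring_scope.
Local Open Scope quotient_scope.

(* Abelian groups are zmodTypes, so the grading group is written additively:
   e, g h, g^-1, g^2 become 0, g + h, - g, g *+ 2. *)

(* A finite-dimensional algebra has only finitely many nonzero components, so
   D is the direct sum of the D_g, g in G, exactly when it is the direct sum of
   those indexed by some finite s outside of which they vanish. *)
Record grDivAlg (R : fieldType) (G : zmodType) := GrDivAlg {
  gd_alg :> falgType R;
  gd_comp : G -> {vspace gd_alg};
  gd_mulS : forall g h, (gd_comp g * gd_comp h <= gd_comp (g + h))%VS;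
  gd_dsum : exists s : seq G,
    [/\ uniq s, forall g, g \notin s -> gd_comp g = 0%VS,
        directv (\sum_(g <- s) gd_comp g) &
        (\sum_(g <- s) gd_comp g)%VS = fullv];
  gd_unit : forall g x, x \in gd_comp g -> x != 0 -> x \is a GRing.unit
}.

Definition gd_supp (R : fieldType) (G : zmodType) (D : grDivAlg R G) : {pred G} :=
  fun t => gd_comp D t != 0%VS.

Section SupportSubgroup.
Variables (R : fieldType) (G : zmodType) (D : grDivAlg R G).
Local Notation T := (gd_supp D).

Lemma gd_suppP t :
  reflect (exists2 x, x \in gd_comp D t & x != 0) (t \in T).
Proof.
apply: (iffP idP) => [Tt|[x Dx x0]].
  by exists (vpick (gd_comp D t)); rewrite ?memv_pick // vpick0.
by apply: contraNneq x0 => D0; rewrite D0 memv0 in Dx.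
Qed.

Lemma gd_suppD s t : s \in T -> t \in T -> s + t \in T.
Proof.
move=> /gd_suppP[x Dx x0] /gd_suppP[y Dy y0]; apply/gd_suppP; exists (x * y).
  by apply: subvP (gd_mulS D s t) _ _; apply: memv_mul.
by rewrite mulrI_eq0 //; apply/mulrI/(gd_unit Dx x0).
Qed.

Lemma gd_suppMn t n : t \in T -> t *+ n.+1 \in T.
Proof. by move=> Tt; elim: n => // n IH; rewrite mulrS gd_suppD. Qed.

Lemma gd_supp_torsion t : t \in T -> exists n, t *+ n.+1 = 0.
Proof.
move=> Tt; have [s [_ s0 _ _]] := gd_dsum D.
have sT n : t *+ n.+1 \in s.
  by apply: contraT => /s0 D0; have := gd_suppMn n Tt; rewrite unfold_in D0 eqxx.
have /injectivePn[i [j ij eij]] :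
    ~~ injectiveb (fun i : 'I_(size s).+1 => Ordinal (etrans (index_mem _ s) (sT i))).
  by apply/injectiveP => /leq_card; rewrite !card_ord ltnn.
have {eij} : t *+ i.+1 = t *+ j.+1.
  have /(congr1 (nth 0 s \o val)) /= := eij.
  by rewrite !nth_index.
wlog ltij : i j ij / (i < j)%N => [wlg|].
  by case: (ltngtP i j) => [/wlg|/wlg|/val_inj/eqP/(negP ij)//] + e;
     apply => //; rewrite eq_sym.
move=> /eqP; rewrite -(subnKC ltij) -addnS mulrnDr -subr_eq0 opprD addrA subrr.
rewrite sub0r oppr_eq0 => /eqP e; eexists; exact: e.
Qed.

Lemma gd_supp_zmod : zmod_closed T.
Proof.
have T0 : 0 \in T.
  have [s [_ _ _ sD]] := gd_dsum D.
  have [t Tt] : exists t, t \in T.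
    apply/not_existsP => T0; have := oner_neq0 D.
    have S0 : (\sum_(g <- s) gd_comp D g)%VS = 0%VS.
      by rewrite big1 // => g _; apply: contra_notP (T0 g) => /eqP.
    by rewrite -memv0 -S0 sD memvf.
  by have [n <-] := gd_supp_torsion Tt; apply: gd_suppMn.
split=> // s t Ts Tt; have [[|n]] := gd_supp_torsion Tt.
  by rewrite mulr1n => ->; rewrite subr0.
rewrite mulrS => /eqP; rewrite addrC addr_eq0 => /eqP <-.
by apply: gd_suppD => //; apply: gd_suppMn.
Qed.

HB.instance Definition _ := GRing.isZmodClosed.Build G (gd_supp D) gd_supp_zmod.

End SupportSubgroup.


Section Models.
Variables (R : realType) (G : zmodType) (D : grDivAlg R G).

Local Notation T := (gd_supp D).
Local Notation De := (gd_comp D 0).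
Local Notation "G/T" := (Quotient.quot (gd_supp D)).

(* An identification of D_e with R, C = R1 + Ri or H = R1 + Ri + Rj + Rij.  The
   relations force the listed spanning vectors to be linearly independent.  The
   i of H_type also serves as the fixed imaginary unit of D_e. *)
Variant neutral_type : Type :=
| R_type of De = 1%VS
| C_type (i : D) of i * i = -1 & De = <<[:: 1%R; i]>>%VS
| H_type (i j : D) of i * i = -1 & j * j = -1 & i * j = - (j * i)
    & De = <<[:: 1%R; i; j; (i * j)%R]>>%VS.

Definition is_sign (z : int) : Prop := z = 1 \/ z = -1.

Definition degree_preserving_involution (phi : {linear D -> D}) : Prop :=
  [/\ forall x y, phi (x * y) = phi y * phi x,
      forall x, phi (phi x) = x &
      forall g x, x \in gd_comp D g -> phi x \in gd_comp D g].

Definition conjugation_on_De (E : neutral_type) (phi : D -> D) : Prop :=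
  match E with
  | R_type _ => forall x, x \in De -> phi x = x
  | C_type i _ _ => forall a b : R, phi (a%:A + b *: i) = a%:A - b *: i
  | H_type i j _ _ _ _ => forall a b c d : R,
      phi (a%:A + b *: i + c *: j + d *: (i * j))
        = a%:A - b *: i - c *: j - d *: (i * j)
  end.

Definition K (E : neutral_type) : {pred G} := fun t =>
  (t \in T) && (if E is C_type _ _ _ then (gd_comp D t <= 'C(De))%VS else true).

(* Only the values X t with t in T are meaningful. *)
Definition homogeneous_choice (E : neutral_type) (phi0 : D -> D) (delta : int)
    (X : G -> D) : Prop :=
  forall t, t \in T ->
    [/\ X t \in gd_comp D t, X t != 0 &
        match E with
        | R_type _ => True
        | C_type _ _ _ => t \in K E -> phi0 (X t) = X t *~ delta
        | H_type _ _ _ _ _ _ => forall d, d \in De -> X t * d = d * X t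
        end].

Definition coset_section (xi : G/T -> G) : Prop :=
  forall x : G/T, \pi_(G/T) (xi x) = x.

(* The sign of the real number r when d = r 1. *)
Definition real_sign (d : D) : int := sgz (coord [tuple (1 : D)] ord0 d).

Record triple := Triple {
  tr_g0 : G;
  tr_kappa : G/T -> nat;
  tr_sigma : G/T -> int
}.

Section FixedChoices.
Variables (E : neutral_type) (phi0 : D -> D) (delta : int).
Variables (X : G -> D) (xi : G/T -> G).

(* For t in T, phi0 (X t) is X t or - X t. *)
Definition eta (t : G) : int := if phi0 (X t) == X t then 1 else -1.

Definition tau (g0 : G) (x : G/T) : G := g0 + xi x *+ 2.

(* (G/T)_{g0}; whether g0 g^2 lies in T depends only on the coset gT. *)
Definition self_dual (g0 : G) : {pred G/T} := fun x => tau g0 x \in T.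

Definition admissible (g0 : G) (kappa : G/T -> nat) : Prop :=
  [/\ exists x, kappa x != 0%N,
      finite_set [set x | kappa x != 0%N]%classic,
      forall x, kappa (- \pi_(G/T) g0 - x) = kappa x &
      forall x, x \in self_dual g0 ->
        match E with
        | R_type _ => eta (tau g0 x) = - delta -> ~~ odd (kappa x)
        | C_type _ _ _ =>
            tau g0 x \notin K E -> eta (tau g0 x) = - delta -> ~~ odd (kappa x)
        | H_type _ _ _ _ _ _ => True
        end].

Definition signature_place (g0 : G) : {pred G/T} := fun x =>
  (x \in self_dual g0) &&
  (if E is C_type _ _ _ then tau g0 x \in K E else eta (tau g0 x) == delta).

Definition signature_function (g0 : G) (kappa : G/T -> nat)
    (sigma : G/T -> int) : Prop :=
  forall x, `|sigma x| <= (kappa x)%:Z /\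
    if x \in signature_place g0 then (sigma x = (kappa x)%:Z %[mod 2])%Z
    else sigma x = 0.

Definition inX (p : triple) : Prop :=
  admissible (tr_g0 p) (tr_kappa p) /\
  signature_function (tr_g0 p) (tr_kappa p) (tr_sigma p).

Definition sign_act (e : int) (p : triple) : triple :=
  Triple (tr_g0 p) (tr_kappa p) (fun x => e * tr_sigma p x).

Definition group_act (g : G) (p : triple) : triple :=
  Triple (tr_g0 p - g *+ 2)
    (fun x => tr_kappa p (x - \pi_(G/T) g))
    (fun x => let y : G/T := x - \pi_(G/T) g in
       let t := tr_g0 p + xi y *+ 2 in
       let u := - xi y - g + xi x in
       eta u * real_sign ((X (t + u *+ 2))^-1 * X u * X t * X u)
         * tr_sigma p y).

Definition same_orbit (p p' : triple) : Prop :=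
  exists g e, is_sign e /\ p' = sign_act e (group_act g p).

(* The ordering x_1, ..., x_s of the support of kappa: sup_x lists x_1, ..., x_m,
   while sup_y j and sup_z j are the two members x_{m+2j-1} and x_{m+2j} of the
   j-th pair. *)
Record support_order (p : triple) := SupportOrder {
  sup_m : nat;
  sup_r : nat;
  sup_x : 'I_sup_m -> G/T;
  sup_y : 'I_sup_r -> G/T;
  sup_z : 'I_sup_r -> G/T;
  sup_uniq : uniq (codom sup_x ++ codom sup_y ++ codom sup_z);
  sup_mem : forall x,
    (x \in codom sup_x ++ codom sup_y ++ codom sup_z) = (tr_kappa p x != 0%N);
  sup_self_dual : forall i, sup_x i \in self_dual (tr_g0 p);
  sup_pair : forall j, sup_y j + sup_z j = - \pi_(G/T) (tr_g0 p)
}.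

End FixedChoices.
End Models.

Arguments sup_x {R G D xi p} s _.
Arguments sup_y {R G D xi p} s _.
Arguments sup_z {R G D xi p} s _.

Section GradedAlgebrasWithInvolution.
Variables (R : pzRingType) (G : zmodType).

(* Raw data: a ring with an action of R, homogeneous components and an
   involution.  The usual structures on algebras over R exclude the square
   matrices whose size is not syntactically a successor. *)
Record grInvAlg := GrInvAlg {
  gi_ring : pzRingType;
  gi_scale : R -> gi_ring -> gi_ring;
  gi_comp : G -> gi_ring -> Prop;
  gi_inv : gi_ring -> gi_ring
}.

Definition isomorphic (A B : grInvAlg) : Prop :=
  exists f : gi_ring A -> gi_ring B,
    [/\ bijective f,
        {morph f : a b / a + b} /\ {morph f : a b / a * b} /\ f 1 = 1,
        forall r a, f (gi_scale r a) = gi_scale r (f a),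
        forall g a, gi_comp g a <-> gi_comp g (f a) &
        forall a, f (gi_inv a) = gi_inv (f a)].

End GradedAlgebrasWithInvolution.

(* The two-sided inverse of A, for matrices over a noncommutative ring. *)
Definition matrix_inverse (S : pzRingType) (n : nat) (A : 'M[S]_n) : 'M[S]_n :=
  xget A [set B | A *m B = 1%:M /\ B *m A = 1%:M]%classic.

Section ModelAlgebra.
Variables (R : realType) (G : zmodType) (D : grDivAlg R G).
Variables (E : neutral_type D) (phi0 : D -> D) (delta : int).
Variables (X : G -> D) (xi : Quotient.quot (gd_supp D) -> G).
Variables (p : triple D) (o : support_order xi p).

Local Notation g0 := (tr_g0 p).
Local Notation kappa := (tr_kappa p).
Local Notation sigma := (tr_sigma p).
Local Notation eta := (eta phi0 X).
Local Notation K := (K E).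

(* This is |kappa|, since kappa (sup_y o j) = kappa (sup_z o j). *)
Definition model_size : nat :=
  (\sum_(i < sup_m o) kappa (sup_x o i) +
   \sum_(j < sup_r o) (kappa (sup_z o j) + kappa (sup_z o j)))%N.

(* g_i, for a row (or column) in the i-th of the s blocks. *)
Definition row_degree (a : 'I_model_size) : G :=
  xi (match split a with
      | inl b => sup_x o (tagnat.sig1 b)
      | inr b => if split (tagnat.sig2 b) is inl _
                 then sup_y o (tagnat.sig1 b) else sup_z o (tagnat.sig1 b)
      end).

(* A matrix is homogeneous of degree g when each of its entries d, say in block
   (i, j), lies in D_t for the t such that g_i t g_j^-1 = g. *)
Definition model_comp (g : G) (A : 'M[D]_model_size) : Prop :=
  forall a b t, row_degree a + t - row_degree b = g -> A a b \in gd_comp D t.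

(* The conform_mx only cast sizes: p + q = kappa x in S_signature, and kappa x
   is even in S_symplectic, wherever they are used. *)
Definition S_signature (x : Quotient.quot (gd_supp D)) : 'M[D]_(kappa x) :=
  let p := `|(((kappa x)%:Z + sigma x) %/ 2)%Z|%N in
  let q := `|(((kappa x)%:Z - sigma x) %/ 2)%Z|%N in
  conform_mx 0 (block_mx 1%:M 0 0 (- 1%:M) : 'M[D]_(p + q)).

Definition S_symplectic (n : nat) : 'M[D]_n :=
  conform_mx 0 (block_mx 0 1%:M (- 1%:M) 0 : 'M[D]_(n./2 + n./2)).

Definition S_self_dual (x : Quotient.quot (gd_supp D)) : 'M[D]_(kappa x) :=
  let t := tau xi g0 x in
  match E with
  | R_type _ => if eta t == delta then S_signature x else S_symplectic (kappa x)
  | C_type _ _ _ => if t \in K then S_signature x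
                    else if eta t == delta then 1%:M else S_symplectic (kappa x)
  | H_type i _ _ _ _ _ => if eta t == delta then S_signature x else i%:M
  end.

Definition pair_degree (j : 'I_(sup_r o)) : G :=
  g0 + xi (sup_y o j) + xi (sup_z o j).

Definition S_pair (j : 'I_(sup_r o)) :
    'M[D]_(kappa (sup_z o j) + kappa (sup_z o j)) :=
  block_mx 0 1%:M (delta * eta (pair_degree j))%:~R%:M 0.

Definition Phi : 'M[D]_model_size :=
  block_mx
    (\mxdiag_(i < sup_m o) (X (tau xi g0 (sup_x o i)) *: S_self_dual (sup_x o i)))
    0 0
    (\mxdiag_(j < sup_r o) (X (pair_degree j) *: S_pair j)).

Definition model_inv (A : 'M[D]_model_size) : 'M[D]_model_size :=
  matrix_inverse Phi *m map_mx phi0 A^T *m Phi.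

Definition M : grInvAlg R G :=
  @GrInvAlg R G 'M[D]_model_size (fun r => map_mx ( *:%R r)) model_comp model_inv.

End ModelAlgebra.

(* Main.v *)
Require Import Defs.
From HB Require Import structures.
From mathcomp Require Import all_boot all_order all_algebra all_field.
From mathcomp Require Import boolp classical_sets cardinality reals.
From mathcomp Require Import zify ring lra.

(* An isomorphism of graded algebras between M_k(D) and M_k'(D) is conjugation by
   a matrix P (Skolem-Noether), which may be taken homogeneous, of degree g say.  It
   is compatible with the involutions exactly when P^* Phi' P = r Phi for some real
   number r != 0.  Comparing degrees gives g0' = g0 - 2g, and P maps the block of a
   coset x bijectively to the block of x + g, so that kappa' is the translate of
   kappa.  On a self-dual block carrying a signature, X_u P has entries in D_e, where
   u measures the failure of xi to be equivariant, and Sylvester's law of inertia over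
   D_e = R, C or H shows that the signatures agree up to the sign of
   r eta(u) X_(t+2u)^-1 X_u X_t X_u.

   Conversely, Phi is monomial: a signed permutation matrix, for an involution of
   the rows, with homogeneous coefficients.  A monomial P is then found by solving
   one equation in D for each orbit of that involution; for orbits with two elements
   one of the two entries of P is arbitrary, and for fixed rows the equation amounts
   to extracting a square root in R or C. *)

(** D is a division algebra only in the graded sense: a sum of homogeneous elements of different
    degrees may be a zero divisor, and the two matrix sizes are not known to agree at the outset.
    Hence P is not read off from dimensions of modules but produced by averaging over a Casimir
    element of D, and later linear algebra is moved into the division ring D_e by multiplying the
    entries of a block by a suitable X_u. There, systems of equations are handled by counting real
    dimensions. The factor r is a single real number because P^* Phi' P Phi^-1 is central and Z(D) =
    R; this is where the one global sign of the orbit comes from. Signatures survive only where X_t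
    commutes with D_e and the diagonal coefficients are real. Every other block is congruent to its
    negative: symplectic blocks and pairs because one of two entries is free, blocks over C outside
    K because X_t conjugates D_e and square roots exist there, blocks over H with coefficient i
    because phi0 j i j = - i. This is the reason for the different shapes of S_i. *)

Set Implicit Arguments.
Unset Strict Implicit.
Unset Printing Implicit Defensive.

Import Order.TTheory GRing.Theory Num.Theory.
Local Open Scope ring_scope.
Local Open Scope quotient_scope.

(** * Identities in abelian groups *)

(* Decided by reflection: the integer coefficients of the atoms are compared. *)
Inductive zexpr := ZVar of nat | ZZero | ZAdd of zexpr & zexpr | ZOpp of zexpr.

Fixpoint zeval (V : zmodType) (env : seq V) (e : zexpr) : V :=
  match e with
  | ZVar i => nth 0 env i
  | ZZero => 0
  | ZAdd e1 e2 => zeval env e1 + zeval env e2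
  | ZOpp e1 => - zeval env e1
  end.

Fixpoint zcoef (e : zexpr) (i : nat) : int :=
  match e with
  | ZVar j => if j == i then 1 else 0
  | ZZero => 0
  | ZAdd e1 e2 => zcoef e1 i + zcoef e2 i
  | ZOpp e1 => - zcoef e1 i
  end.

Lemma zevalE (V : zmodType) (env : seq V) e :
  zeval env e = \sum_(i < size env) env`_i *~ zcoef e i.
Proof.
elim: e => [j||e1 IH1 e2 IH2|e1 IH1] /=.
- have [lt_j|ge_j] := ltnP j (size env).
    rewrite (bigD1 (Ordinal lt_j)) //= eqxx big1 ?addr0 // => i neq_ij.
    by case: eqP => // ji; case/eqP: neq_ij; apply: val_inj.
  rewrite nth_default // big1 // => i _; case: eqP => // ji.
  by move: ge_j; rewrite ji leqNgt ltn_ord.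
- by rewrite big1.
- by rewrite IH1 IH2 -big_split; apply: eq_bigr => i _; rewrite /= mulrzDr.
- by rewrite IH1 -sumrN; apply: eq_bigr => i _; rewrite mulrNz.
Qed.

Lemma zmod_decide (V : zmodType) (env : seq V) e1 e2 :
  all (fun i => zcoef e1 i == zcoef e2 i) (iota 0 (size env)) ->
  zeval env e1 = zeval env e2.
Proof.
move=> /allP eq12; rewrite !zevalE; apply: eq_bigr => i _.
by rewrite (eqP (eq12 (val i) _)) // mem_iota /=.
Qed.

Ltac zmem x l :=
  match l with
  | nil => constr:(false)
  | x :: _ => constr:(true)
  | _ :: ?l' => zmem x l'
  end.

Ltac zatoms t l :=
  match t with
  | (?a + ?b)%R => let l1 := zatoms a l in zatoms b l1
  | (- ?a)%R => zatoms a l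
  | (?a *+ 2)%R => zatoms a l
  | (0)%R => l
  | _ => match zmem t l with true => l | false => constr:(t :: l) end
  end.

Ltac zindex x l :=
  match l with
  | x :: _ => constr:(0%N)
  | _ :: ?l' => let n := zindex x l' in constr:(S n)
  end.

Ltac zreify t l :=
  match t with
  | (?a + ?b)%R => let e1 := zreify a l in let e2 := zreify b l in constr:(ZAdd e1 e2)
  | (- ?a)%R => let e1 := zreify a l in constr:(ZOpp e1)
  | (?a *+ 2)%R => let e1 := zreify a l in constr:(ZAdd e1 e1)
  | (0)%R => constr:(ZZero)
  | _ => let n := zindex t l in constr:(ZVar n)
  end.

Ltac zmod :=
  match goal with
  | |- @eq ?T ?t1 ?t2 =>
    let l0 := constr:(@nil T) in
    let l1 := zatoms t1 l0 in
    let l := zatoms t2 l1 in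
    let e1 := zreify t1 l in
    let e2 := zreify t2 l in
    exact (@zmod_decide _ l e1 e2 isT)
  end.

(** [zmod] uses no hypotheses. One equation is brought in by checking, as a formal identity, that
    the two sides of the goal differ by exactly as much as the two sides of the hypothesis. *)
Lemma zmod_shift (V : zmodType) (a b c d : V) : a = b -> c - d = a - b -> c = d.
Proof. by move=> ->; rewrite subrr => /eqP; rewrite subr_eq0 => /eqP. Qed.

Ltac zmod_from H := apply: (zmod_shift H); zmod.

(** * Graded division algebras *)

Section GradedDivision.
Variables (R : fieldType) (G : zmodType) (D : grDivAlg R G).
Local Notation "'D_ g" := (gd_comp D g) (at level 8, g at level 2).
Local Notation De := (gd_comp D 0).

Lemma compM g h x y : x \in 'D_ g -> y \in 'D_ h -> x * y \in 'D_ (g + h).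
Proof. by move=> gx hy; apply: subvP (gd_mulS D g h) _ _; apply: memv_mul. Qed.

Lemma comp_mem g h x : g = h -> x \in 'D_ g -> x \in 'D_ h.
Proof. by move=> ->. Qed.

Lemma homog_ind (P : D -> Prop) :
    P 0 -> (forall x y, P x -> P y -> P (x + y)) ->
    (forall g x, x \in 'D_ g -> P x) -> forall x, P x.
Proof.
move=> P0 PD Ph x; have [s [_ _ _ sD]] := gd_dsum D.
have: x \in (\sum_(g <- s) 'D_ g)%VS by rewrite sD memvf.
elim: s {sD} x => [|g s IH] x; first by rewrite big_nil memv0 => /eqP ->.
rewrite big_cons => /memv_addP[u Du [v Dv ->]].
by apply: PD; [apply: Ph Du | apply: IH].
Qed.

(** Directness of a finite sum is an equality of dimensions. Comparing the dimension of the whole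
    with those of ['D_ g] and of the sum [U] of the other components leaves nothing for their
    intersection, and ['D_ h] lies in [U] when h differs from g. *)
Lemma comp_degree g h x : x \in 'D_ g -> x \in 'D_ h -> x != 0 -> g = h.
Proof.
move=> gx hx x0; apply/eqP; apply: contraNT x0 => neq_gh.
have [s [s_uniq s0 sdir _]] := gd_dsum D.
have in_s k : x \in 'D_ k -> (k \notin s) -> x == 0.
  by move=> kx /s0 k0; rewrite k0 memv0 in kx.
have [gs|/in_s->//] := boolP (g \in s).
have [hs|/in_s->//] := boolP (h \in s).
move: sdir; rewrite directvE /= => /eqP dim_s.
set U := (\sum_(k <- s | k != g) 'D_ k)%VS.
have sub_U : ('D_ h <= U)%VS.
  by rewrite /U (big_rem _ hs) /= eq_sym neq_gh addvSl.
have dimU : (\dim U <= \sum_(k <- s | k != g) \dim 'D_ k)%N.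
  exact: dimv_leq_sum.
have dir : \dim ('D_ g :&: U)%VS = 0%N.
  apply/eqP; rewrite -leqn0 -(leq_add2l (\dim ('D_ g + U))) addn0.
  rewrite dimv_sum_cap /U -(bigD1_seq g) // dim_s (bigD1_seq g) //=.
  by rewrite leq_add2l.
move: (dir) => /eqP; rewrite dimv_eq0 => /eqP dir0.
by rewrite -memv0 -dir0 memv_cap gx (subvP sub_U).
Qed.

Lemma mul_homog_neq0 g x y : x \in 'D_ g -> x != 0 -> y != 0 -> x * y != 0.
Proof. by move=> gx x0 y0; rewrite mulrI_eq0 //; apply/mulrI/(gd_unit gx). Qed.

Lemma amull_De x : x \in De -> x != 0 -> (amull x @: De)%VS = De.
Proof.
move=> De_x x0; apply/eqP; rewrite eqEdim; apply/andP; split.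
  apply/subvP => _ /memv_imgP[y De_y ->]; rewrite lfunE /=.
  by apply: comp_mem (compM De_x De_y); rewrite addr0.
by rewrite limg_dim_eq // (eqP (lker0_amull (gd_unit De_x x0))) capv0.
Qed.

(** Left multiplication by a nonzero x of D_e maps D_e onto itself, so x = x z for some z in D_e,
    and cancelling x gives z = 1. *)
Lemma one_De : 1 \in De.
Proof.
have /gd_suppP[x De_x x0] : 0 \in gd_supp D by case: (gd_supp_zmod D).
have: x \in (amull x @: De)%VS by rewrite amull_De.
case/memv_imgP => z De_z; rewrite lfunE /= -{1}[x]mulr1.
by move/(mulrI (gd_unit De_x x0)) => ->.
Qed.

Lemma scal_De r : r%:A \in De.
Proof. by apply: memvZ; exact: one_De. Qed.

(** A degree in the support has finite order, so some power of x lies in D_e, where it has an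
    inverse z; then x^-1 is a lower power of x times z. *)
Lemma comp_inv g x : x \in 'D_ g -> x != 0 -> x^-1 \in 'D_ (- g).
Proof.
move=> gx x0; have xU := gd_unit gx x0.
have Tg : g \in gd_supp D by apply/gd_suppP; exists x.
have [n gn] := gd_supp_torsion Tg.
have Dpow m : x ^+ m \in 'D_ (g *+ m).
  elim: m => [|m IH]; first by rewrite expr0 mulr0n one_De.
  by rewrite exprS mulrS; apply: compM.
have xn0 : x ^+ n.+1 != 0.
  by apply: contraTneq (unitrX n.+1 xU) => ->; rewrite unitr0.
have Den : x ^+ n.+1 \in De by rewrite -gn.
have: 1 \in (amull (x ^+ n.+1) @: De)%VS by rewrite amull_De // one_De.
case/memv_imgP => z De_z; rewrite lfunE /= exprS -mulrA => e.
have -> : x^-1 = x ^+ n * z by apply: (mulrI xU); rewrite mulrV.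
apply: comp_mem (compM (Dpow n) De_z); rewrite addr0.
by move/eqP: gn; rewrite mulrS addrC addr_eq0 => /eqP.
Qed.

Lemma homog_inv_neq0 g x : x \in 'D_ g -> x != 0 -> x^-1 != 0.
Proof.
by move=> gx x0; apply: contraTneq (gd_unit gx x0) => e; rewrite -unitrV e unitr0.
Qed.

Lemma comp_suppP g x : x \in 'D_ g -> x != 0 -> g \in gd_supp D.
Proof. by move=> gx x0; apply/gd_suppP; exists x. Qed.

Lemma comp_out g x : g \notin gd_supp D -> x \in 'D_ g -> x = 0.
Proof. by move=> nTg gx; apply/eqP; apply: contraNT nTg; apply: comp_suppP. Qed.

Lemma supp_finite : exists2 s : seq G, uniq s & forall t, (t \in s) = (t \in gd_supp D).
Proof.
have [s [s_uniq s0 _ _]] := gd_dsum D.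
exists [seq t <- s | t \in gd_supp D]; first exact: filter_uniq.
move=> t; rewrite mem_filter; case: (boolP (t \in gd_supp D)) => //= Tt.
by apply: contraT => /s0 D0; rewrite unfold_in D0 eqxx in Tt.
Qed.

Section Central.
Hypothesis D_central : 'Z({:D})%VS = 1%VS.

Lemma central_scalar x : (forall g y, y \in 'D_ g -> y * x = x * y) ->
  exists r : R, x = r%:A.
Proof.
move=> comm_x; have: x \in 'Z({:D})%VS.
  rewrite memv_cap memvf; apply/centvP => y _.
  elim/homog_ind: y => [|y z ey ez|g y gy]; last by rewrite (comm_x g).
    by rewrite mulr0 mul0r.
  by rewrite mulrDl mulrDr ey ez.
by rewrite D_central => /vlineP.
Qed.

(* In a shortest relation one left factor may be taken to be 1; bracketing with
   homogeneous elements then shows that all left factors are central. *)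
Lemma sandwich_inj (I : finType) (b : I -> D) (beta : I -> G) :
    (forall i, b i \in 'D_ (beta i)) ->
    (forall h (r : I -> R), \sum_(i | beta i == h) r i *: b i = 0 ->
       forall i, beta i = h -> r i = 0) ->
  forall g (a : I -> D), (forall i, a i \in 'D_ (g - beta i)) ->
    (forall h x, x \in 'D_ h -> \sum_i a i * x * b i = 0) -> forall i, a i = 0.
Proof.
move=> Db b_free g a; have [n] := ubnP #|[pred i | a i != 0]|.
elim: n g a => // n IH g a /ltnSE le_n Da sum0.
have [/forallP a0|/forallPn[i0 ai0]] := boolP [forall i, a i == 0].
  by move=> i; apply/eqP.
pose c i := (a i0)^-1 * a i.
have Uai0 := gd_unit (Da i0) ai0.
have Dc i : c i \in 'D_ (beta i0 - beta i).
  by apply: comp_mem (compM (comp_inv (Da i0) ai0) (Da i)); rewrite opprB addrA subrK.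
have ci0 : c i0 = 1 by rewrite /c mulVr.
have sumc0 h x : x \in 'D_ h -> \sum_i c i * x * b i = 0.
  move=> hx; transitivity ((a i0)^-1 * \sum_i a i * x * b i).
    by rewrite mulr_sumr; apply: eq_bigr => i _; rewrite !mulrA.
  by rewrite (sum0 h) ?mulr0.
have comm_c i h y : y \in 'D_ h -> y * c i = c i * y.
  move=> hy; apply/eqP; rewrite -subr_eq0; apply/eqP; move: i.
  apply: (IH (h + beta i0)) => [|i|k x kx].
  - apply: leq_trans le_n; apply: proper_card; apply/properP; split.
      apply/fintype.subsetP => i; rewrite !inE /c; apply: contraNneq => ->.
      by rewrite !mulr0 mul0r subrr.
    by exists i0; rewrite !inE // ci0 mulr1 mul1r subrr eqxx.
  - rewrite memvB //; first by apply: comp_mem (compM hy (Dc i)); rewrite addrA.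
    by apply: comp_mem (compM (Dc i) hy); rewrite addrAC [beta i0 + h]addrC.
  - transitivity (y * (\sum_i c i * x * b i) - \sum_i c i * (y * x) * b i).
      rewrite mulr_sumr -sumrB; apply: eq_bigr => i _.
      by rewrite !mulrBl !mulrA.
    by rewrite (sumc0 k) // (sumc0 (h + k)) ?compM // mulr0 subrr.
have /choice[r cE] i : exists r : R, c i = r%:A.
  by apply: central_scalar => h y; apply: comm_c.
(* Taking x = 1 leaves a real relation between the b_i. A real c_i has degree 0, so only the indices
   with beta i = beta i0 contribute, and for these the b_i are independent. *)
have: r i0 = 0.
  apply: (b_free (beta i0)) => //.
  rewrite -[RHS](sumc0 0 1 one_De) [RHS](bigID (fun i => beta i == beta i0)) /=.
  rewrite [X in _ = _ + X]big1 ?addr0 => [|i neq_i].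
    by apply: eq_bigr => i _; rewrite cE mulr1 mulr_algl.
  have [->|ci] := eqVneq (c i) 0; first by rewrite !mul0r.
  have De_ci : c i \in De by rewrite cE scal_De.
  move/eqP: (comp_degree (Dc i) De_ci ci).
  by rewrite subr_eq0 eq_sym (negPf neq_i).
by move=> r0; have := oner_neq0 D; rewrite -ci0 cE r0 scale0r eqxx.
Qed.

End Central.
End GradedDivision.

(** * Casimir elements of a graded division algebra *)

Section Casimir.
Variables (R : fieldType) (G : zmodType) (D : grDivAlg R G).
Local Notation "'D_ g" := (gd_comp D g) (at level 8, g at level 2).
Local Notation De := (gd_comp D 0).

(** Such a B is an additive map on the tensor square of D over R; quantifying over all B expresses
    an identity between tensors without forming the tensor product. *)
Definition balanced (V : zmodType) (B : D -> D -> V) : Prop :=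
  [/\ forall x x' y, B (x + x') y = B x y + B x' y,
      forall x y y', B x (y + y') = B x y + B x y' &
      forall r x y, B (r *: x) y = B x (r *: y)].

Section Balanced.
Variables (V : zmodType) (B : D -> D -> V).
Hypothesis B_bal : balanced B.

Lemma balanced0l y : B 0 y = 0.
Proof. by case: B_bal => BD _ _; apply: (addrI (B 0 y)); rewrite -BD !addr0. Qed.

Lemma balanced0r x : B x 0 = 0.
Proof. by case: B_bal => _ BD _; apply: (addrI (B x 0)); rewrite -BD !addr0. Qed.

Lemma balanced_suml (I : finType) (F : I -> D) y :
  B (\sum_i F i) y = \sum_i B (F i) y.
Proof.
case: B_bal => BD _ _; exact: (big_morph (fun x => B x y) (fun u v => BD u v y) (balanced0l y)).
Qed.

Lemma balanced_sumr (I : finType) x (F : I -> D) :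
  B x (\sum_i F i) = \sum_i B x (F i).
Proof.
case: B_bal => _ BD _; exact: (big_morph (B x) (BD x) (balanced0r x)).
Qed.
End Balanced.

Lemma exists_functional : exists lam : {scalar D}, lam 1 != 0.
Proof.
have [k k0] : exists k, coord (vbasis {:D}) k 1 != 0.
  apply/existsP; rewrite -negb_forall; apply/negP => /forallP k0.
  have := oner_neq0 D; rewrite (coord_vbasis (memvf 1)) big1 ?eqxx // => i _.
  by rewrite (eqP (k0 i)) scale0r.
by exists (coord (vbasis {:D}) k).
Qed.

(* a and b are dual bases for the form (x, y) |-> lam (x y), which is
   nondegenerate as soon as lam 1 != 0. *)
Lemma De_casimir : exists m (a b : 'I_m -> D),
  [/\ (0 < m)%N,
      forall i, [/\ a i \in De, b i \in De & a i != 0],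
      forall r : 'I_m -> R, \sum_i r i *: b i = 0 -> forall i, r i = 0 &
      forall (V : zmodType) (B : D -> D -> V), balanced B ->
        forall c, c \in De -> \sum_i B (c * a i) (b i) = \sum_i B (a i) (b i * c)].
Proof.
have [lam lam1] := exists_functional.
pose b (i : 'I_(\dim De)) := (vbasis De)`_i.
have De_b i : b i \in De by apply/vbasis_mem/mem_nth; rewrite size_tuple.
have DeM x y : x \in De -> y \in De -> x * y \in De.
  by move=> De_x De_y; apply: comp_mem (compM De_x De_y); rewrite addr0.
have b_span y : y \in De -> exists r : 'I_(\dim De) -> R, y = \sum_i r i *: b i.
  by move=> De_y; exists (fun i => coord (vbasis De) i y); rewrite {1}(coord_vbasis De_y).
have b_free (r : 'I_(\dim De) -> R) : \sum_i r i *: b i = 0 -> forall i, r i = 0.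
  by move: r; apply/freeP; apply: basis_free (vbasisP De).
(* If z were nonzero, z^-1 would be a combination of the b_i, whence lam 1 = lam (z^-1 z) = 0. *)
have nondeg z : z \in De -> (forall i, lam (b i * z) = 0) -> z = 0.
  move=> De_z bz0; apply/eqP; apply: contraNT lam1 => z0.
  have De_zV : z^-1 \in De by rewrite -oppr0; apply: comp_inv.
  have [r rE] := b_span _ De_zV.
  rewrite -(mulVr (gd_unit De_z z0)) rE mulr_suml linear_sum big1 // => i _.
  by rewrite -scalerAl scalarZ bz0 /= mulr0.
pose Gm : 'M[R]_(\dim De) := \matrix_(i, j) lam (b i * b j).
have GmU : Gm \in unitmx.
  rewrite unitmxE unitfE; apply/negP => /det0P[v v0 vG].
  have ev : \sum_i v 0 i *: b i = 0.
    apply/eqP; apply: contraT => y0; set y := \sum_i _ in y0.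
    have De_y : y \in De by apply: memv_suml => i _; apply: memvZ.
    have De_yV : y^-1 \in De by rewrite -oppr0; apply: comp_inv.
    have [r rE] := b_span _ De_yV.
    case/eqP: lam1.
    rewrite -(mulrV (gd_unit De_y y0)) rE mulr_sumr linear_sum big1 // => j _.
    rewrite -scalerAr scalarZ /= /y mulr_suml linear_sum.
    have := congr1 (fun M : 'rV_(\dim De) => M 0 j) vG; rewrite !mxE => e.
    rewrite (eq_bigr (fun i => v 0 i * Gm i j)) ?e ?mulr0 // => i _.
    by rewrite -scalerAl scalarZ mxE.
  by case/eqP: v0; apply/rowP => i; rewrite mxE (b_free _ ev).
pose a j := \sum_l (invmx Gm) l j *: b l.
have De_a j : a j \in De by apply: memv_suml => l _; apply: memvZ.
have dual i j : lam (b i * a j) = (i == j)%:R.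
  have := congr1 (fun M : 'M_(\dim De) => M i j) (mulmxV GmU); rewrite !mxE => <-.
  rewrite mulr_sumr linear_sum; apply: eq_bigr => l _.
  by rewrite -scalerAr scalarZ mxE mulrC.
have expand_b y : y \in De -> y = \sum_j lam (y * a j) *: b j.
  move=> De_y; have [r rE] := b_span _ De_y.
  rewrite {1}rE; apply: eq_bigr => j _; congr (_ *: _).
  rewrite rE mulr_suml linear_sum (bigD1 j) //= -scalerAl scalarZ dual eqxx mulr1.
  rewrite big1 ?addr0 // => i neq_ij.
  by rewrite -scalerAl scalarZ dual (negPf neq_ij) /= mulr0.
have expand_a y : y \in De -> y = \sum_i lam (b i * y) *: a i.
  move=> De_y; apply/eqP; rewrite -subr_eq0; apply/eqP; apply: nondeg => [|j].
    by rewrite memvB //; apply: memv_suml => i _; apply: memvZ.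
  rewrite mulrBr linearB /= mulr_sumr linear_sum (bigD1 j) //= -scalerAr scalarZ.
  rewrite dual eqxx mulr1 big1 ?addr0 ?subrr // => i neq_ij.
  by rewrite -scalerAr scalarZ dual eq_sym (negPf neq_ij) /= mulr0.
exists (\dim De), a, b; split => //.
- rewrite lt0n dimv_eq0; apply: contraTneq (one_De D) => ->.
  by rewrite memv0 oner_eq0.
- move=> i; split=> //; apply/eqP => a0; have /eqP := dual i i.
  by rewrite a0 mulr0 linear0 eqxx eq_sym oner_eq0.
move=> V B B_bal c De_c; have [_ _ Bmid] := B_bal.
(* Expanding c a_i along the a_j and b_j c along the b_i produces the same coefficients lam (b_j c
   a_i). *)
transitivity (\sum_i \sum_j B (lam (b j * (c * a i)) *: a j) (b i)).
  apply: eq_bigr => i _; rewrite -(balanced_suml B_bal); congr (B _ _).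
  by apply: expand_a; apply: DeM.
rewrite exchange_big /=; apply: eq_bigr => j _.
transitivity (\sum_i B (a j) (lam (b j * c * a i) *: b i)).
  by apply: eq_bigr => i _; rewrite Bmid mulrA.
by rewrite -(balanced_sumr B_bal) -expand_b // DeM.
Qed.

(** By the last clause the tensor formed from the pairs a_i, b_i commutes with D. The independence
    of the b_i in each degree and one nonzero a_i are what [sandwich_inj] needs to provide an
    average that does not vanish. *)
Definition casimir (I : finType) (a b : I -> D) (beta : I -> G) : Prop :=
  [/\ forall i, b i \in 'D_ (beta i),
      forall i, a i \in 'D_ (- beta i),
      exists i, a i != 0,
      forall h (r : I -> R), \sum_(i | beta i == h) r i *: b i = 0 ->
        forall i, beta i = h -> r i = 0 &
      forall (V : zmodType) (B : D -> D -> V), balanced B ->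
        forall c, \sum_i B (c * a i) (b i) = \sum_i B (a i) (b i * c)].

(** The Casimir element of D_e is induced up to D: each pair a, b is replaced by the pairs X_t a, b
    X_t^-1 for t in the support, as one averages over representatives of cosets. *)
Lemma exists_casimir :
  exists (I : finType) (a b : I -> D) (beta : I -> G), casimir a b beta.
Proof.
have [m [a [b [m_gt0 De_ab b_free casDe]]]] := De_casimir.
have [s s_uniq s_mem] := supp_finite D.
pose t := tnth (in_tuple s).
have Tt i : t i \in gd_supp D by rewrite -s_mem mem_tnth.
pose X g := vpick ('D_ g).
have DX g : X g \in 'D_ g by apply: memv_pick.
have X0 g : g \in gd_supp D -> X g != 0 by rewrite vpick0.
have XU g : g \in gd_supp D -> X g \is a GRing.unit by move/X0/(gd_unit (DX g)).
exists ('I_(size s) * 'I_m)%type, (fun i => X (t i.1) * a i.2),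
  (fun i => b i.2 * (X (t i.1))^-1), (fun i => - t i.1); split.
- case=> i k /=; have [_ De_b _] := De_ab k.
  by apply: comp_mem (compM De_b (comp_inv (DX _) (X0 _ (Tt i)))); rewrite add0r.
- case=> i k /=; have [De_a _ _] := De_ab k.
  by apply: comp_mem (compM (DX _) De_a); rewrite addr0 opprK.
- have s_gt0 : (0 < size s)%N.
    have : 0 \in s by rewrite s_mem; case: (gd_supp_zmod D).
    by case: (s).
  exists (Ordinal s_gt0, Ordinal m_gt0) => /=.
  have [_ _ a0] := De_ab (Ordinal m_gt0).
  by apply: mul_homog_neq0 (DX _) _ a0; apply: X0.
- move=> h r sum0; have {sum0} : \sum_(i | t i == - h) \sum_k
      r (i, k) *: (b k * (X (t i))^-1) = 0.
    rewrite -[RHS]sum0 (pair_big (fun i => t i == - h) xpredT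
      (fun i k => r (i, k) *: (b k * (X (t i))^-1))) /=.
    by apply: eq_big => [[i k]|[i k] _] //=; rewrite andbT eqr_oppLR.
  move=> sum0 [i k] /= e; have ti : t i = - h by rewrite -e opprK.
  move: sum0; rewrite (bigD1 i) ?ti //= [X in _ + X]big1 ?addr0 => [sum0|j /andP[tj neq_ji]].
    apply: (b_free (fun k => r (i, k))).
    apply: (mulIr (_ : (X (- h))^-1 \is a GRing.unit)).
      by rewrite unitrV XU // -ti.
    rewrite mul0r mulr_suml -[RHS]sum0; apply: eq_bigr => j _.
    by rewrite -scalerAl.
  case/eqP: neq_ji; apply: val_inj; apply/eqP.
  rewrite -(nth_uniq 0 (ltn_ord j) (ltn_ord i) s_uniq).
  by move/eqP: tj; rewrite -ti /t !(tnth_nth 0) /= => ->.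
move=> V B B_bal c; have [BDl BDr Bmid] := B_bal.
elim/homog_ind: c => [|x y ex ey|h c hc].
- by rewrite !big1 // => i _; rewrite ?mul0r ?mulr0 (balanced0l B_bal, balanced0r B_bal).
- under eq_bigr do rewrite mulrDl BDl.
  under [RHS]eq_bigr do rewrite mulrDr BDr.
  by rewrite !big_split /= ex ey.
have [->|c0] := eqVneq c 0.
  by rewrite !big1 // => i _; rewrite ?mul0r ?mulr0 (balanced0l B_bal, balanced0r B_bal).
have Th : h \in gd_supp D by apply: comp_suppP hc c0.
pose F g := \sum_k B (X g * a k) (b k * (X g)^-1 * c).
transitivity (\sum_(g <- s) F (h + g)).
  transitivity (\sum_i \sum_k B (c * (X (t i) * a k)) (b k * (X (t i))^-1)).
    by rewrite pair_bigA.
  rewrite [RHS]big_tnth; apply: eq_bigr => i _; rewrite -/(t i).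
  have Tht : h + t i \in gd_supp D by apply: gd_suppD.
  (* Since c X_t = X_(h+t) y with y in D_e, invariance over D_e passes y to the other factor. *)
  pose y := (X (h + t i))^-1 * c * X (t i).
  have De_y : y \in De.
    apply: comp_mem (compM (compM (comp_inv (DX _) (X0 _ Tht)) hc) (DX (t i))).
    by rewrite opprD addrAC subrK addNr.
  have Bt : balanced (fun u v => B (X (h + t i) * u) (v * (X (t i))^-1)).
    split=> [u u' v|u v v'|q u v]; rewrite ?mulrDr ?mulrDl ?BDl ?BDr //.
    by rewrite -scalerAr -scalerAl Bmid.
  transitivity (\sum_k B (X (h + t i) * (y * a k)) (b k * (X (t i))^-1)).
    by apply: eq_bigr => k _; rewrite /y !mulrA mulrV ?mul1r ?XU.
  rewrite (casDe _ _ Bt y De_y); apply: eq_bigr => k _; congr (B _ _).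
  by rewrite /y -!mulrA mulrV ?mulr1 // XU.
rewrite -(big_map (+%R h) xpredT F) /=.
(* Translation by h permutes the support. *)
have -> : \sum_(g <- [seq h + g | g <- s]) F g = \sum_(g <- s) F g.
  apply: perm_big; apply: uniq_perm => //; first by rewrite map_inj_uniq //; apply: addrI.
  move=> g; rewrite s_mem; apply/mapP/idP => [[g' sg' ->]|Tg].
    by apply: gd_suppD => //; rewrite -s_mem.
  exists (g - h); last by rewrite addrC subrK.
  by rewrite s_mem; case: (gd_supp_zmod D) => _; apply.
rewrite [LHS]big_tnth; transitivity (\sum_i \sum_k B (X (t i) * a k) (b k * (X (t i))^-1 * c)).
  by [].
by rewrite pair_bigA.
Qed.

End Casimir.

(** * Isomorphisms of graded matrix algebras *)

Section DeltaMatrices.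
Variables (S : nzRingType).

Lemma scale_delta_mxE m n (d : S) (a i : 'I_m) (b j : 'I_n) :
  (d *: delta_mx a b) i j = if (i == a) && (j == b) then d else 0.
Proof. by rewrite !mxE; case: ifP => _; rewrite ?mulr1 ?mulr0. Qed.

Lemma mulmx_delta_sum m n p (A : 'M[S]_(m, n)) (b : 'I_n) (c : 'I_p) :
  A *m delta_mx b c = \sum_i A i b *: delta_mx i c.
Proof.
apply/matrixP => i j; rewrite mxE summxE (bigD1 b) //= (bigD1 i) //= scale_delta_mxE eqxx.
rewrite mxE eqxx /= big1 => [|k nk]; last by rewrite mxE (negPf nk) mulr0.
rewrite big1 => [|k nk]; last by rewrite scale_delta_mxE eq_sym (negPf nk).
by case: (j == c); rewrite ?mulr1 ?mulr0.
Qed.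

Lemma delta_mulmx_sum m n p (A : 'M[S]_(m, n)) (b : 'I_m) (c : 'I_p) :
  delta_mx c b *m A = \sum_j A b j *: delta_mx c j.
Proof.
apply/matrixP => i j; rewrite mxE summxE (bigD1 b) //= (bigD1 j) //= scale_delta_mxE eqxx.
rewrite mxE eqxx big1 => [|k nk]; last by rewrite mxE (negPf nk) andbF mul0r.
rewrite big1 => [|k nk]; last by rewrite scale_delta_mxE [j == k]eq_sym (negPf nk) andbF.
by rewrite andbT; case: (i == c); rewrite ?mul1r ?mul0r.
Qed.

Lemma mul_scale_delta_mx m n p (d e : S) (a : 'I_m) (b b' : 'I_n) (c : 'I_p) :
  (d *: delta_mx a b) *m (e *: delta_mx b' c)
    = if b == b' then (d * e) *: delta_mx a c else 0.
Proof.
apply/matrixP => i j; rewrite mxE (bigD1 b) //= big1 => [|k nk]; last first.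
  by rewrite scale_delta_mxE (negPf nk) andbF mul0r.
rewrite !scale_delta_mxE eqxx andbT addr0.
have [_|_] /= := eqVneq b b'; last by rewrite !mxE mulr0.
by rewrite ?eqxx scale_delta_mxE; do 2!case: eqP => _ /=; rewrite ?mulr0 ?mul0r.
Qed.

End DeltaMatrices.

(** * A graded Skolem-Noether theorem *)

Section SkolemNoether.
Variables (R : fieldType) (G : zmodType) (D : grDivAlg R G).
Local Notation "'D_ g" := (gd_comp D g) (at level 8, g at level 2).
Local Notation De := (gd_comp D 0).
Hypothesis D_central : 'Z({:D})%VS = 1%VS.

Definition homog_mx m n (deg : 'I_m -> G) (deg' : 'I_n -> G) g (A : 'M[D]_(m, n)) :=
  forall a b t, deg a + t - deg' b = g -> A a b \in 'D_ t.

Lemma homog_mxE m n (deg : 'I_m -> G) (deg' : 'I_n -> G) g (A : 'M[D]_(m, n)) a b :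
  homog_mx deg deg' g A -> A a b \in 'D_ (g - deg a + deg' b).
Proof. by apply; zmod. Qed.

Lemma homog_scale_delta m n (deg : 'I_m -> G) (deg' : 'I_n -> G) a b d t :
  d \in 'D_ t -> homog_mx deg deg' (deg a + t - deg' b) (d *: delta_mx a b).
Proof.
move=> td i j s e; rewrite scale_delta_mxE; case: eqP => [ei|_] /=; last exact: mem0v.
case: eqP => [ej|_]; last exact: mem0v.
by apply: comp_mem td; rewrite ei ej in e; zmod_from (esym e).
Qed.

Lemma mx_central n (N : 'M[D]_n) (a0 : 'I_n) :
  (forall A, N *m A = A *m N) -> exists r : R, N = (r%:A)%:M.
Proof.
move=> N_comm.
have offE d (a b c : 'I_n) : (N *m (d *: delta_mx a b)) c b = N c a * d.
  rewrite mxE (bigD1 a) //= big1 => [|k nk]; rewrite scale_delta_mxE ?eqxx ?addr0 //.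
  by rewrite (negPf nk) mulr0.
have offE' d (a b c : 'I_n) : ((d *: delta_mx a b) *m N) a c = d * N b c.
  rewrite mxE (bigD1 b) //= big1 => [|k nk]; rewrite scale_delta_mxE ?eqxx ?addr0 //.
  by rewrite (negPf nk) andbF mul0r.
have diag d a b : N a a * d = d * N b b by rewrite -(offE d a b a) N_comm offE'.
have [r rE] : exists r : R, N a0 a0 = r%:A.
  by apply: (central_scalar D_central) => g y _; rewrite (diag y a0 a0).
exists r; apply/matrixP => i j; rewrite mxE -rE.
have [<-|nij] := eqVneq i j.
  by rewrite mulr1n -[LHS]mulr1 (diag 1 i a0) mul1r.
rewrite mulr0n -[LHS]mulr1 -(offE 1 j j) N_comm mxE big1 // => k _.
by rewrite scale_delta_mxE (negPf nij) mul0r.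
Qed.

(* The first column p of P and, up to a scalar, the first row q of Q are obtained
   by averaging over a Casimir element of D. *)
Lemma graded_skolem_noether n n' (a0 : 'I_n) (deg : 'I_n -> G) (deg' : 'I_n' -> G)
    (f : 'M[D]_n -> 'M[D]_n') :
    bijective f -> {morph f : A B / A + B} -> {morph f : A B / A *m B} ->
    f 1%:M = 1%:M ->
    (forall (r : R) A, f (map_mx ( *:%R r) A) = map_mx ( *:%R r) (f A)) ->
    (forall g A, homog_mx deg deg g A -> homog_mx deg' deg' g (f A)) ->
  exists g (P : 'M[D]_(n', n)) (Q : 'M[D]_(n, n')),
    [/\ P *m Q = 1%:M, Q *m P = 1%:M, forall A, f A = P *m A *m Q,
        homog_mx deg' deg g P & homog_mx deg deg' (- g) Q].
Proof.
move=> [f' fK f'K] fD fM f1 fZ fh.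
have f0 : f 0 = 0 by apply: (addrI (f 0)); rewrite -fD !addr0.
have f_sum (I : finType) (F : I -> 'M[D]_n) : f (\sum_i F i) = \sum_i f (F i).
  exact: (big_morph f fD f0).
pose u d : 'M[D]_n := d *: delta_mx a0 a0.
have uM d e : u d *m u e = u (d * e) by rewrite /u mul_scale_delta_mx eqxx.
have uD d e : u (d + e) = u d + u e by rewrite /u scalerDl.
have uZ (r : R) d : u (r *: d) = map_mx ( *:%R r) (u d).
  by apply/matrixP => i j; rewrite [RHS]mxE /u !scale_delta_mxE; case: ifP; rewrite ?scaler0.
have hu t d : d \in 'D_ t -> homog_mx deg' deg' t (f (u d)).
  move=> td; apply: fh; have := @homog_scale_delta _ _ deg deg a0 a0 d t td.
  by congr (homog_mx _ _ _ _); zmod.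
have [I [a [b [beta [Db Da [i0 ai0] b_free cas]]]]] := exists_casimir D.
have inj := sandwich_inj D_central Db b_free.
have [c0 [e0 fu0]] : exists c0 e0, f (u (a i0)) c0 e0 != 0.
  have: f (u (a i0)) != 0.
    apply: contraNneq ai0 => fu0.
    have /matrixP/(_ a0 a0) : u (a i0) = 0 by rewrite -[LHS]fK fu0 -[in LHS]f0 fK.
    by rewrite /u scale_delta_mxE mxE !eqxx /= => ->.
  apply: contraNP => /forallNP nE; apply/eqP/matrixP => c e; rewrite [RHS]mxE.
  by have /forallNP/(_ e)/negP := nE c; rewrite negbK => /eqP.
(* If all these averages vanished, [sandwich_inj] would kill the entries at (c0, e0) of all f (u (a
   i)), against the choice of c0 and e0. *)
have [x [h [hx px0]]] : exists x h, x \in 'D_ h /\ \sum_i f (u (a i)) c0 e0 * x * b i != 0.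
  apply: contrapT => nE; case/eqP: fu0.
  apply: (inj (deg' e0 - deg' c0) (fun i => f (u (a i)) c0 e0)) => [i|k x kx].
    by apply: comp_mem (homog_mxE c0 e0 (hu _ _ (Da i))); zmod.
  by apply: contrapT => /eqP nz; apply: nE; exists x, k.
pose p c := \sum_i f (u (a i)) c e0 * x * b i.
(* By the Casimir identity, f (u d) acts on the column p from the left as d acts from the right. *)
have pE d c : \sum_e f (u d) c e * p e = p c * d.
  transitivity (\sum_i f (u (d * a i)) c e0 * x * b i).
    under eq_bigr do rewrite mulr_sumr.
    rewrite exchange_big /=; apply: eq_bigr => i _.
    rewrite -uM fM mxE !mulr_suml; apply: eq_bigr => e _; by rewrite !mulrA.
  have bal : balanced (fun v w => f (u v) c e0 * x * w).
    split=> [v v' w|v w w'|r v w]; first by rewrite uD fD mxE !mulrDl.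
      by rewrite mulrDr.
    by rewrite uZ fZ mxE -!scalerAl -scalerAr.
  by rewrite (cas _ _ bal d) /p mulr_suml; apply: eq_bigr => i _; rewrite mulrA.
have Dp c : p c \in 'D_ (deg' e0 + h - deg' c).
  apply: memv_suml => i _.
  apply: comp_mem (compM (compM (homog_mxE c e0 (hu _ _ (Da i))) hx) (Db i)).
  by zmod.
have Uc0 := gd_unit (Dp c0) px0.
have [z [k [kz bz0]]] : exists z k, z \in 'D_ k /\ \sum_i a i * z * b i != 0.
  apply: contrapT => nE; case/eqP: ai0; apply: (inj 0 a) => [i|k z kz].
    by apply: comp_mem (Da i); zmod.
  by apply: contrapT => /eqP nz; apply: nE; exists z, k.
(* Chosen so that the pairing [rho] of q with p collapses to the average of z, which is nonzero. *)
pose y := z * (p c0)^-1.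
have Dy : y \in 'D_ (k - (deg' e0 + h - deg' c0)) by apply: compM (comp_inv _ _).
pose q c := \sum_i a i * y * f (u (b i)) c0 c.
have qE d c : \sum_e q e * f (u d) e c = d * q c.
  transitivity (\sum_i a i * y * f (u (b i * d)) c0 c).
    under eq_bigr do rewrite mulr_suml.
    rewrite exchange_big /=; apply: eq_bigr => i _.
    rewrite -uM fM mxE mulr_sumr; apply: eq_bigr => e _; by rewrite !mulrA.
  have bal : balanced (fun v w => v * y * f (u w) c0 c).
    split=> [v v' w|v w w'|r v w]; first by rewrite !mulrDl.
      by rewrite uD fD mxE mulrDr.
    by rewrite uZ fZ mxE -!scalerAl -scalerAr.
  by rewrite -(cas _ _ bal d) /q mulr_sumr; apply: eq_bigr => i _; rewrite !mulrA.
pose ga := deg' e0 + h; pose ep := k - ga.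
have Dq c : q c \in 'D_ (ep + deg' c).
  apply: memv_suml => i _.
  apply: comp_mem (compM (compM (Da i) Dy) (homog_mxE c0 c (hu _ _ (Db i)))).
  by rewrite /ep /ga; zmod.
pose rho := \sum_c q c * p c.
have rhoE : rho = \sum_i a i * z * b i.
  rewrite /rho; under eq_bigr do rewrite mulr_suml.
  rewrite exchange_big /=; apply: eq_bigr => i _.
  under eq_bigr do rewrite -mulrA.
  by rewrite -mulr_sumr pE /y !mulrA mulrVK // -?mulrA.
(* Both intertwining properties together carry d through the pairing, so [rho] is central. *)
have [r rE] : exists r : R, rho = r%:A.
  apply: (central_scalar D_central) => g d gd.
  rewrite /rho mulr_sumr mulr_suml.
  transitivity (\sum_c \sum_e q e * f (u d) e c * p c).
    by apply: eq_bigr => c _; rewrite mulrA -qE mulr_suml.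
  rewrite exchange_big /=; apply: eq_bigr => e _.
  by rewrite -mulrA -pE mulr_sumr; apply: eq_bigr => c _; rewrite mulrA.
have rho0 : rho != 0 by rewrite rhoE.
have r0 : r != 0 by apply: contraNneq rho0 => r0; rewrite rE r0 scale0r.
(* [rho] has degree [ep + ga] and is a nonzero scalar; this makes the degrees of P and Q
   opposite. *)
have ep_ga : ep + ga = 0.
  apply: comp_degree (_ : rho \in _) _ rho0; last by rewrite rE scal_De.
  by apply: memv_suml => c _; apply: comp_mem (compM (Dq c) (Dp c)); rewrite /ga; zmod.
pose P := \matrix_(c, b) \sum_e f (delta_mx b a0) c e * p e.
pose Q := \matrix_(b, c) (r^-1 *: \sum_e q e * f (delta_mx a0 b) e c).
have fP A : f A *m P = P *m A.
  apply/matrixP => c b'; rewrite !mxE.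
  transitivity (\sum_e f (A *m delta_mx b' a0) c e * p e).
    under eq_bigr do rewrite mxE mulr_sumr.
    rewrite exchange_big /=; apply: eq_bigr => e _; rewrite fM mxE mulr_suml.
    by apply: eq_bigr => i _; rewrite mulrA.
  rewrite mulmx_delta_sum f_sum; under eq_bigr do rewrite summxE mulr_suml.
  rewrite exchange_big /=; apply: eq_bigr => i _.
  have -> : A i b' *: delta_mx i a0 = delta_mx i a0 *m u (A i b').
    by rewrite -[delta_mx i a0 in RHS]scale1r mul_scale_delta_mx eqxx mul1r.
  under eq_bigr do rewrite fM mxE mulr_suml.
  rewrite exchange_big /= mxE mulr_suml; apply: eq_bigr => e _.
  rewrite -mulrA -pE mulr_sumr; apply: eq_bigr => e' _; by rewrite mulrA.
have fQ A : Q *m f A = A *m Q.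
  apply/matrixP => b' c; rewrite !mxE.
  transitivity (r^-1 *: \sum_e q e * f (delta_mx a0 b' *m A) e c).
    under eq_bigr do rewrite mxE -scalerAl mulr_suml.
    rewrite -scaler_sumr exchange_big /=; congr (_ *: _).
    apply: eq_bigr => e _; rewrite fM mxE mulr_sumr.
    by apply: eq_bigr => i _; rewrite mulrA.
  rewrite delta_mulmx_sum f_sum.
  under [RHS]eq_bigr do rewrite mxE -scalerAr.
  rewrite -scaler_sumr; congr (_ *: _).
  under eq_bigr do rewrite summxE mulr_sumr.
  rewrite exchange_big /=; apply: eq_bigr => i _.
  have -> : A b' i *: delta_mx a0 i = u (A b' i) *m delta_mx a0 i.
    by rewrite -[delta_mx a0 i in RHS]scale1r mul_scale_delta_mx eqxx mulr1.
  under eq_bigr do rewrite fM mxE mulr_sumr.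
  rewrite exchange_big /= mulr_sumr; apply: eq_bigr => e _.
  rewrite mulrA -qE mulr_suml; apply: eq_bigr => e' _; by rewrite mulrA.
have QP : Q *m P = 1%:M.
  apply/matrixP => b1 b2; rewrite !mxE.
  transitivity (r^-1 *: \sum_e q e * \sum_e' f (delta_mx a0 b1 *m delta_mx b2 a0) e e' * p e').
    under eq_bigr do rewrite mxE mxE -scalerAl mulr_suml.
    rewrite -scaler_sumr exchange_big /=; congr (_ *: _).
    apply: eq_bigr => e _; under eq_bigr do rewrite -mulrA.
    rewrite -mulr_sumr; congr (_ * _).
    under [LHS]eq_bigr do rewrite mulr_sumr.
    rewrite [LHS]exchange_big /=; apply: eq_bigr => e' _; rewrite fM mxE mulr_suml.
    by apply: eq_bigr => i _; rewrite mulrA.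
  rewrite -[delta_mx a0 b1]scale1r -[delta_mx b2 a0]scale1r mul_scale_delta_mx.
  rewrite mulr1; case: eqP => _; last first.
    by rewrite f0 big1 ?scaler0 // => e _; rewrite big1 ?mulr0 // => e' _; rewrite mxE mul0r.
  under eq_bigr do rewrite pE mulr1.
  by rewrite -/rho rE scalerA mulVf // scale1r.
(* As n and n' are not known to be equal, Q P = 1 is not enough. Surjectivity of f makes P Q commute
   with all matrices, hence scalar, and Q (P Q) P = 1 then forces the scalar to be 1. *)
have PQ : P *m Q = 1%:M.
  have [s sE] : exists s : R, P *m Q = (s%:A)%:M.
    apply: mx_central => // A; rewrite -[A]f'K.
    by rewrite -mulmxA fQ mulmxA -fP !mulmxA.
  have: Q *m ((P *m Q) *m P) = 1%:M by rewrite mulmxA mulmxA QP mul1mx QP.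
  rewrite sE mul_scalar_mx => /matrixP/(_ a0 a0); rewrite mxE [RHS]mxE eqxx.
  rewrite (eq_bigr (fun c => s *: (Q a0 c * P c a0))) => [|c _]; last first.
    by rewrite [X in _ * X]mxE mulr_algl -scalerAr.
  rewrite -scaler_sumr => e.
  have /matrixP/(_ a0 a0) := QP; rewrite mxE [RHS]mxE eqxx => e'.
  by move: e; rewrite e' => ->.
exists (ga - deg a0), P, Q; split => //.
- by move=> A; rewrite -fP -mulmxA PQ mulmx1.
- move=> c b' t e; rewrite mxE; apply: memv_suml => e' _.
  have hd := @homog_scale_delta _ _ deg deg b' a0 1 0 (one_De D).
  rewrite scale1r in hd.
  apply: comp_mem (compM (homog_mxE c e' (fh _ _ hd)) (Dp e')).
  by rewrite /ga in e; zmod_from (esym e).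
- move=> b' c t e; rewrite mxE; apply: memvZ; apply: memv_suml => e' _.
  have hd := @homog_scale_delta _ _ deg deg a0 b' 1 0 (one_De D).
  rewrite scale1r in hd.
  apply: comp_mem (compM (Dq e') (homog_mxE e' c (fh _ _ hd))).
  have -> : ep = - ga by apply/eqP; rewrite -addr_eq0 ep_ga.
  by zmod_from (esym e).
Qed.

End SkolemNoether.

(** * Elementary facts on signatures, half-exchanges and block matrices *)

Lemma sqrD_anticomm (S : pzRingType) (x y : S) :
  x * y = - (y * x) -> (x + y) * (x + y) = x * x + y * y.
Proof. by move=> xy; rewrite mulrDl !mulrDr xy addrA addrNK. Qed.

Lemma signature_parts (k : nat) (s : int) :
  `|s| <= k%:Z -> (s = k%:Z %[mod 2])%Z ->
  let p := `|((k%:Z + s) %/ 2)%Z|%N in let q := `|((k%:Z - s) %/ 2)%Z|%N in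
  (p + q = k)%N /\ p%:Z - q%:Z = s.
Proof. by move=> s_le s_mod p q; rewrite /p /q; lia. Qed.

(** For even k this exchanges the two halves of 0, ..., k - 1: it is the permutation underlying the
    standard symplectic matrix. *)
Definition half_flip (k i : nat) : nat := if (i < k./2)%N then (i + k./2)%N else (i - k./2)%N.

Lemma half_flip_lt k i : ~~ odd k -> (i < k)%N -> (half_flip k i < k)%N.
Proof. by rewrite /half_flip => even_k; case: ifP; lia. Qed.

Lemma half_flipK k i : ~~ odd k -> (i < k)%N -> half_flip k (half_flip k i) = i.
Proof. by rewrite /half_flip => even_k; do 2!case: ifP; lia. Qed.

Lemma half_flip_half k i : ~~ odd k -> (i < k)%N ->
  (half_flip k i < k./2)%N = ~~ (i < k./2)%N.
Proof. by rewrite /half_flip => even_k; case: ifP; lia. Qed.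

Lemma half_flip_neq k i : ~~ odd k -> (i < k)%N -> half_flip k i != i.
Proof. by rewrite /half_flip => even_k; case: ifP; lia. Qed.

Section Matrices.
Variable S : pzRingType.

Lemma conform_signatureE n p q (i j : 'I_n) : (p + q = n)%N ->
  conform_mx 0 (block_mx 1%:M 0 0 (- 1%:M) : 'M[S]_(p + q)) i j
    = if j == i :> nat then if (i < p)%N then 1 else -1 else 0.
Proof.
move=> e; move: i j; rewrite -e => i j; rewrite conform_mx_id.
case: (split_ordP i) => i' ->; case: (split_ordP j) => j' ->.
- rewrite block_mxEul mxE /= ?ltn_ord eq_sym -val_eqE /=; by case: eqP.
- by rewrite block_mxEur mxE /= gtn_eqF // (leq_trans (ltn_ord i')) ?leq_addr.
- by rewrite block_mxEdl mxE /= ltn_eqF // (leq_trans (ltn_ord j')) ?leq_addr.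
rewrite block_mxEdr !mxE /= eqn_add2l ?[(_ < _)%N]ltnNge ?leq_addr /= eq_sym -val_eqE /=.
by case: eqP; rewrite ?oppr0.
Qed.

Lemma conform_symplecticE n (i j : 'I_n) : ~~ odd n ->
  conform_mx 0 (block_mx 0 1%:M (- 1%:M) 0 : 'M[S]_(n./2 + n./2)) i j
    = if j == half_flip n i :> nat then if (i < n./2)%N then 1 else -1 else 0.
Proof.
move=> n_even; have e : (n./2 + n./2 = n)%N by rewrite addnn even_halfK.
rewrite /half_flip; set h := n./2 in e *; move: i j; rewrite -e => i j.
rewrite conform_mx_id; case: (split_ordP i) => i' ->; case: (split_ordP j) => j' ->.
- by rewrite block_mxEul mxE /= ?ltn_ord ltn_eqF // (leq_trans (ltn_ord j')) ?leq_addl.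
- by rewrite block_mxEur mxE /=  ?ltn_ord addnC eqn_add2r eq_sym -val_eqE /=; case: eqP.
- rewrite block_mxEdl !mxE /= ?[(_ < _)%N]ltnNge ?leq_addr /= addKn eq_sym -val_eqE /=.
  by case: eqP; rewrite ?oppr0.
rewrite block_mxEdr mxE /= ?[(_ < _)%N]ltnNge ?leq_addr /= addKn gtn_eqF //.
by rewrite (leq_trans (ltn_ord i')) ?leq_addr.
Qed.

Lemma mxdiag_RankE m (k : 'I_m -> nat) (B : forall i, 'M[S]_(k i)) i a b :
  (\mxdiag_i B i) (tagnat.Rank i a) (tagnat.Rank i b) = B i a b.
Proof.
by have /matrixP/(_ a b) := submxblock_diag B i; rewrite mxE.
Qed.

Lemma mxdiag_Rank_neq m (k : 'I_m -> nat) (B : forall i, 'M[S]_(k i)) i j a b :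
  i != j -> (\mxdiag_i B i) (tagnat.Rank i a) (tagnat.Rank j b) = 0.
Proof.
move=> nij; have := @mxblockK S m m k k (fun i j => if i == j then conform_mx 0 (B i) else 0) i j.
by move=> /matrixP/(_ a b); rewrite !mxE (negPf nij) !mxE.
Qed.

Lemma scalar_mxE k (d : S) (i j : 'I_k) :
  (d%:M : 'M[S]_k) i j = if j == i :> nat then d else 0.
Proof. by rewrite mxE eq_sym -val_eqE; case: eqP. Qed.

Lemma matrix_inverse_unique k (A B : 'M[S]_k) :
  A *m B = 1%:M -> B *m A = 1%:M -> matrix_inverse A = B.
Proof.
move=> AB BA; rewrite /matrix_inverse; case: xgetP => [C _ [_ CA]|/(_ B)[]//].
by rewrite -[C]mulmx1 -AB mulmxA CA mul1mx.
Qed.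

End Matrices.

(** * The neutral component and the elements X t *)

Section Models.
Variables (R : realType) (G : zmodType) (D : grDivAlg R G).
Local Notation "'D_ g" := (gd_comp D g) (at level 8, g at level 2).
Local Notation De := (gd_comp D 0).
Local Notation T := (gd_supp D).
Local Notation GT := (Quotient.quot (gd_supp D)).
Local Notation pi := (\pi_(Quotient.quot (gd_supp D))).
Variables (E : neutral_type D) (phi0 : {linear D -> D}) (delta : int) (X : G -> D).
Hypothesis phi0_inv : degree_preserving_involution phi0.
Hypothesis phi0_conj : conjugation_on_De E phi0.
Hypothesis delta_sign : is_sign delta.
Hypothesis X_choice : homogeneous_choice E phi0 delta X.
Local Notation eta := (Defs.eta phi0 X).
Local Notation K := (Defs.K E).

Lemma phi0M x y : phi0 (x * y) = phi0 y * phi0 x.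
Proof. by case: phi0_inv => + _ _; apply. Qed.

Lemma phi0K x : phi0 (phi0 x) = x.
Proof. by case: phi0_inv => _ + _; apply. Qed.

Lemma phi0_comp g x : x \in 'D_ g -> phi0 x \in 'D_ g.
Proof. by case: phi0_inv => _ _; apply. Qed.

Lemma phi0_1 : phi0 1 = 1.
Proof. by rewrite -[LHS]mul1r -{1}(phi0K 1) -phi0M mul1r phi0K. Qed.

Lemma phi0_scal r : phi0 r%:A = r%:A.
Proof. by rewrite linearZ /= phi0_1. Qed.

Lemma phi0_eq0 x : (phi0 x == 0) = (x == 0).
Proof. by apply/eqP/eqP => [e|->]; rewrite ?linear0 // -[x]phi0K e linear0. Qed.

Lemma phi0V x : x \is a GRing.unit -> phi0 x^-1 = (phi0 x)^-1.
Proof.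
move=> xU; have e : phi0 x * phi0 x^-1 = 1 by rewrite -phi0M mulVr // phi0_1.
have e' : phi0 x^-1 * phi0 x = 1 by rewrite -phi0M mulrV // phi0_1.
by rewrite -[LHS]mul1r -(@mulVr _ (phi0 x)) -?mulrA ?e ?mulr1 //; apply/unitrP; exists (phi0 x^-1).
Qed.

Lemma eq_oppr_eq0 (x : D) : x = - x -> x = 0.
Proof.
move=> e; have /eqP : x *+ 2 = 0 by rewrite mulr2n {1}e addNr.
by rewrite -scaler_nat scaler_eq0 pnatr_eq0 => /eqP.
Qed.

Lemma De_mul x y : x \in De -> y \in De -> x * y \in De.
Proof. by move=> Dx Dy; apply: comp_mem (compM Dx Dy); rewrite addr0. Qed.

Lemma De_inv x : x \in De -> x != 0 -> x^-1 \in De.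
Proof. by move=> Dx x0; rewrite -oppr0; apply: comp_inv. Qed.

Lemma De_domain x y : x \in De -> x * y = 0 -> x = 0 \/ y = 0.
Proof.
move=> Dx xy0; have [->|x0] := eqVneq x 0; [by left | right].
by apply: (mulrI (gd_unit Dx x0)); rewrite xy0 mulr0.
Qed.

(** Real and imaginary part, uniformly in R, C and H. Positivity of the norm and reality of
    self-conjugate elements are deduced from this form without returning to the three cases. *)
Lemma De_decomp x : x \in De ->
  exists (a s : R) p, [/\ x = a%:A + p, phi0 p = - p, p * p = (- s)%:A & 0 <= s].
Proof.
case: E phi0_conj => [DeE|i ii DeE|i j ii jj ij DeE] /= conj.
- rewrite DeE => /vlineP[a ->]; exists a, 0, 0.
  by rewrite addr0 oppr0 linear0 oppr0 mulr0 scale0r.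
- rewrite DeE span_cons span_seq1 => /memv_addP[_ /vlineP[a ->] [_ /vlineP[b ->] ->]].
  exists a, (b ^+ 2), (b *: i); split=> //; last exact: sqr_ge0.
    by have := conj 0 b; rewrite scale0r !add0r.
  by rewrite -scalerAl -scalerAr ii scalerA scalerN scaleNr expr2.
rewrite DeE !span_cons span_nil addv0.
move=> /memv_addP[_ /vlineP[a ->] [_ /memv_addP[_ /vlineP[b ->] [_
  /memv_addP[_ /vlineP[c ->] [_ /vlineP[d ->] ->]] ->]] ->]].
exists a, (b ^+ 2 + c ^+ 2 + d ^+ 2), (b *: i + c *: j + d *: (i * j)).
have scale_anti u v r s : u * v = - (v * u) :> D ->
    (r *: u) * (s *: v) = - ((s *: v) * (r *: u)).
  by move=> uv; rewrite -!scalerAl -!scalerAr uv !scalerA mulrC scalerN.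
have ik : i * (i * j) = - ((i * j) * i) by rewrite {1}ij mulrN mulrA.
have jk : j * (i * j) = - ((i * j) * j) by rewrite mulrA -[j * i]opprK -ij mulNr.
have kk : (i * j) * (i * j) = - 1.
  by rewrite mulrA -[i * j * i]mulrA -[j * i]opprK -ij mulrN mulrA ii mulN1r opprK jj.
split; first by rewrite !addrA.
- by have := conj 0 b c d; rewrite scale0r !add0r => ->; rewrite !opprD.
- rewrite sqrD_anticomm; last first.
    by rewrite mulrDl mulrDr opprD; congr (_ + _); apply: scale_anti.
  rewrite sqrD_anticomm; last exact: scale_anti.
  rewrite -!scalerAl -!scalerAr ii jj kk !scalerN !scalerA -!expr2.
  by rewrite !scaleNr !scalerDl !opprD.
by rewrite !addr_ge0 // sqr_ge0.
Qed.

Lemma De_fixed x : x \in De -> phi0 x = x -> exists r : R, x = r%:A.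
Proof.
move=> /De_decomp[a [s [p [-> pN _ _]]]]; rewrite linearD /= phi0_scal pN => /addrI e.
by exists a; rewrite (eq_oppr_eq0 (esym e)) addr0.
Qed.

Lemma De_norm x : x \in De -> x != 0 -> exists2 r : R, 0 < r & phi0 x * x = r%:A.
Proof.
move=> De_x x0; have [a [s [p [xE pN pp s0]]]] := De_decomp De_x.
have e : phi0 x * x = (a ^+ 2 + s)%:A.
  rewrite xE linearD /= phi0_scal pN mulrDl !mulrDr !mulr_algl !mulr_algr mulNr pp.
  by rewrite scalerN addrA addrK scalerA -expr2 -scaleNr opprK -scalerDl.
exists (a ^+ 2 + s) => //; rewrite lt_neqAle addr_ge0 ?sqr_ge0 // andbT eq_sym.
apply: contraNneq x0 => s0'; move: e; rewrite s0' scale0r => e.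
by case: (De_domain (phi0_comp De_x) e) => /eqP; rewrite ?phi0_eq0.
Qed.

Lemma X_comp t : t \in T -> X t \in 'D_ t.
Proof. by case/X_choice. Qed.

Lemma X_neq0 t : t \in T -> X t != 0.
Proof. by case/X_choice. Qed.

Lemma X_unit t : t \in T -> X t \is a GRing.unit.
Proof. by move=> Tt; apply: gd_unit (X_comp Tt) (X_neq0 Tt). Qed.

Lemma comp_XDe t x : t \in T -> x \in 'D_ t -> exists2 d, d \in De & x = X t * d.
Proof.
move=> Tt tx; exists ((X t)^-1 * x); last by rewrite mulrA mulrV ?X_unit // mul1r.
by apply: comp_mem (compM (comp_inv (X_comp Tt) (X_neq0 Tt)) tx); zmod.
Qed.

Lemma K_supp t : t \in K -> t \in T.
Proof. by case/andP. Qed.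

Lemma T_add s t : s \in T -> t \in T -> s + t \in T.
Proof. exact: gd_suppD. Qed.

Lemma T_opp t : t \in T -> - t \in T.
Proof. by move=> Tt; rewrite -sub0r; case: (gd_supp_zmod D) => T0; apply. Qed.

Lemma T_add2 t u : u \in T -> (t + u *+ 2 \in T) = (t \in T).
Proof.
move=> Tu; have Tu2 : u *+ 2 \in T by rewrite mulr2n T_add.
by apply/idP/idP => Tt; [rewrite -[t](addrK (u *+ 2)) | ]; rewrite T_add ?T_opp.
Qed.

Lemma X_comm t d : t \in K -> d \in De -> X t * d = d * X t.
Proof.
move=> /andP[Tt]; have [tX _] := X_choice Tt.
case: E => [DeE _ _|i ii DeE _ /centvsP|i j ii jj ij DeE XK _].
- by rewrite DeE => /vlineP[a ->]; rewrite mulr_algl mulr_algr.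
- by move=> /(_ _ _ tX)/[apply].
- by move=> /XK.
Qed.

Definition is_C : bool := if E is C_type _ _ _ then true else false.

Lemma K_notC t : ~~ is_C -> t \in T -> t \in K.
Proof. by rewrite /is_C => nC Tt; apply/andP; split=> //; case: E nC. Qed.

Lemma C_comm x y : is_C -> x \in De -> y \in De -> x * y = y * x.
Proof.
rewrite /is_C; case: E => // i ii DeE _ De_x; have xi : x * i = i * x.
  move: De_x; rewrite DeE span_cons span_seq1.
  move=> /memv_addP[_ /vlineP[a ->] [_ /vlineP[b ->] ->]].
  by rewrite mulrDl mulrDr mulr_algl mulr_algr -scalerAl -scalerAr.
rewrite DeE span_cons span_seq1 => /memv_addP[_ /vlineP[a ->] [_ /vlineP[b ->] ->]].
by rewrite mulrDl mulrDr mulr_algl mulr_algr -scalerAl -scalerAr xi.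
Qed.

(** Over H, write w = a + b i + z with z anticommuting with i: commuting with i kills z, and
    commuting with j then kills b. *)
Lemma notC_center w : ~~ is_C -> w \in De -> (forall d, d \in De -> w * d = d * w) ->
  exists r : R, w = r%:A.
Proof.
rewrite /is_C; case: E => // [DeE _|i j ii jj ij DeE _].
  by rewrite DeE => /vlineP.
have De_i : i \in De by rewrite DeE memv_span // !inE eqxx ?orbT.
have De_j : j \in De by rewrite DeE memv_span // !inE eqxx ?orbT.
move=> De_w w_comm; move: (De_w).
rewrite DeE !span_cons span_nil addv0.
move=> /memv_addP[_ /vlineP[a ->] [_ /memv_addP[_ /vlineP[b ->] [_
  /memv_addP[_ /vlineP[c ->] [_ /vlineP[d ->] ->]] ->]] wE]].
have i0 : i != 0 by apply: contra_eq_neq ii => ->; rewrite mulr0 eq_sym oppr_eq0 oner_neq0.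
have j0 : j != 0 by apply: contra_eq_neq jj => ->; rewrite mulr0 eq_sym oppr_eq0 oner_neq0.
pose z := c *: j + d *: (i * j).
have zi : z * i = - (i * z).
  rewrite mulrDl mulrDr -!scalerAl -!scalerAr opprD -!scalerN; congr (_ *: _ + _ *: _).
    by rewrite ij opprK.
  by rewrite -mulrA -[j * i]opprK -ij mulrN.
have De_z : z \in De by rewrite memvD // memvZ // De_mul.
have {}wE : w = a%:A + (b *: i + z) := wE.
clearbody z.
have z0 : z = 0.
  have := w_comm i De_i; rewrite wE !mulrDl !mulrDr mulr_algl mulr_algr.
  rewrite -scalerAl -scalerAr zi => /addrI/addrI/esym/eq_oppr_eq0/(De_domain De_i).
  by case=> // e; rewrite e eqxx in i0.
have := w_comm j De_j; rewrite wE z0 addr0 mulrDl mulrDr mulr_algl mulr_algr.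
move=> /addrI; rewrite -[in RHS]scalerAr -[j * i]opprK -ij scalerN -scalerAl.
move=> /eq_oppr_eq0/eqP; rewrite scaler_eq0 => /orP[/eqP b0|/eqP ij0].
  by exists a; rewrite b0 scale0r addr0.
by case: (De_domain De_i ij0) => e; [rewrite e eqxx in i0 | rewrite e eqxx in j0].
Qed.

(** Here D_e = C, and conjugation by a nonzero y of D_t sends i to a square root of -1 in D_e, that
    is, to i or - i. Some y does not commute with D_e, which excludes i; every other element of D_t
    is y times an element of D_e. *)
Lemma notK_skew t x d : t \in T -> t \notin K -> x \in 'D_ t -> d \in De ->
  x * d = phi0 d * x.
Proof.
move=> Tt nKt; have C : is_C by apply: contraNT nKt => nC; apply: K_notC.
have De_comm := C_comm C.
move: nKt C phi0_conj; rewrite /is_C unfold_in Tt /=.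
case: E => // i ii DeE nC _ /= conj tx.
have De_i : i \in De by rewrite DeE memv_span // !inE eqxx ?orbT.
have i0 : i != 0 by apply: contra_eq_neq ii => ->; rewrite mulr0 eq_sym oppr_eq0 oner_neq0.
have phi_i : phi0 i = - i by have := conj 0 1; rewrite scale0r scale1r !add0r.
have xi : x * i = - (i * x).
  have [y [ty [k [De_k yk]]]] : exists y, y \in 'D_ t /\ exists k, k \in De /\ y * k <> k * y.
    apply: contrapT => nE; case/centvsP: nC => y k ty De_k.
    by apply: contrapT => yk; apply: nE; exists y; split=> //; exists k.
  have y0 : y != 0 by apply/eqP => y0; rewrite y0 mul0r mulr0 in yk.
  have Uy := gd_unit ty y0.
  have yi : y * i = - (i * y).
    pose z := y * i * y^-1.
    have De_z : z \in De.
      by apply: comp_mem (compM (compM ty De_i) (comp_inv ty y0)); zmod.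
    have zz : z * z = -1.
      by rewrite /z !mulrA mulrVK // -[y * i * i]mulrA ii mulrN1 mulNr mulrV.
    have yiE : y * i = z * y by rewrite /z mulrVK.
    have /(De_domain _)[] : (z - i) * (z + i) = 0.
      by rewrite mulrDl !mulrDr zz mulNr mulNr (De_comm z i) // ii opprK addrA addrK addNr.
    - by rewrite memvB.
    - move=> /eqP; rewrite subr_eq0 => /eqP zi; case: yk.
      move: De_k; rewrite DeE span_cons span_seq1.
      move=> /memv_addP[_ /vlineP[a ->] [_ /vlineP[b ->] ->]].
      by rewrite mulrDl mulrDr mulr_algl mulr_algr -scalerAl -scalerAr yiE zi.
    by move=> /eqP; rewrite addr_eq0 => /eqP zi; rewrite yiE zi mulNr.
  have [e De_e ->] : exists2 e, e \in De & x = y * e.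
    exists (y^-1 * x); last by rewrite mulrA mulrV // mul1r.
    by apply: comp_mem (compM (comp_inv ty y0) tx); zmod.
  by rewrite -mulrA (De_comm e) // !mulrA yi mulNr.
rewrite DeE span_cons span_seq1 => /memv_addP[_ /vlineP[a ->] [_ /vlineP[b ->] ->]].
rewrite conj mulrDr mulrBl mulr_algl mulr_algr -scalerAl -scalerAr xi.
by rewrite scalerN.
Qed.

Lemma notK_is_C t : t \in T -> t \notin K -> is_C.
Proof. by move=> Tt; apply: contraNT => nC; apply: K_notC. Qed.

Lemma eta_sign t : is_sign (eta t).
Proof. by rewrite /Defs.eta; case: ifP; [left | right]. Qed.

Lemma etaP t : phi0 (X t) = X t \/ phi0 (X t) = - X t -> phi0 (X t) = X t *~ eta t.
Proof.
rewrite /Defs.eta; case: eqP => [-> _|ne [/ne//|->]]; by rewrite ?mulr1z ?mulrN1z.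
Qed.

Lemma De_sqr1 w : w \in De -> w * w = 1 -> w = 1 \/ w = -1.
Proof.
move=> De_w ww; have/De_domain : (w - 1) * (w + 1) = 0.
  by rewrite mulrBl mulrDr ww mulr1 mul1r; zmod.
rewrite memvB // ?one_De // => -[]// /eqP; first by rewrite subr_eq0 => /eqP; left.
by rewrite addr_eq0 => /eqP; right.
Qed.

(** Outside K the sign is the same on all of D_t: phi0 (X_t d) = phi0 d phi0 (X_t), and carrying
    phi0 d back across X_t restores d. *)
Lemma notK_phi0 t x : t \in T -> t \notin K -> x \in 'D_ t -> phi0 x = x *~ eta t.
Proof.
move=> Tt nKt tx; have skew := notK_skew Tt nKt.
have [w De_w XE] := comp_XDe Tt (phi0_comp (X_comp Tt)).
have De_comm := C_comm (notK_is_C Tt nKt).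
have Xeta : phi0 (X t) = X t *~ eta t.
  apply: etaP; have ww : w * w = 1.
    apply: (mulrI (X_unit Tt)); rewrite mulr1 -[RHS]phi0K XE phi0M XE mulrA.
    by rewrite -skew ?X_comp // mulrA.
  rewrite XE; case: (De_sqr1 De_w ww) => ->; [left | right]; by rewrite ?mulr1 ?mulrN1.
have [d De_d ->] := comp_XDe Tt tx.
by rewrite phi0M Xeta mulrzAr -skew ?X_comp.
Qed.

(** [eta] is -1 by default as soon as phi0 (X t) differs from X t, so a sign has to be exhibited
    first. Over R and H, X_t^-1 phi0 (X_t) centralizes D_e, hence is real, and its square is 1. *)
Lemma phi0_X t : t \in T -> phi0 (X t) = X t *~ eta t.
Proof.
move=> Tt; have [Kt|nKt] := boolP (t \in K); last by apply: notK_phi0 => //; apply: X_comp.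
apply: etaP; have [C|nC] := boolP is_C.
  have [_ _] := X_choice Tt; move: C; rewrite /is_C.
  move: Kt; case: E => // i ii DeE Kt _ /(_ Kt) ->.
  by case: delta_sign => ->; rewrite ?mulr1z ?mulrN1z; [left | right].
have [w De_w XE] := comp_XDe Tt (phi0_comp (X_comp Tt)).
have [|r rE] := notC_center nC De_w.
  move=> d De_d; apply: (mulrI (X_unit Tt)); rewrite mulrA -XE [RHS]mulrA X_comm //.
  by rewrite -[d * X t * w]mulrA -XE -[d]phi0K -!phi0M X_comm // phi0_comp.
have ww : w * w = 1.
  apply: (mulrI (X_unit Tt)); rewrite mulr1 -[RHS]phi0K XE phi0M XE rE phi0_scal.
  by rewrite !mulr_algl -scalerAr.
rewrite XE; case: (De_sqr1 De_w ww) => ->; [left | right]; by rewrite ?mulr1 ?mulrN1.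
Qed.

Lemma is_C_eta t : is_C -> t \in K -> eta t = delta.
Proof.
move=> C Kt; have Tt := K_supp Kt; have [_ X0] := X_choice Tt; move: C; rewrite /is_C.
move: Kt; case: E => // i ii DeE Kt _ /(_ Kt); rewrite /Defs.eta => ->.
case: delta_sign => ->; first by rewrite mulr1z eqxx.
rewrite mulrN1z; case: eqP => // /esym/eq_oppr_eq0 e; by rewrite e eqxx in X0.
Qed.

Lemma conj_twist t u x : u \in T -> t \in K -> x \in 'D_ t ->
  (forall d, d \in De -> x * d = d * x) ->
  forall d, d \in De -> (X u * x * X u) * d = d * (X u * x * X u).
Proof.
move=> Tu Kt tx x_comm d De_d; have [Ku|nKu] := boolP (u \in K).
  by rewrite -mulrA (X_comm Ku De_d) !mulrA -[_ * x * d]mulrA x_comm // !mulrA (X_comm Ku De_d).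
have De_d' := phi0_comp De_d.
have skew := notK_skew Tu nKu (X_comp Tu).
rewrite -mulrA (skew _ De_d) !mulrA -[_ * x * phi0 d]mulrA x_comm // !mulrA.
by rewrite (skew _ De_d') phi0K.
Qed.

(** An element of D_e moved across both factors X_u is conjugated twice or not at all, so X_u X_t
    X_u commutes with D_e; were t + 2u outside K, it would also conjugate D_e. *)
Lemma K_twist t u : u \in T -> t \in K -> t + u *+ 2 \in K.
Proof.
move=> Tu Kt; have Tt := K_supp Kt; have Ttu : t + u *+ 2 \in T by rewrite T_add2.
apply: contraT => nK; have C := notK_is_C Ttu nK.
pose y := X u * X t * X u.
have Dy : y \in 'D_ (t + u *+ 2).
  by apply: comp_mem (compM (compM (X_comp Tu) (X_comp Tt)) (X_comp Tu)); zmod.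
have y0 : y != 0.
  have XuXt : X u * X t != 0 by apply: mul_homog_neq0 (X_comp Tu) _ _; apply: X_neq0.
  by apply: mul_homog_neq0 (compM (X_comp Tu) (X_comp Tt)) XuXt (X_neq0 Tu).
have y_comm := conj_twist Tu Kt (X_comp Tt) (fun d De_d => X_comm Kt De_d).
have y_skew := notK_skew Ttu nK Dy.
have [d De_d /eqP] : exists2 d, d \in De & phi0 d != d.
  move: C phi0_conj; rewrite /is_C; case: E => // i ii DeE _ /= conj.
  exists i; first by rewrite DeE memv_span // !inE eqxx ?orbT.
  have := conj 0 1; rewrite scale0r scale1r !add0r => ->.
  apply/eqP => /esym/eq_oppr_eq0 i0; have := oner_neq0 D.
  by rewrite -oppr_eq0 -ii i0 mulr0 eqxx.
case; apply: (mulIr (gd_unit Dy y0)).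
by rewrite -y_skew // y_comm.
Qed.

Lemma K_add2 t u : u \in T -> (t + u *+ 2 \in K) = (t \in K).
Proof.
move=> Tu; apply/idP/idP => [|/K_twist]; last by apply.
by move=> /(K_twist (T_opp Tu)); rewrite mulNrn addrK.
Qed.

Lemma phi0_sandwich t u : u \in T -> t \in T ->
  phi0 (X u * X t * X u) = (X u * X t * X u) *~ eta t.
Proof.
move=> Tu Tt; rewrite !phi0M !phi0_X //.
case: (eta_sign u) => ->; case: (eta_sign t) => ->;
  by rewrite !(mulr1z, mulrN1z, mulrN, mulNr, opprK, mulrA).
Qed.

(** This is why the action can speak of a sign. Over R and H the quotient of the two elements
    centralizes D_e; over C it is fixed by phi0, since phi0 multiplies both by delta. In each case
    it is real. *)
Lemma twistE t u : u \in T -> t \in K ->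
  exists2 z : R, z != 0 & X u * X t * X u = z *: X (t + u *+ 2).
Proof.
move=> Tu Kt; have Tt := K_supp Kt; have Ktu := K_twist Tu Kt; have Ttu := K_supp Ktu.
set y := X u * X t * X u.
have Dy : y \in 'D_ (t + u *+ 2).
  by apply: comp_mem (compM (compM (X_comp Tu) (X_comp Tt)) (X_comp Tu)); zmod.
have y0 : y != 0.
  have XuXt : X u * X t != 0 by apply: mul_homog_neq0 (X_comp Tu) _ _; apply: X_neq0.
  by apply: mul_homog_neq0 (compM (X_comp Tu) (X_comp Tt)) XuXt (X_neq0 Tu).
have [w De_w yE] := comp_XDe Ttu Dy.
suff [z wE] : exists z : R, w = z%:A.
  exists z; last by rewrite yE wE mulr_algr.
  by apply: contraNneq y0 => z0; rewrite yE wE z0 scale0r mulr0.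
have [C|nC] := boolP is_C.
  apply: De_fixed => //; apply: (mulrI (X_unit Ttu)).
  have : phi0 y = y *~ delta.
    by rewrite phi0_sandwich // (is_C_eta C Kt).
  rewrite yE phi0M phi0_X // (is_C_eta C Ktu) mulrzAr -X_comm ?phi0_comp //.
  by case: delta_sign => ->; rewrite ?mulr1z ?mulrN1z // => /oppr_inj.
apply: notC_center => // d De_d; apply: (mulrI (X_unit Ttu)).
rewrite mulrA -yE (conj_twist Tu Kt (X_comp Tt) (fun e De_e => X_comm Kt De_e) De_d).
by rewrite -/y yE !mulrA X_comm.
Qed.

Lemma real_sign_scal z : real_sign (z%:A : D) = sgz z.
Proof.
rewrite /real_sign linearZ /=.
have free1 : free [tuple (1 : D)] by rewrite /free span_seq1 dim_vline oner_eq0.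
have := coord_free ord0 ord0 free1; rewrite /= => ->.
by rewrite mulr1.
Qed.

Lemma real_sign_twist t u (z : R) : u \in T -> t \in K ->
  X u * X t * X u = z *: X (t + u *+ 2) ->
  real_sign ((X (t + u *+ 2))^-1 * X u * X t * X u) = sgz z.
Proof.
move=> Tu Kt e; rewrite -!mulrA [X u * (X t * _)]mulrA e -scalerAr mulVr ?real_sign_scal //.
by apply: X_unit; rewrite T_add2 //; apply: K_supp.
Qed.

Lemma sign_mulrz_inj x (e e' : int) : x != 0 :> D -> is_sign e -> is_sign e' ->
  x *~ e = x *~ e' -> e = e'.
Proof.
move=> x0 [-> | ->] [-> | ->] //; rewrite mulr1z mulrN1z.
  by move=> /eq_oppr_eq0 e0; rewrite e0 eqxx in x0.
by move=> /esym/eq_oppr_eq0 e0; rewrite e0 eqxx in x0.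
Qed.

Lemma sign_mulrzK (x : D) (e : int) : is_sign e -> x *~ e *~ e = x.
Proof. by case=> ->; rewrite ?mulr1z ?mulrN1z ?opprK. Qed.

(** Makes the type of a self-dual block independent of the representative: another element of the
    coset changes [tau] by twice an element of T. *)
Lemma eta_add2 t u : u \in T -> t \in T -> eta (t + u *+ 2) = eta t.
Proof.
move=> Tu Tt; have Ttu : t + u *+ 2 \in T by rewrite T_add2.
have [Kt|nKt] := boolP (t \in K).
  have [z z0 yE] := twistE Tu Kt; have := phi0_sandwich Tu Tt.
  rewrite yE linearZ /= phi0_X // scalerMzr => /(scalerI z0).
  by apply: sign_mulrz_inj (X_neq0 Ttu) (eta_sign _) (eta_sign _).
have nKtu : t + u *+ 2 \notin K by rewrite K_add2.
have := phi0_sandwich Tu Tt; rewrite (notK_phi0 Ttu nKtu).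
  apply: sign_mulrz_inj (eta_sign _) (eta_sign _).
  have XuXt : X u * X t != 0 by apply: mul_homog_neq0 (X_comp Tu) _ _; apply: X_neq0.
  by apply: mul_homog_neq0 (compM (X_comp Tu) (X_comp Tt)) XuXt (X_neq0 Tu).
by apply: comp_mem (compM (compM (X_comp Tu) (X_comp Tt)) (X_comp Tu)); zmod.
Qed.

Lemma phi0_XV u : u \in T -> phi0 (X u)^-1 = (X u)^-1 *~ eta u.
Proof.
move=> Tu; rewrite phi0V ?X_unit // phi0_X //.
by case: (eta_sign u) => ->; rewrite ?mulr1z ?mulrN1z ?invrN.
Qed.

Lemma XV_comp u : u \in T -> (X u)^-1 \in 'D_ (- u).
Proof. by move=> Tu; apply: comp_inv (X_comp Tu) (X_neq0 Tu). Qed.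

(** * Congruence of one-dimensional forms *)

Lemma twistVE t u (z : R) : u \in T -> z != 0 ->
  X u * X t * X u = z *: X (t + u *+ 2) ->
  (X u)^-1 * X (t + u *+ 2) * (X u)^-1 = z^-1 *: X t.
Proof.
move=> Tu z0 e; have -> : X (t + u *+ 2) = z^-1 *: (X u * X t * X u).
  by rewrite e scalerA mulVf // scale1r.
by rewrite -scalerAr -scalerAl !mulrA mulVr ?X_unit // mul1r mulrK ?X_unit.
Qed.

(** Half-angle formulas: with n the modulus of a + b i, the root has real part sqrt ((n + a) / 2)
    and imaginary part sqrt ((n - a) / 2) up to sign, the sign being that of b. *)
Lemma C_sqrt v : is_C -> v \in De -> exists2 c, c \in De & c * c = v.
Proof.
rewrite /is_C; case: E => // i ii DeE _.
rewrite DeE span_cons span_seq1 => /memv_addP[_ /vlineP[a ->] [_ /vlineP[b ->] ->]].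
pose n := Num.sqrt (a ^+ 2 + b ^+ 2).
have nn : n ^+ 2 = a ^+ 2 + b ^+ 2 by rewrite sqr_sqrtr // addr_ge0 ?sqr_ge0.
have n0 : 0 <= n by apply: sqrtr_ge0.
have le_an : `|a| <= n by rewrite -sqrtr_sqr ler_wsqrtr // lerDl sqr_ge0.
have [na1 na2] : 0 <= (n + a) / 2 /\ 0 <= (n - a) / 2.
  by move: le_an; rewrite ler_norml => /andP[]; split; lra.
pose x := Num.sqrt ((n + a) / 2).
pose q := Num.sqrt ((n - a) / 2); pose y := (if 0 <= b then 1 else - 1) * q.
have xx : x * x = (n + a) / 2 by rewrite -expr2 sqr_sqrtr.
have yy : y * y = (n - a) / 2.
  by rewrite /y mulrACA -!expr2 sqr_sqrtr //; case: ifP => _; rewrite ?sqrrN ?expr1n mul1r.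
have xq : x * q = `|b| / 2.
  rewrite /x /q -sqrtrM // (_ : _ * _ = (b / 2) ^+ 2).
    by rewrite sqrtr_sqr normrM [X in _ * X]ger0_norm // invr_ge0.
  have -> : (n + a) / 2 * ((n - a) / 2) = (n ^+ 2 - a ^+ 2) / 4 by field.
  by rewrite nn; field.
have xy : x * y + x * y = b.
  rewrite /y mulrCA xq; case: (lerP 0 b) => b0; first by rewrite ger0_norm //; field.
  by rewrite ltr0_norm //; field.
exists (x%:A + y *: i).
  by rewrite memv_add ?memvZ ?memv_line.
rewrite mulrDl !mulrDr !mulr_algl !mulr_algr -!scalerAl -!scalerAr ii !scalerA.
rewrite [_ *: i + _ *: -1]addrC addrACA -scalerDl xy.
by rewrite scalerN -scaleNr -scalerDl xx yy; congr (_ *: _ + _); field.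
Qed.

Lemma scale_sgz (z : R) (x : D) : z != 0 -> (`|z| / z) *: x = x *~ sgz z.
Proof.
rewrite neq_lt => /orP[z0|z0].
  by rewrite ltr0_norm // ltr0_sgz // mulNr mulfV ?lt_eqF // scaleN1r mulrN1z.
by rewrite gtr0_norm // gtr0_sgz // mulfV ?gt_eqF // scale1r mulr1z.
Qed.

Lemma sgz_sign (z : R) : z != 0 -> is_sign (sgz z).
Proof.
by rewrite neq_lt => /orP[z0|z0]; [right; apply: ltr0_sgz | left; apply: gtr0_sgz].
Qed.

Lemma sign_mul (e e' : int) : is_sign e -> is_sign e' -> is_sign (e * e').
Proof. by move=> [] -> [] ->; [left | right | right | left]. Qed.

(** d = sqrt |z| X_u^-1 works: the root absorbs the size of z, and only the signs of z and [eta u]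
    remain to be matched. *)
Lemma solve_signature t u (z : R) (e e' r : int) : u \in T -> t \in K -> z != 0 ->
  X u * X t * X u = z *: X (t + u *+ 2) ->
  is_sign e -> is_sign e' -> is_sign r -> e' * eta u * sgz z = r * e ->
  exists d, [/\ d \in 'D_ (- u), d != 0 &
    phi0 d * (X (t + u *+ 2) *~ e') * d = X t *~ e *~ r].
Proof.
move=> Tu Kt z0 zE e_sgn e'_sgn r_sgn eq_sgn; pose c := Num.sqrt `|z|.
have c0 : c != 0 by rewrite sqrtr_eq0 -ltNge normr_gt0.
have cc : c * c = `|z| by rewrite -expr2 sqr_sqrtr.
exists (c *: (X u)^-1); split; first by rewrite memvZ // XV_comp.
  by rewrite scaler_eq0 negb_or c0 (homog_inv_neq0 (X_comp Tu)) ?X_neq0.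
rewrite linearZ /= phi0_XV // -scalerAr -!scalerAl scalerA cc.
have -> : (X u)^-1 *~ eta u * (X (t + u *+ 2) *~ e') * (X u)^-1
    = ((X u)^-1 * X (t + u *+ 2) * (X u)^-1) *~ (e' * eta u).
  by rewrite mulrzAl mulrzAr !mulrzAl mulrzA.
rewrite (twistVE Tu z0 zE) scalerMzr scalerA scale_sgz // -!mulrzA.
by rewrite eq_sgn mulrC.
Qed.

(** With d = X_u^-1 c, carrying phi0 c across X_t turns it into c, so the unknown enters as c^2 and
    a square root in C serves either sign r. *)
Lemma solve_skew t u (r : int) : u \in T -> t \in T -> t \notin K -> is_sign r ->
  exists d, [/\ d \in 'D_ (- u), d != 0 & phi0 d * X (t + u *+ 2) * d = X t *~ r].
Proof.
move=> Tu Tt nKt r_sgn; have C := notK_is_C Tt nKt.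
have Ttu : t + u *+ 2 \in T by rewrite T_add2.
have [w De_w wE] : exists2 w, w \in De & (X u)^-1 * X (t + u *+ 2) * (X u)^-1 = X t * w.
  apply: comp_XDe => //.
  by apply: comp_mem (compM (compM (XV_comp Tu) (X_comp Ttu)) (XV_comp Tu)); zmod.
have w0 : w != 0.
  apply: contraNneq (X_neq0 Ttu) => w0; move: wE; rewrite w0 mulr0 => e.
  apply/eqP/(mulrI (_ : (X u)^-1 \is a GRing.unit)); first by rewrite unitrV X_unit.
  by apply: (mulIr (_ : (X u)^-1 \is a GRing.unit)); rewrite ?unitrV ?X_unit // e !mulr0 mul0r.
pose v := w^-1 *~ (r * eta u).
have re_sgn : is_sign (r * eta u).
  by apply: sign_mul => //; apply: eta_sign.
have De_v : v \in De.
  by rewrite /v; case: re_sgn => ->; rewrite ?mulr1z ?mulrN1z ?memvN De_inv.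
have [c De_c cc] := C_sqrt C De_v.
have c0 : c != 0.
  apply: contraNneq (w0) => c0; have e : v = 0 by rewrite -cc c0 mulr0.
  have := sign_mulrzK w^-1 re_sgn; rewrite -/v e mul0rz => e'.
  by case/eqP: (homog_inv_neq0 De_w w0).
exists ((X u)^-1 * c); split.
- by apply: comp_mem (compM (XV_comp Tu) De_c); zmod.
- by apply: mul_homog_neq0 (XV_comp Tu) _ c0; apply: homog_inv_neq0 (X_comp Tu) _; apply: X_neq0.
rewrite phi0M phi0_XV // mulrzAr.
have -> : (phi0 c * (X u)^-1) *~ eta u * X (t + u *+ 2) * ((X u)^-1 * c)
    = (phi0 c * ((X u)^-1 * X (t + u *+ 2) * (X u)^-1) * c) *~ eta u.
  by rewrite !mulrzAl !mulrA.
rewrite wE mulrA -(notK_skew Tt nKt (X_comp Tt) De_c) -!mulrA (C_comm C De_w De_c).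
rewrite [c * (c * w)]mulrA cc /v mulrzAl mulVr ?(gd_unit De_w) //.
by rewrite mulrzA !mulrzAr mulr1 (sign_mulrzK _ (eta_sign u)).
Qed.

(** Since phi0 j i j = - i, the form i is congruent to its negative: e = 1 or e = j realizes
    whichever sign is needed. *)
Lemma solve_quaternion i j (ii : i * i = -1) (jj : j * j = -1) (ij : i * j = - (j * i))
    (DeE : De = <<[:: 1%R; i; j; (i * j)%R]>>%VS) t u (z : R) (r : int) :
  E = H_type ii jj ij DeE -> u \in T -> t \in T -> z != 0 ->
  X u * X t * X u = z *: X (t + u *+ 2) -> is_sign r ->
  exists d, [/\ d \in 'D_ (- u), d != 0 &
    phi0 d * (X (t + u *+ 2) * i) * d = X t * i *~ r].
Proof.
move=> EE Tu Tt z0 zE r_sgn; move: phi0_conj; rewrite EE /= => conj.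
have nC : ~~ is_C by rewrite /is_C EE.
have De_i : i \in De by rewrite DeE memv_span // !inE eqxx ?orbT.
have De_j : j \in De by rewrite DeE memv_span // !inE eqxx ?orbT.
have j0 : j != 0 by apply: (contra_eq_neq _ jj) => ->; rewrite mulr0 eq_sym oppr_eq0 oner_neq0.
have phi_j : phi0 j = - j by have := conj 0 0 1 0; rewrite !scale0r scale1r !subr0 !add0r addr0.
have [e [De_e e0 eE]] : exists e, [/\ e \in De, e != 0 &
    phi0 e * i * e = i *~ (r * eta u * sgz z)].
  have [|] : r * eta u * sgz z = 1 \/ r * eta u * sgz z = -1.
    by apply: sign_mul (sign_mul _ (eta_sign u)) (sgz_sign z0).
  - by move=> ->; exists 1; rewrite one_De oner_neq0 phi0_1 mul1r mulr1.
  move=> ->; exists j; rewrite De_j j0 phi_j; split=> //.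
  by rewrite mulrN1z mulNr -ij -mulrA jj mulrN1.
have [c c0 cc] : exists2 c : R, c != 0 & c * c = `|z|.
  exists (Num.sqrt `|z|); first by rewrite sqrtr_eq0 -ltNge normr_gt0.
  by rewrite -expr2 sqr_sqrtr.
have XVe x : x \in De -> (X u)^-1 * x = x * (X u)^-1.
  move=> De_x; apply: (mulrI (X_unit Tu)); rewrite mulrA mulrV ?X_unit // mul1r.
  by rewrite mulrA X_comm ?(K_notC nC) // mulrK ?X_unit.
exists (c *: ((X u)^-1 * e)); split.
- by apply: memvZ; apply: comp_mem (compM (XV_comp Tu) De_e); zmod.
- rewrite scaler_eq0 negb_or c0.
  by apply: mul_homog_neq0 (XV_comp Tu) _ e0; apply: homog_inv_neq0 (X_comp Tu) _; apply: X_neq0.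
rewrite linearZ /= -!scalerAl -scalerAr scalerA cc phi0M phi0_XV // mulrzAr !mulrzAl.
have -> : phi0 e * (X u)^-1 * (X (t + u *+ 2) * i) * ((X u)^-1 * e)
    = phi0 e * ((X u)^-1 * X (t + u *+ 2) * (X u)^-1) * (i * e).
  by rewrite !mulrA -[_ * (X u)^-1 * i]mulrA XVe // !mulrA.
rewrite (twistVE Tu z0 zE) -scalerAr -scalerAl -(X_comm (K_notC nC Tt)) ?phi0_comp //.
rewrite -mulrA [phi0 e * _]mulrA eE mulrzAr scalerMzr scalerA scale_sgz // -!mulrzA.
congr (_ *~ _); case: r_sgn => ->; case: (eta_sign u) => ->; case: (sgz_sign z0) => ->; by [].
Qed.

Lemma cosetD g h : pi (g + h) = pi g + pi h :> GT.
Proof. exact: Quotient.pi_add. Qed.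

Lemma cosetN g : pi (- g) = - pi g :> GT.
Proof. exact: Quotient.pi_opp. Qed.

Lemma coset_eq0 g : (g \in T) = (pi g == 0 :> GT).
Proof.
have pi0 : pi 0 = 0 :> GT by apply: (addrI (pi 0 : GT)); rewrite -cosetD !addr0.
by rewrite -pi0 -[g in LHS]subr0; apply: Quotient.idealrBE.
Qed.

Variable xi : GT -> G.
Hypothesis xi_section : coset_section xi.

Lemma coset_xi x : pi (xi x) = x.
Proof. exact: xi_section. Qed.

Lemma self_dualE g0 x : (x \in self_dual xi g0) = (- pi g0 - x == x :> GT).
Proof.
rewrite unfold_in /tau coset_eq0 mulr2n !cosetD !coset_xi addrA addr_eq0.
by rewrite -opprD eqr_oppLR.
Qed.

(** * The models in monomial form *)

Section Model.
Variables (p : triple D) (o : support_order xi p).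
Local Notation kappa := (tr_kappa p).
Local Notation n := (model_size o).
Hypothesis p_inX : inX E phi0 delta X xi p.

Lemma kappa_sym x : kappa (- pi (tr_g0 p) - x) = kappa x.
Proof. by case: p_inX => -[_ _ + _ _]; apply. Qed.

(* A row a is labelled by its coset cs a and its position ix a < kappa (cs a).
   In row a, Phi has the single nonzero entry phi_at a, in column bar a, where bar
   is an involution. *)
Definition cs (a : 'I_n) : GT :=
  match split a with
  | inl b => sup_x o (tagnat.sig1 b)
  | inr b => if split (tagnat.sig2 b) is inl _
             then sup_y o (tagnat.sig1 b) else sup_z o (tagnat.sig1 b)
  end.

Definition ix (a : 'I_n) : nat :=
  match split a with
  | inl b => tagnat.sig2 b
  | inr b => match split (tagnat.sig2 b) with inl i => i | inr i => i end
  end.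

Lemma row_degreeE a : row_degree a = xi (cs a).
Proof. by []. Qed.

Definition at_x i (k : 'I_(kappa (sup_x o i))) : 'I_n := lshift _ (tagnat.Rank i k).
Definition at_y j (k : 'I_(kappa (sup_z o j))) : 'I_n :=
  rshift _ (tagnat.Rank j (lshift _ k)).
Definition at_z j (k : 'I_(kappa (sup_z o j))) : 'I_n :=
  rshift _ (tagnat.Rank j (rshift _ k)).

Variant position (a : 'I_n) : Prop :=
| PositionX i k of a = @at_x i k
| PositionY j k of a = @at_y j k
| PositionZ j k of a = @at_z j k.

Lemma positionP a : position a.
Proof.
case: (split_ordP a) => b ->; rewrite -(tagnat.sig2K b).
  by apply: (@PositionX _ _ (tagnat.sig2 b)).
by case: (split_ordP (tagnat.sig2 b)) => k ->; 
  [apply: (PositionY (k := k)) | apply: (PositionZ (k := k))].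
Qed.

Lemma cs_x i k : cs (@at_x i k) = sup_x o i.
Proof. by rewrite /cs /at_x (unsplitK (inl _)) tagnat.Rank1K. Qed.

Lemma ix_x i k : ix (@at_x i k) = k.
Proof. by rewrite /ix /at_x (unsplitK (inl _)) tagnat.Rank2K. Qed.

Lemma cs_y j k : cs (@at_y j k) = sup_y o j.
Proof.
by rewrite /cs /at_y (unsplitK (inr _)) /tagnat.sig2 /tagnat.sig1
  /tagnat.Rank tagnat.rankK /= (unsplitK (inl _)).
Qed.

Lemma ix_y j k : ix (@at_y j k) = k.
Proof.
by rewrite /ix /at_y (unsplitK (inr _)) /tagnat.sig2 /tagnat.sig1
  /tagnat.Rank tagnat.rankK /= (unsplitK (inl _)).
Qed.

Lemma cs_z j k : cs (@at_z j k) = sup_z o j.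
Proof.
by rewrite /cs /at_z (unsplitK (inr _)) /tagnat.sig2 /tagnat.sig1
  /tagnat.Rank tagnat.rankK /= (unsplitK (inr _)).
Qed.

Lemma ix_z j k : ix (@at_z j k) = k.
Proof.
by rewrite /ix /at_z (unsplitK (inr _)) /tagnat.sig2 /tagnat.sig1
  /tagnat.Rank tagnat.rankK /= (unsplitK (inr _)).
Qed.


Lemma kappa_yz j : kappa (sup_y o j) = kappa (sup_z o j).
Proof. by rewrite -[LHS]kappa_sym -(sup_pair j) addrAC subrr add0r. Qed.

Lemma ix_lt a : (ix a < kappa (cs a))%N.
Proof.
case: (positionP a) => [i k|j k|j k] ->.
- by rewrite cs_x ix_x.
- by rewrite cs_y ix_y kappa_yz.
- by rewrite cs_z ix_z.
Qed.

Lemma at_ex x i : (i < kappa x)%N -> exists2 a, cs a = x & ix a = i.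
Proof.
move=> lt_i; have : kappa x != 0%N by rewrite -lt0n (leq_ltn_trans _ lt_i).
rewrite -(sup_mem o) !mem_cat => /or3P[] /codomP[j ej]; move: lt_i; rewrite ej => lt_i.
- by exists (at_x (Ordinal lt_i)); rewrite ?cs_x ?ix_x.
- by rewrite kappa_yz in lt_i; exists (at_y (Ordinal lt_i)); rewrite ?cs_y ?ix_y.
- by exists (at_z (Ordinal lt_i)); rewrite ?cs_z ?ix_z.
Qed.

Lemma sup_inj : [/\ injective (sup_x o), injective (sup_y o) & injective (sup_z o)].
Proof.
have := sup_uniq o; rewrite !cat_uniq => /and3P[x_uniq _ /and3P[y_uniq _ z_uniq]].
by split; apply/injectiveP.
Qed.

Lemma sup_neq : [/\ forall i j, sup_x o i <> sup_y o j,
  forall i j, sup_x o i <> sup_z o j & forall j j', sup_y o j <> sup_z o j'].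
Proof.
have := sup_uniq o; rewrite !cat_uniq => /and3P[_ /hasPn x_yz /and3P[_ /hasPn yz _]].
split=> [i j e|i j e|j j' e].
- have /x_yz : sup_y o j \in codom (sup_y o) ++ codom (sup_z o) by rewrite mem_cat codom_f.
  by rewrite /= -e codom_f.
- have /x_yz : sup_z o j \in codom (sup_y o) ++ codom (sup_z o).
    by rewrite mem_cat codom_f orbT.
  by rewrite /= -e codom_f.
- by have /yz := codom_f (sup_z o) j'; rewrite /= -e codom_f.
Qed.

Lemma cs_ix_inj a b : cs a = cs b -> ix a = ix b -> a = b.
Proof.
have [x_inj y_inj z_inj] := sup_inj; have [xy xz yz] := sup_neq.
case: (positionP a) => i k ->; case: (positionP b) => j l ->;
  rewrite ?(cs_x, cs_y, cs_z, ix_x, ix_y, ix_z) => ecs;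
  try by [case: (xy _ _ ecs) | case: (xz _ _ ecs) | case: (yz _ _ ecs)
        | case: (xy _ _ (esym ecs)) | case: (xz _ _ (esym ecs)) | case: (yz _ _ (esym ecs))].
- by move/x_inj: ecs => ecs; move: k; rewrite ecs => k /val_inj ->.
- by move/y_inj: ecs => ecs; move: k; rewrite ecs => k /val_inj ->.
- by move/z_inj: ecs => ecs; move: k; rewrite ecs => k /val_inj ->.
Qed.

Local Notation g0 := (tr_g0 p).
Local Notation sigma := (tr_sigma p).
Local Notation tau := (Defs.tau xi g0).
Local Notation sp := (signature_place E phi0 delta X xi g0).

Definition symplectic (x : GT) : bool :=
  (x \in self_dual xi g0) &&
  match E with
  | R_type _ => eta (tau x) != delta
  | C_type _ _ _ => (tau x \notin K) && (eta (tau x) != delta)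
  | H_type _ _ _ _ _ _ => false
  end.

Definition bar_ix (x : GT) (i : nat) : nat :=
  if symplectic x then half_flip (kappa x) i else i.

Definition pos_size (x : GT) : nat := `|(((kappa x)%:Z + sigma x) %/ 2)%Z|%N.

Definition neg_size (x : GT) : nat := `|(((kappa x)%:Z - sigma x) %/ 2)%Z|%N.

Definition coef (x : GT) (i : nat) : D :=
  if symplectic x then if (i < (kappa x)./2)%N then 1 else -1
  else if x \in sp then if (i < pos_size x)%N then 1 else -1
  else if E is H_type i _ _ _ _ _ then i else 1.

Lemma opp_of_neq_sign (e : int) : is_sign e -> e != delta -> e = - delta.
Proof. by case: delta_sign => -> [] ->. Qed.

Lemma symplectic_even x : symplectic x -> ~~ odd (kappa x).
Proof.
case: p_inX => [[_ _ _ adm] _] /andP[/adm].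
case: E => [DeE adm_x neq|i ii DeE adm_x /andP[nK neq]|//].
  by apply: adm_x; apply: opp_of_neq_sign neq; apply: eta_sign.
by apply: adm_x => //; apply: opp_of_neq_sign neq; apply: eta_sign.
Qed.

Lemma sizes x : x \in sp ->
  (pos_size x + neg_size x = kappa x)%N /\ (pos_size x)%:Z - (neg_size x)%:Z = sigma x.
Proof.
case: p_inX => _ /(_ x)[sig_le] + x_sp; rewrite x_sp => sig_mod.
exact: signature_parts.
Qed.

Lemma S_signatureE x (i j : 'I_(kappa x)) : x \in sp ->
  S_signature p x i j = if j == i :> nat then if (i < pos_size x)%N then 1 else -1 else 0.
Proof. by move=> /sizes[e _]; rewrite /S_signature conform_signatureE. Qed.

Lemma S_symplecticE x (i j : 'I_(kappa x)) : symplectic x ->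
  S_symplectic D (kappa x) i j = if j == half_flip (kappa x) i :> nat
    then if (i < (kappa x)./2)%N then 1 else -1 else 0 :> D.
Proof. by move=> /symplectic_even even_k; rewrite /S_symplectic conform_symplecticE. Qed.

Lemma symplectic_sp x : symplectic x -> x \in sp -> False.
Proof.
move=> /andP[_ sym] /andP[_]; move: sym.
by case: E => [? /negPf ->|? ? ? /andP[/negPf ->]|].
Qed.

Lemma S_self_dualE x (i j : 'I_(kappa x)) : x \in self_dual xi g0 ->
  S_self_dual E phi0 delta X xi p x i j = if j == bar_ix x i :> nat then coef x i else 0.
Proof.
move=> sd; rewrite /bar_ix /coef.
have [sym|nsym] := boolP (symplectic x).
  rewrite -S_symplecticE // /S_self_dual; move: sym; rewrite /symplectic sd /=.
  by case: E => [? /negPf ->|? ? ? /andP[/negPf -> /negPf ->]|].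
have [x_sp|nsp] := boolP (x \in sp).
  rewrite -S_signatureE // /S_self_dual; move: x_sp; rewrite unfold_in sd /=.
  by case: E => [? ->|? ? ? ->|? ? ? ? ? ? ->].
rewrite /S_self_dual; move: nsym nsp; rewrite /symplectic [x \in sp]unfold_in sd /=.
case: E => [?|? ? ?|? ? ? ? ? ?]; first by rewrite negbK => ->.
  by rewrite negb_and => /orP[/negPn ->//|/negPn ->] /negPf ->; rewrite scalar_mxE.
by move=> _ /negPf ->; rewrite scalar_mxE.
Qed.

(** Off the self-dual cosets t is symmetric in the pair, so both rows carry the same X_t; membership
    in [codom (sup_z o)] singles out the second block of [S_pair], the one with the sign delta
    eta. *)
Definition phi_at (a : 'I_n) : D :=
  if cs a \in self_dual xi g0 then X (tau (cs a)) * coef (cs a) (ix a)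
  else let t := g0 + xi (cs a) + xi (- pi g0 - cs a) in
       X t *~ (if cs a \in codom (sup_z o) then delta * eta t else 1).

Definition is_bar (a b : 'I_n) : bool :=
  (cs b == - pi g0 - cs a) && (ix b == bar_ix (cs a) (ix a)).

Lemma dual_y j : - pi g0 - sup_y o j = sup_z o j.
Proof. by rewrite -(sup_pair j) addrAC subrr add0r. Qed.

Lemma dual_z j : - pi g0 - sup_z o j = sup_y o j.
Proof. by rewrite -(sup_pair j) addrK. Qed.

Lemma dual_x i : - pi g0 - sup_x o i = sup_x o i.
Proof. by have := sup_self_dual i; rewrite self_dualE => /eqP. Qed.

Lemma y_not_self_dual j : sup_y o j \in self_dual xi g0 = false.
Proof.
have [_ _ yz] := sup_neq; rewrite self_dualE dual_y.
by apply/eqP => /esym/yz.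
Qed.

Lemma z_not_self_dual j : sup_z o j \in self_dual xi g0 = false.
Proof. by have [_ _ yz] := sup_neq; rewrite self_dualE dual_z; apply/eqP => /yz. Qed.

Lemma y_notin_z j : sup_y o j \in codom (sup_z o) = false.
Proof. by have [_ _ yz] := sup_neq; apply/negP => /codomP[k /yz]. Qed.

Lemma bar_ix_nsd x i : x \in self_dual xi g0 = false -> bar_ix x i = i.
Proof. by rewrite /bar_ix /symplectic => ->. Qed.

Lemma PhiE a b : Phi E phi0 delta X o a b = if is_bar a b then phi_at a else 0.
Proof.
have [x_inj y_inj z_inj] := sup_inj; have [xy xz yz] := sup_neq.
rewrite /is_bar /phi_at /Phi.
case: (positionP a) => i k ->; case: (positionP b) => j l ->;
  rewrite ?(cs_x, cs_y, cs_z, ix_x, ix_y, ix_z) ?(dual_x, dual_y, dual_z).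
- rewrite /at_x block_mxEul (sup_self_dual i).
  have [eij|nij] := eqVneq i j.
    move: l; rewrite -eij => l; rewrite eqxx mxdiag_RankE mxE S_self_dualE ?sup_self_dual //.
    by rewrite /=; case: ifP => // _; rewrite mulr0.
  by rewrite mxdiag_Rank_neq // (inj_eq x_inj) eq_sym (negPf nij).
- by rewrite block_mxEur mxE; case: eqP => // /esym/xy.
- by rewrite block_mxEur mxE; case: eqP => // /esym/xz.
- by rewrite block_mxEdl mxE; case: eqP => // /xz.
- rewrite block_mxEdr; case: eqP => [/yz//|_] /=.
  have [eij|nij] := eqVneq i j; last by rewrite mxdiag_Rank_neq.
  by move: l; rewrite -eij => l; rewrite mxdiag_RankE mxE /S_pair block_mxEul mxE mulr0.
- rewrite block_mxEdr (inj_eq z_inj) y_not_self_dual y_notin_z.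
  rewrite bar_ix_nsd ?y_not_self_dual //.
  have [eij|nij] := eqVneq j i; last by rewrite mxdiag_Rank_neq // eq_sym.
  move: l; rewrite eij => l; rewrite mxdiag_RankE mxE /S_pair block_mxEur scalar_mxE.
  by rewrite /=; case: ifP => _; rewrite ?mulr0 ?mulr1 ?mulr1z.
- by rewrite block_mxEdl mxE; case: eqP => // /xy.
- rewrite block_mxEdr (inj_eq y_inj) z_not_self_dual codom_f.
  rewrite bar_ix_nsd ?z_not_self_dual //.
  have [eij|nij] := eqVneq j i; last by rewrite mxdiag_Rank_neq // eq_sym.
  move: l; rewrite eij => l; rewrite mxdiag_RankE mxE /S_pair block_mxEdl scalar_mxE.
  rewrite /pair_degree [g0 + xi (sup_z o i) + _]addrAC.
  by rewrite /=; case: ifP => _; rewrite ?mulr0 ?mulrzr.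
rewrite block_mxEdr; case: eqP => [/esym/yz//|_] /=.
have [eij|nij] := eqVneq i j; last by rewrite mxdiag_Rank_neq.
by move: l; rewrite -eij => l; rewrite mxdiag_RankE mxE /S_pair block_mxEdr mxE mulr0.
Qed.

Lemma dualK x : - pi g0 - (- pi g0 - x) = x.
Proof. by rewrite opprB addrC subrK. Qed.

Lemma self_dual_dual x : (- pi g0 - x \in self_dual xi g0) = (x \in self_dual xi g0).
Proof. by rewrite !self_dualE dualK eq_sym. Qed.

Lemma symplectic_dual x : symplectic (- pi g0 - x) = symplectic x.
Proof.
have [sd|nsd] := boolP (x \in self_dual xi g0).
  by move: sd; rewrite self_dualE => /eqP ->.
by rewrite /symplectic self_dual_dual (negPf nsd).
Qed.

Lemma bar_ix_lt x i : (i < kappa x)%N -> (bar_ix x i < kappa x)%N.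
Proof.
by move=> lt_i; rewrite /bar_ix; case: ifP => // sym; rewrite half_flip_lt ?symplectic_even.
Qed.

(** The default a is never taken: by [barP] the pick always succeeds. *)
Definition bar (a : 'I_n) : 'I_n := odflt a [pick b | is_bar a b].

Lemma barP a : cs (bar a) = - pi g0 - cs a /\ ix (bar a) = bar_ix (cs a) (ix a).
Proof.
have [b cs_b ix_b] : exists2 b, cs b = - pi g0 - cs a & ix b = bar_ix (cs a) (ix a).
  by apply: at_ex; rewrite kappa_sym bar_ix_lt ?ix_lt.
rewrite /bar; case: pickP => [c /andP[/eqP -> /eqP ->]//|/(_ b)].
by rewrite /is_bar cs_b ix_b !eqxx.
Qed.

Lemma cs_bar a : cs (bar a) = - pi g0 - cs a.
Proof. by case: (barP a). Qed.

Lemma ix_bar a : ix (bar a) = bar_ix (cs a) (ix a).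
Proof. by case: (barP a). Qed.

Lemma is_barE a b : is_bar a b = (b == bar a).
Proof.
apply/andP/eqP => [[/eqP e1 /eqP e2]|->]; last by rewrite cs_bar ix_bar !eqxx.
by apply: cs_ix_inj; rewrite ?cs_bar ?ix_bar.
Qed.

Lemma barK : involutive bar.
Proof.
move=> a; apply: cs_ix_inj; rewrite ?cs_bar ?dualK // !ix_bar cs_bar.
rewrite /bar_ix symplectic_dual; have [sym|//] := boolP (symplectic (cs a)).
by rewrite kappa_sym half_flipK ?symplectic_even ?ix_lt.
Qed.

Lemma Phi_barE a b : Phi E phi0 delta X o a b = if b == bar a then phi_at a else 0.
Proof. by rewrite PhiE is_barE. Qed.

Lemma bar_fixed a : (bar a == a) = (cs a \in self_dual xi g0) && ~~ symplectic (cs a).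
Proof.
rewrite eq_sym -is_barE /is_bar eq_sym -self_dualE; congr (_ && _).
rewrite /bar_ix; case: ifP => [sym|_]; last exact: eqxx.
by rewrite eq_sym (negPf (half_flip_neq _ _)) ?ix_lt ?symplectic_even.
Qed.

Lemma H_unit_De : if E is H_type i _ _ _ _ _ then
  [/\ i \in gd_comp D 0, i != 0 & phi0 i = - i] else True.
Proof.
move: phi0_conj; case: E => // i j ii jj ij DeE /= conj; split.
- by rewrite DeE memv_span // !inE eqxx ?orbT.
- apply/eqP => i0; have := oner_neq0 D.
  by rewrite -oppr_eq0 -ii i0 mulr0 eqxx.
by have := conj 0 1 0 0; rewrite !scale0r scale1r !subr0 !add0r !addr0.
Qed.

Lemma coef_De x i : coef x i \in gd_comp D 0.
Proof.
have one := one_De D; rewrite /coef; case: ifP => _; [|case: ifP => _].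
- by case: ifP => _; rewrite // memvN.
- by case: ifP => _; rewrite // memvN.
by have := H_unit_De; case: E => // ? ? ? ? ? ? [].
Qed.

Lemma coef_neq0 x i : coef x i != 0.
Proof.
have one := oner_neq0 D; rewrite /coef; case: ifP => _; [|case: ifP => _].
- by case: ifP; rewrite ?oppr_eq0.
- by case: ifP; rewrite ?oppr_eq0.
by have := H_unit_De; case: E => // ? ? ? ? ? ? [].
Qed.

Lemma tau_T x : x \in self_dual xi g0 -> tau x \in T.
Proof. by rewrite unfold_in. Qed.

Lemma dual_T x : g0 + xi x + xi (- pi g0 - x) \in T.
Proof. by rewrite coset_eq0 !cosetD !coset_xi -opprD subrr. Qed.

Lemma phi_at_comp a :
  phi_at a \in 'D_ (g0 + row_degree a + row_degree (bar a)).
Proof.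
rewrite !row_degreeE cs_bar /phi_at; case: ifP => sd.
  have -> : - pi g0 - cs a = cs a by move: sd; rewrite self_dualE => /eqP.
  apply: comp_mem (compM (X_comp (tau_T sd)) (coef_De _ _)).
  by rewrite /Defs.tau; zmod.
have Xt := X_comp (dual_T (cs a)).
by case: ifP => _; 
  [case: delta_sign => ->; case: (eta_sign (g0 + xi (cs a) + xi (- pi g0 - cs a))) => -> |];
  rewrite ?mulN1r ?mul1r ?opprK ?mulr1z ?mulrN1z ?memvN.
Qed.

Lemma phi_at_neq0 a : phi_at a != 0.
Proof.
rewrite /phi_at; case: ifP => sd.
  by apply: mul_homog_neq0 (X_comp (tau_T sd)) (X_neq0 (tau_T sd)) (coef_neq0 _ _).
have X0 := X_neq0 (dual_T (cs a)).
by case: ifP => _; 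
  [case: delta_sign => ->; case: (eta_sign (g0 + xi (cs a) + xi (- pi g0 - cs a))) => -> |];
  rewrite ?mulN1r ?mul1r ?opprK ?mulr1z ?mulrN1z ?oppr_eq0.
Qed.

Lemma sp_eta x : x \in sp -> eta (tau x) = delta.
Proof.
rewrite unfold_in => /andP[sd]; case: (boolP (is_C)) => [C|].
  move=> h; have Kt : tau x \in K by move: C h; rewrite /is_C; case: E.
  by rewrite (is_C_eta C Kt).
by rewrite /is_C; case: E => // *; apply/eqP.
Qed.

Lemma sp_K x : x \in sp -> tau x \in K.
Proof.
rewrite unfold_in => /andP[/tau_T Tt]; case: (boolP (is_C)) => [C|nC].
  by move: C; rewrite /is_C; case: E.
by move=> _; apply: K_notC.
Qed.

Lemma sp_self_dual x : x \in sp -> x \in self_dual xi g0.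
Proof. by rewrite unfold_in => /andP[]. Qed.

Lemma symplectic_eta x : symplectic x -> eta (tau x) = - delta.
Proof.
move=> /andP[_]; move=> sym; apply: opp_of_neq_sign; first exact: eta_sign.
by move: sym; case: E => // ? ? ? /andP[].
Qed.

(* In these cosets S is 1 (over C) or the imaginary unit (over H). *)
Lemma rest_cases x : x \in self_dual xi g0 -> ~~ symplectic x -> x \notin sp ->
  match E with
  | R_type _ => False
  | C_type _ _ _ => tau x \notin K /\ eta (tau x) = delta
  | H_type _ _ _ _ _ _ => eta (tau x) = - delta
  end.
Proof.
move=> sd; rewrite /symplectic [x \in sp]unfold_in sd /=.
have := @opp_of_neq_sign _ (eta_sign (tau x)).
case: E => [?|? ? ?|? ? ? ? ? ?] op.
- by rewrite negbK => ->.
- by rewrite negb_and => /orP[/negPn ->//|/negPn/eqP].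
by move=> _ /op.
Qed.

(** Exactly one member of each pair is listed by [sup_z], so the extra sign in [phi_at] sits on one
    of the rows a and [bar a] only. *)
Lemma codom_z_dual a : cs a \notin self_dual xi g0 ->
  (- pi g0 - cs a \in codom (sup_z o)) = (cs a \notin codom (sup_z o)).
Proof.
case: (positionP a) => [i k|j k|j k] ->; [rewrite cs_x | rewrite cs_y | rewrite cs_z].
- by rewrite sup_self_dual.
- by rewrite dual_y codom_f y_notin_z.
by rewrite dual_z codom_f y_notin_z.
Qed.

(** Phi is delta-hermitian, which dictates the block types: coefficients 1 and -1 on the diagonal go
    with eta = delta, while for eta = - delta the missing sign comes from the symplectic exchange or
    from phi0 i = - i. For a pair it is the factor delta eta. *)
Lemma phi_at_herm a : phi0 (phi_at a) = phi_at (bar a) *~ delta.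
Proof.
rewrite /phi_at cs_bar ix_bar self_dual_dual.
have [sd|nsd] := boolP (cs a \in self_dual xi g0).
  have -> : - pi g0 - cs a = cs a by move: sd; rewrite self_dualE => /eqP.
  have Tt := tau_T sd; rewrite phi0M (phi0_X Tt).
  rewrite /coef /bar_ix; case: ifP => [sym|/negbT nsym].
    rewrite symplectic_eta // half_flip_half ?symplectic_even ?ix_lt //.
    by case: ifP => _; case: delta_sign => ->;
      rewrite /= ?linearN /= phi0_1 ?(mulr1z, mulrN1z, opprK, mulr1, mulN1r, mulrN1, mul1r).
  case: ifP => [x_sp|/negbT nsp].
    rewrite sp_eta //.
    by case: ifP => _; case: delta_sign => ->;
      rewrite /= ?linearN /= phi0_1 ?(mulr1z, mulrN1z, opprK, mulr1, mulN1r, mulrN1, mul1r).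
  have := rest_cases sd nsym nsp; have := H_unit_De; have := X_choice Tt.
  case: E => // [? ? ? _ _ [_ ->]|i j ii jj ij DeE [_ _ XK] [De_i _ phi_i] ->].
    by rewrite phi0_1 mul1r mulr1.
  by rewrite phi_i mulrNz mulrN mulNr opprK mulrzAr XK // mulrzAl.
have phiX := phi0_X (dual_T (cs a)).
rewrite dualK [g0 + xi (- pi g0 - cs a) + _]addrAC.
set t := g0 + _ + _ in phiX *.
rewrite codom_z_dual // -!mulrzA; case: ifP => /= _; rewrite ?mulr1z.
  by case: delta_sign => ->; move: phiX; case: (eta_sign t) => -> phiX;
    rewrite ?mulN1r ?mul1r ?opprK ?mulr1z ?mulrN1z ?linearN /= ?phiX ?mulr1z ?mulrN1z ?opprK.
by rewrite phiX ; case: delta_sign => ->; case: (eta_sign t) => ->.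
Qed.

Definition Phi_inverse : 'M[D]_n := \matrix_(a, b) if b == bar a then (phi_at b)^-1 else 0.

Lemma phi_at_unit a : phi_at a \is a GRing.unit.
Proof. exact: gd_unit (phi_at_comp a) (phi_at_neq0 a). Qed.

Lemma Phi_mulV : Phi E phi0 delta X o *m Phi_inverse = 1%:M.
Proof.
apply/matrixP => a b; rewrite !mxE (bigD1 (bar a)) //= Phi_barE eqxx mxE barK.
rewrite big1 => [|c /negPf nc]; last by rewrite Phi_barE nc mul0r.
by rewrite addr0 eq_sym; case: eqP => [->|_]; rewrite ?mulr0 // mulrV ?phi_at_unit.
Qed.

Lemma Phi_Vmul : Phi_inverse *m Phi E phi0 delta X o = 1%:M.
Proof.
apply/matrixP => a b; rewrite !mxE (bigD1 (bar a)) //= Phi_barE mxE eqxx barK.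
rewrite big1 => [|c /negPf nc]; last by rewrite mxE nc mul0r.
by rewrite addr0 eq_sym; case: eqP => [->|_]; rewrite ?mulr0 // mulVr ?phi_at_unit.
Qed.

Lemma matrix_inverse_Phi : matrix_inverse (Phi E phi0 delta X o) = Phi_inverse.
Proof. exact: matrix_inverse_unique Phi_mulV Phi_Vmul. Qed.

Lemma model_invE (A : 'M[D]_n) a b :
  model_inv E phi0 delta X A a b
    = (phi_at (bar a))^-1 * phi0 (A (bar b) (bar a)) * phi_at (bar b).
Proof.
rewrite /model_inv matrix_inverse_Phi mxE (bigD1 (bar b)) //= Phi_barE barK eqxx.
rewrite big1 => [|c nc]; last first.
  by rewrite Phi_barE -{1}[b]barK (inj_eq (can_inj barK)) eq_sym (negPf nc) mulr0.
rewrite addr0 mxE (bigD1 (bar a)) //= mxE eqxx big1 ?addr0 => [|c /negPf nc].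
  by rewrite !mxE.
by rewrite mxE nc mul0r.
Qed.

End Model.

(** * Block types under translation by g *)

Section Shift.
Variables (g g0 g0' : G).
Hypothesis g0'E : g0' = g0 - g *+ 2.

Definition shift_u (x : GT) : G := - xi x - g + xi (x + pi g).

Lemma shift_u_T x : shift_u x \in T.
Proof.
rewrite coset_eq0 /shift_u !cosetD !cosetN !(coset_xi).
by apply/eqP; zmod.
Qed.

(** The origin of t + 2u in the action of g: it is the degree [tau] of the translated coset for the
    translated base point. *)
Lemma tau_shift x : tau xi g0' (x + pi g) = tau xi g0 x + shift_u x *+ 2.
Proof. by rewrite /tau /shift_u g0'E; zmod. Qed.

Lemma self_dual_shift x : (x + pi g \in self_dual xi g0') = (x \in self_dual xi g0).
Proof. by rewrite [LHS]unfold_in [RHS]unfold_in /self_dual tau_shift T_add2 // shift_u_T. Qed.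

Lemma dual_shift x : - pi g0' - (x + pi g) = (- pi g0 - x) + pi g :> GT.
Proof. by rewrite g0'E mulr2n !(cosetD, cosetN); zmod. Qed.

Lemma eta_shift x : x \in self_dual xi g0 ->
  Defs.eta phi0 X (tau xi g0' (x + pi g)) = Defs.eta phi0 X (tau xi g0 x).
Proof.
move=> sd; rewrite tau_shift; apply: (eta_add2).
  exact: shift_u_T.
by rewrite unfold_in in sd.
Qed.

Lemma K_shift x : (tau xi g0' (x + pi g) \in K) = (tau xi g0 x \in K).
Proof.
rewrite tau_shift; apply: (K_add2).
exact: shift_u_T.
Qed.

Lemma sp_shift x : (x + pi g \in signature_place E phi0 delta X xi g0')
  = (x \in signature_place E phi0 delta X xi g0).
Proof.
rewrite [LHS]unfold_in [RHS]unfold_in /signature_place self_dual_shift; case sd: (x \in _) => //=.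
by rewrite K_shift eta_shift.
Qed.

End Shift.

Section ShiftTriple.
Variables (g : G) (p p' : triple D).
Hypothesis g0'E : tr_g0 p' = tr_g0 p - g *+ 2.

Lemma symplectic_shift x :
  symplectic p' (x + pi g) = symplectic p x.
Proof.
rewrite /symplectic (self_dual_shift g0'E); case sd: (x \in _) => //=.
have etaE := eta_shift g0'E sd.
have KE := K_shift g0'E x.
by move: KE; case: E => [?|? ? ?|? ? ? ? ? ?] KE; rewrite ?KE ?etaE.
Qed.

Lemma bar_ix_shift x i : tr_kappa p' (x + pi g) = tr_kappa p x ->
  bar_ix p' (x + pi g) i = bar_ix p x i.
Proof. by rewrite /bar_ix symplectic_shift => ->. Qed.

End ShiftTriple.

(** * Triples in the same orbit *)

Section Transport.
Variables (p p' : triple D).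
Hypotheses (p_inX : inX E phi0 delta X xi p) (p'_inX : inX E phi0 delta X xi p').
Variables (o : support_order xi p) (o' : support_order xi p').
Local Notation n := (model_size o).
Local Notation n' := (model_size o').
Local Notation sp := (signature_place E phi0 delta X xi (tr_g0 p)).

Section Isomorphism.
Variables (g : G) (e : int) (pm : 'I_n -> 'I_n') (q : 'I_n' -> 'I_n) (d : 'I_n -> D).
Hypotheses (e_sign : is_sign e) (pmK : cancel pm q) (qK : cancel q pm).
Hypothesis pm_bar : forall a, pm (bar a) = bar (pm a).
Hypothesis Dd : forall a, d a \in 'D_ (g + row_degree a - row_degree (pm a)).
Hypothesis d0 : forall a, d a != 0.
Hypothesis d_form : forall a, phi0 (d a) * phi_at (pm a) * d (bar a) = phi_at a *~ e.

(* Conjugation by the monomial matrix with entry d a at (pm a, a). *)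
Lemma monomial_isomorphism : isomorphic (M E phi0 delta X o) (M E phi0 delta X o').
Proof.
have Ud a : d a \is a GRing.unit by apply: gd_unit (Dd a) (d0 a).
have UdV a : (d a)^-1 \is a GRing.unit by rewrite unitrV.
have DdV a : (d a)^-1 \in 'D_ (row_degree (pm a) - row_degree a - g).
  by apply: comp_mem (comp_inv (Dd a) (d0 a)); zmod.
pose f (A : 'M[D]_n) : 'M[D]_n' := \matrix_(c, c') (d (q c) * A (q c) (q c') * (d (q c'))^-1).
pose f' (B : 'M[D]_n') : 'M[D]_n := \matrix_(a, b) ((d a)^-1 * B (pm a) (pm b) * d b).
have fE A a b : f A (pm a) (pm b) = d a * A a b * (d b)^-1 by rewrite mxE !pmK.
exists f; split.
- exists f' => A; apply/matrixP => a b; rewrite !mxE ?pmK ?qK.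
    by rewrite !mulrA mulVr // mul1r -mulrA mulVr // mulr1.
  by rewrite !mulrA mulrV // mul1r -mulrA mulrV // mulr1.
- split; first by move=> A B; apply/matrixP => a b; rewrite !mxE mulrDr mulrDl.
  split.
    move=> A B; apply/matrixP => a b; rewrite !mxE mulr_sumr mulr_suml.
    rewrite [RHS](reindex pm) /=; last by exists q => c _; rewrite ?pmK ?qK.
    apply: eq_bigr => c _; rewrite !mxE pmK.
    by rewrite !mulrA -[_ * (d c)^-1 * d c]mulrA mulVr // mulr1.
  apply/matrixP => a b; rewrite !mxE (inj_eq (can_inj qK)).
  by case: eqP => [->|_]; rewrite ?mulr0 ?mul0r // mulr1 mulrV.
- by move=> r A; apply/matrixP => a b; rewrite !mxE -scalerAr -scalerAl.
- move=> h A; split=> hA a b t eq_t.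
    rewrite mxE; have Aab : A (q a) (q b) \in 'D_ (h - row_degree (q a) + row_degree (q b)).
      by apply: hA; zmod.
    apply: comp_mem (compM (compM (Dd _) Aab) (DdV _)).
    by rewrite !qK; zmod_from (esym eq_t).
  have -> : A a b = (d a)^-1 * f A (pm a) (pm b) * d b.
    by rewrite fE !mulrA mulVr // mul1r -mulrA mulVr // mulr1.
  have fAab : f A (pm a) (pm b) \in 'D_ (h - row_degree (pm a) + row_degree (pm b)).
    by apply: hA; zmod.
  by apply: comp_mem (compM (compM (DdV _) fAab) (Dd _)); zmod_from (esym eq_t).
move=> A; apply/matrixP => c c'; rewrite -[c]qK -[c']qK.
set a := q c; set b := q c'; rewrite fE.
change (d a * model_inv E phi0 delta X A a b * (d b)^-1
        = model_inv E phi0 delta X (f A) (pm a) (pm b)).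
rewrite !model_invE // -!pm_bar fE !phi0M phi0V //.
have U a' : phi_at (pm a') \is a GRing.unit by apply: phi_at_unit.
have V (a' : 'I_n) : phi_at a' \is a GRing.unit by apply: phi_at_unit.
have Uphi a' : phi0 (d a') \is a GRing.unit.
  by apply: gd_unit (phi0_comp (Dd a')) _; rewrite phi0_eq0.
have Ve a' : phi_at (a' : 'I_n) *~ e \is a GRing.unit.
  by case: e_sign => ->; rewrite ?mulr1z ?mulrN1z ?unitrN.
have inv_e (x : D) : (x *~ e)^-1 = x^-1 *~ e.
  by case: e_sign => ->; rewrite ?mulr1z ?mulrN1z ?invrN.
(* [d_form] is used at [bar a] for the left factor and at [bar b] for the right one. Each use
   contributes one sign e, and the two cancel. *)
have dl : d a * (phi_at (bar a))^-1 *~ e = (phi_at (pm (bar a)))^-1 * (phi0 (d (bar a)))^-1.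
  have e1 := d_form (bar a); rewrite barK // in e1.
  have -> : d a = (phi_at (pm (bar a)))^-1 * (phi0 (d (bar a)))^-1 * (phi_at (bar a) *~ e).
    by rewrite -e1 -!mulrA mulKr // mulKr.
  by rewrite -mulrzAr -inv_e mulrK.
have dr : phi0 (d (bar b)) * phi_at (pm (bar b)) = phi_at (bar b) * (d b)^-1 *~ e.
  have e1 := d_form (bar b); rewrite barK // in e1.
  by rewrite -mulrzAl -e1 mulrK.
rewrite !mulrA -dl -[RHS]mulrA dr !mulrzAl mulrzAr !mulrA.
by rewrite (sign_mulrzK _ e_sign).
Qed.

End Isomorphism.

(** The sign in the action of g, indexed by the source coset x instead of the target, so that u
    becomes [shift_u g x]. *)
Definition twist_sign (g : G) (x : GT) : int :=
  let t := tau xi (tr_g0 p) x in let u := shift_u g x in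
  eta u * real_sign ((X (t + u *+ 2))^-1 * X u * X t * X u).

Section OrbitIsomorphism.
Variables (g : G) (e : int).
Hypothesis e_sign : is_sign e.
Hypothesis g0'E : tr_g0 p' = tr_g0 p - g *+ 2.
Hypothesis kappa'E : forall x, tr_kappa p' (x + pi g) = tr_kappa p x.
Hypothesis sigma'E : forall x, tr_sigma p' (x + pi g) = e * (twist_sign g x * tr_sigma p x).

(** When the total sign is -1 the positive and negative parts exchange their sizes: [move_ix] then
    sends the positive positions behind the negative ones, which come to the front. *)
Let swap x := (x \in sp) && (e * twist_sign g x == -1).
Let move_ix x i := if swap x
  then if (i < pos_size p x)%N then (i + neg_size p x)%N else (i - pos_size p x)%N else i.
Let move_ixV x i := if swap x
  then if (i < neg_size p x)%N then (i + pos_size p x)%N else (i - neg_size p x)%N else i.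

Lemma move_ix_lt x i : (i < tr_kappa p x)%N -> (move_ix x i < tr_kappa p x)%N.
Proof.
rewrite /move_ix /swap; case x_sp: (x \in sp) => //=; case: ifP => // _.
by have [] := sizes p_inX x_sp; case: ifP; lia.
Qed.

Lemma move_ixV_lt x i : (i < tr_kappa p x)%N -> (move_ixV x i < tr_kappa p x)%N.
Proof.
rewrite /move_ixV /swap; case x_sp: (x \in sp) => //=; case: ifP => // _.
by have [] := sizes p_inX x_sp; case: ifP; lia.
Qed.

Lemma move_ixK x i : (i < tr_kappa p x)%N -> move_ixV x (move_ix x i) = i.
Proof.
rewrite /move_ix /move_ixV /swap; case x_sp: (x \in sp) => //=; case: (_ == -1) => //.
by have [] := sizes p_inX x_sp; do 2!case: ifP; lia.
Qed.

Lemma move_ixVK x i : (i < tr_kappa p x)%N -> move_ix x (move_ixV x i) = i.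
Proof.
rewrite /move_ix /move_ixV /swap; case x_sp: (x \in sp) => //=; case: (_ == -1) => //.
by have [] := sizes p_inX x_sp; do 2!case: ifP; lia.
Qed.

Lemma move_ix_nsp x i : x \notin sp -> move_ix x i = i.
Proof. by rewrite /move_ix /swap => /negPf ->. Qed.

Lemma fixed_solution (a : 'I_n) (a' : 'I_n') :
    bar a = a -> cs a' = cs a + pi g -> ix a' = move_ix (cs a) (ix a) ->
  exists d, [/\ d \in 'D_ (- shift_u g (cs a)), d != 0 &
    phi0 d * phi_at a' * d = phi_at a *~ e].
Proof.
move=> /eqP; rewrite bar_fixed // => /andP[sd nsym] cs_a' ix_a'.
rewrite /phi_at cs_a' ix_a' (self_dual_shift g0'E) sd (tau_shift g0'E).
rewrite /coef (symplectic_shift g0'E) (negPf nsym) (sp_shift g0'E).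
have Tt := tau_T sd; have Tu := shift_u_T g (cs a).
set x := cs a in sd nsym Tt Tu *; set t := tau xi _ x in Tt *; set u := shift_u g x in Tu *.
have [x_sp|nsp] := boolP (x \in sp).
  have Kt : t \in K by apply: sp_K x_sp.
  have [z z0 zE] := twistE Tu Kt.
  have twE : twist_sign g x = eta u * sgz z by rewrite /twist_sign (real_sign_twist Tu Kt zE).
  have int1 (b : bool) : (if b then 1 else -1 : D) = 1 *~ (if b then 1 else -1).
    by case: b.
  rewrite !int1 !mulrzAr !mulr1; apply: (solve_signature Tu Kt z0 zE) => //.
  - by case: ifP; [left | right].
  - by case: ifP; [left | right].
  have x_sp' : x + pi g \in signature_place E phi0 delta X xi (tr_g0 p').
    by rewrite (sp_shift g0'E).
  (* It remains to compare the signs at a position and at its image. Multiplicity and signature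
     determine the sizes of the positive and negative parts on both sides, and [move_ix] was made to
     match these parts. *)
  have [sz1 sz2] := sizes p_inX x_sp; have [] := sizes p'_inX x_sp'.
  rewrite kappa'E sigma'E -sz1 -sz2 /move_ix /swap x_sp /= twE.
  have lt_ix : (ix a < pos_size p x + neg_size p x)%N by rewrite sz1 ix_lt.
  case: e_sign => ->; case: (eta_sign u) => ->; case: (sgz_sign z0) => ->;
    rewrite /= ?(mulr1, mul1r, mulrN1, mulN1r, opprK); case: ifP; case: ifP; lia.
have := rest_cases sd nsym nsp; rewrite -/t.
case: {-1}E (erefl E) => [//|i ii DeE EE [nKt _]|i j ii jj ij DeE EE _].
  by rewrite /= !mulr1; apply: solve_skew => //; rewrite EE.
have nC : ~~ is_C by rewrite /is_C EE.
have [z z0 zE] := twistE Tu (K_notC nC Tt).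
exact: (solve_quaternion EE Tu Tt z0 zE).
Qed.

Lemma orbit_isomorphism : isomorphic (M E phi0 delta X o) (M E phi0 delta X o').
Proof.
have /choice[pm pmP] (a : 'I_n) : exists a' : 'I_n',
    cs a' = cs a + pi g /\ ix a' = move_ix (cs a) (ix a).
  have [|a' e1 e2] := @at_ex _ o' p'_inX (cs a + pi g) (move_ix (cs a) (ix a)).
    by rewrite kappa'E move_ix_lt ?ix_lt.
  by exists a'.
have /choice[q qP] (a' : 'I_n') : exists a : 'I_n,
    cs a = cs a' - pi g /\ ix a = move_ixV (cs a' - pi g) (ix a').
  have [|a e1 e2] := @at_ex _ o p_inX (cs a' - pi g) (move_ixV (cs a' - pi g) (ix a')).
    by rewrite move_ixV_lt // -kappa'E subrK ix_lt.
  by exists a.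
have pmK : cancel pm q.
  move=> a; have [cs_pm ix_pm] := pmP a; have [cs_q ix_q] := qP (pm a).
  rewrite cs_pm addrK in cs_q ix_q; apply: cs_ix_inj => //.
  by rewrite ix_q ix_pm move_ixK ?ix_lt.
have qK : cancel q pm.
  move=> a'; have [cs_q ix_q] := qP a'; have [cs_pm ix_pm] := pmP (q a').
  rewrite cs_q subrK in cs_pm; rewrite cs_q ix_q in ix_pm; apply: cs_ix_inj => //.
  by rewrite ix_pm move_ixVK // -kappa'E subrK ix_lt.
have pm_bar a : pm (bar a) = bar (pm a).
  have [cs_pm ix_pm] := pmP a; have [cs_pmb ix_pmb] := pmP (bar a).
  apply: cs_ix_inj.
    by rewrite cs_pmb !cs_bar // cs_pm (dual_shift g0'E).
  rewrite ix_pmb !ix_bar // cs_pm ix_pm cs_bar // (bar_ix_shift g0'E) //.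
  have [nsd|sd] := boolP (cs a \in self_dual xi (tr_g0 p)).
    have -> : - pi (tr_g0 p) - cs a = cs a by move: nsd; rewrite self_dualE => /eqP.
    rewrite /bar_ix; case: ifP => // sym; rewrite !move_ix_nsp //;
    by apply/negP => x_sp; apply: symplectic_sp sym x_sp.
  rewrite !bar_ix_nsd ?(negPf sd) // !move_ix_nsp //.
    by apply: contra sd => /sp_self_dual.
  by apply: contra sd => /sp_self_dual; rewrite self_dual_dual.
have u_deg (a : 'I_n) : - shift_u g (cs a) = g + row_degree a - row_degree (pm a).
  by have [cs_pm _] := pmP a; rewrite !row_degreeE cs_pm /shift_u; zmod.
pose w (a : 'I_n) := (X (shift_u g (cs a)))^-1.
have Dw a : w a \in 'D_ (- shift_u g (cs a)) by apply: XV_comp; apply: shift_u_T.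
have w0 a : w a != 0.
  by apply: homog_inv_neq0 (X_comp (shift_u_T _ _)) (X_neq0 (shift_u_T _ _)).
(* For a pair a, bar a the entry d (bar a) is determined by the arbitrary choice
   d a = w a. *)
have /choice[d dP] (a : 'I_n) : exists d : D,
    [/\ d \in 'D_ (- shift_u g (cs a)), d != 0,
      bar a = a -> phi0 d * phi_at (pm a) * d = phi_at a *~ e &
      bar a != a -> d = if (a < bar a)%N then w a
        else (phi0 (w (bar a)) * phi_at (pm (bar a)))^-1 * phi_at (bar a) *~ e].
  have Ub : phi0 (w (bar a)) * phi_at (pm (bar a)) \is a GRing.unit.
    rewrite unitrMl; last exact: phi_at_unit.
    by apply: gd_unit (phi0_comp (Dw _)) _; rewrite phi0_eq0.
  have [fix_a|nfix_a] := eqVneq (bar a) a.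
    have [cs_pm ix_pm] := pmP a.
    by have [d [Dd d0 d_form]] := fixed_solution fix_a cs_pm ix_pm; exists d; split=> // /eqP.
  case: ifP => _; first by exists (w a); split=> // e1; rewrite e1 eqxx in nfix_a.
  exists ((phi0 (w (bar a)) * phi_at (pm (bar a)))^-1 * phi_at (bar a) *~ e).
  have D1 := compM (phi0_comp (Dw (bar a))) (phi_at_comp p'_inX (pm (bar a))).
  have n0 : phi0 (w (bar a)) * phi_at (pm (bar a)) != 0.
    by apply: contraTneq Ub => ->; rewrite unitr0.
  have D2 := compM (comp_inv D1 n0) (phi_at_comp p_inX (bar a)).
  split=> //; last by move=> e1; rewrite e1 eqxx in nfix_a.
    apply: (@comp_mem _ _ _ (- (- shift_u g (cs (bar a)) + (tr_g0 p' + row_degree (pm (bar a))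
        + row_degree (bar (pm (bar a))))) + (tr_g0 p + row_degree (bar a)
        + row_degree (bar (bar a))))).
      by rewrite !u_deg -pm_bar !barK // g0'E; zmod.
    by case: e_sign => ->; rewrite ?mulr1z ?mulrN1z ?memvN.
  have V := phi_at_neq0 (bar a).
  have : (phi0 (w (bar a)) * phi_at (pm (bar a)))^-1 * phi_at (bar a) != 0.
    by apply: mul_homog_neq0 (comp_inv D1 n0) (homog_inv_neq0 D1 n0) V.
  by case: e_sign => ->; rewrite ?mulr1z ?mulrN1z ?oppr_eq0.
have Dd a : d a \in 'D_ (g + row_degree a - row_degree (pm a)).
  by rewrite -u_deg; case: (dP a).
have d0 a : d a != 0 by case: (dP a).
apply: (@monomial_isomorphism g e pm q d) => // a.
have [fix_a|nfix_a] := eqVneq (bar a) a.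
  by have [_ _ /(_ fix_a) d_form _] := dP a; rewrite fix_a.
have Uw b : phi0 (w b) * phi_at (pm b) \is a GRing.unit.
  rewrite unitrMl; last exact: phi_at_unit.
  by apply: gd_unit (phi0_comp (Dw _)) _; rewrite phi0_eq0.
have [_ _ _ /(_ nfix_a) da] := dP a; have [_ _ _] := dP (bar a).
rewrite barK // eq_sym => /(_ nfix_a) db.
have [lt_a|le_a] := boolP (a < bar a)%N.
  by rewrite da db lt_a ltnNge ltnW //= mulrzAr mulrA mulrV // mul1r.
have lt_b : (bar a < a)%N by rewrite ltn_neqAle leqNgt le_a nfix_a.
have eq_b : phi0 (w (bar a)) * phi_at (pm (bar a)) * d a = phi_at (bar a) *~ e.
  by rewrite da (negPf le_a) mulrzAr mulrA mulrV // mul1r.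
(* The equation at [bar a] holds by construction; as both forms are delta-hermitian, applying phi0
   turns it into the equation at a. *)
rewrite db lt_b; move/(congr1 phi0): eq_b.
rewrite !phi0M phi0K !raddfMz /= !phi_at_herm // -pm_bar barK //.
rewrite mulrA mulrzAr mulrzAl -[in RHS]mulrzA [_ * e]mulrC mulrzA.
by move/(congr1 (fun x => x *~ delta)); rewrite !(sign_mulrzK _ delta_sign).
Qed.

End OrbitIsomorphism.

Lemma isomorphic_of_same_orbit : same_orbit phi0 X xi p p' ->
  isomorphic (M E phi0 delta X o) (M E phi0 delta X o').
Proof.
case=> g [e [e_sign p'E]].
apply: (@orbit_isomorphism g e) => //.
- by rewrite p'E.
- by move=> x; rewrite p'E /= addrK.
- by move=> x; rewrite p'E /= addrK.
Qed.

End Transport.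

(** * Isomorphic models *)

(** The coefficients act from the left on a division ring, so the system is only treated as a real
    one: rank-nullity applies because unknowns and equations are both counted with the factor dim
    D_e. *)
Lemma more_unknowns (I J : finType) (A : {pred I}) (B : {pred J}) (m : J -> I -> D) :
    (forall c a, c \in B -> a \in A -> m c a \in De) -> (#|B| < #|A|)%N ->
  exists v : I -> D, [/\ exists a, v a != 0, forall a, v a \in De,
    forall a, a \notin A -> v a = 0 &
    forall c, c \in B -> \sum_(a in A) m c a * v a = 0].
Proof.
move=> De_m lt_BA; pose W := subvs_of De.
have dimW : (0 < dim W)%N.
  rewrite -dimvf; rewrite lt0n dimv_eq0; apply/eqP => W0.
  have : vsproj De 1 \in fullv by apply: memvf.
  rewrite W0 memv0 => /eqP/(congr1 vsval); rewrite vsprojK ?one_De // linear0.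
  by apply/eqP; rewrite oner_eq0.
pose Lf (v : {ffun 'I_#|A| -> W}) : {ffun 'I_#|B| -> W} :=
  [ffun c => vsproj De (\sum_i m (enum_val c) (enum_val i) * vsval (v i))].
have Lf_lin : linear Lf.
  move=> k v w; apply/ffunP => c; rewrite !ffunE -linearP; congr (vsproj _ _).
  rewrite scaler_sumr -big_split; apply: eq_bigr => i _ /=.
  by rewrite !ffunE linearP /= mulrDr scalerAr.
pose LL := GRing.isLinear.Build _ _ _ _ Lf Lf_lin.
pose L : {linear {ffun 'I_#|A| -> W} -> {ffun 'I_#|B| -> W}} := HB.pack Lf LL.
have [v v_ker v0] : exists2 v, v \in lker (linfun L) & v != 0.
  have: lker (linfun L) != 0%VS.
    apply: contraTneq lt_BA => ker0; rewrite -leqNgt.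
    have := limg_ker_dim (linfun L) fullv; rewrite ker0 capv0 dimv0 add0n => eq_dim.
    have := dimvS (subvf (linfun L @: fullv)); rewrite eq_dim !dimvf.
    by rewrite /dim /= !card_ord leq_pmul2r.
  by move=> n0; exists (vpick (lker (linfun L))); rewrite ?memv_pick ?vpick0.
have sum_v c : c \in B -> \sum_i m c (enum_val i) * vsval (v i) = 0.
  move=> Bc; move: v_ker; rewrite memv_ker lfunE /= => /eqP/ffunP/(_ (enum_rank_in Bc c)).
  rewrite !ffunE enum_rankK_in // => /(congr1 vsval); rewrite linear0 vsprojK //.
  apply: memv_suml => i _; apply: De_mul; last exact: subvsP.
  by apply: De_m => //; apply: enum_valP.
have [i0 vi0] : exists i, v i != 0.
  apply/existsP; apply: contraNT v0; rewrite negb_exists => /forallP v_eq0.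
  by apply/eqP/ffunP => i; rewrite ffunE; apply/eqP; have := v_eq0 i; rewrite negbK.
pose rk := enum_rank_in (enum_valP i0).
exists (fun a => if a \in A then vsval (v (rk a)) else 0); split.
- exists (enum_val i0); rewrite enum_valP /rk enum_valK_in.
  by apply: contraNneq vi0 => e; apply/eqP/val_inj; rewrite /= e.
- by move=> a; case: ifP => _; [apply: subvsP | apply: mem0v].
- by move=> a /negPf ->.
move=> c Bc; rewrite -[RHS](sum_v c Bc) big_enum_val.
by apply: eq_bigr => i _; rewrite enum_valP /rk enum_valK_in.
Qed.

Lemma De_norm_ge0 x : x \in De -> exists2 r : R, 0 <= r & phi0 x * x = r%:A /\ (x != 0 -> 0 < r).
Proof.
move=> De_x; have [->|x0] := eqVneq x 0; first by exists 0; rewrite // mulr0 scale0r.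
by have [r r0 e] := De_norm De_x x0; exists r => //; apply: ltW.
Qed.

(* As in Sylvester's law, a vector of the positive part of the first form that is
   killed by all positive coordinates of the second form vanishes. *)
Lemma inertia (I J : finType) (A : {pred I}) (B : {pred J}) (m : J -> I -> D)
    (s : I -> R) (e : J -> R) :
    (forall c a, c \in B -> a \in A -> m c a \in De) ->
    (forall a b, a \in A -> b \in A ->
       \sum_(c in B) phi0 (m c a) * (e c *: m c b) = if a == b then (s a)%:A else 0) ->
    (forall a, a \in A -> 0 < s a) ->
  (#|A| <= #|[pred c in B | (0 < e c)%R]|)%N.
Proof.
move=> De_m forms s_gt0; rewrite leqNgt; apply/negP => lt_BA.
have De_m' c a : c \in [pred c in B | (0 < e c)%R] -> a \in A -> m c a \in De.
  by move=> /andP[Bc _]; apply: De_m.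
have [v [[a0 va0] De_v v_out v_ker]] := more_unknowns De_m' lt_BA.
pose w c := \sum_(a in A) m c a * v a.
have De_w c : c \in B -> w c \in De.
  by move=> Bc; apply: memv_suml => a Aa; apply: De_mul => //; apply: De_m.
have /choice[N NP] a : exists r : R, 0 <= r /\ (phi0 (v a) * v a = r%:A /\ (v a != 0 -> 0 < r)).
  by have [r r0 rP] := De_norm_ge0 (De_v a); exists r.
have /choice[N' N'P] c : exists r : R, c \in B -> 0 <= r /\ phi0 (w c) * w c = r%:A.
  have [Bc|_] := boolP (c \in B); last by exists 0.
  by have [r r0 [rE _]] := De_norm_ge0 (De_w c Bc); exists r.
(* The form is evaluated at v in two ways: in its own diagonal coordinates and in the coordinates w
   of the second form. *)
have eq_forms : \sum_(a in A) s a * N a = \sum_(c in B) e c * N' c.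
  have scal_inj (x y : R) : x%:A = y%:A :> D -> x = y.
    by move=> /eqP; rewrite -subr_eq0 -scalerBl scaler_eq0 oner_eq0 orbF subr_eq0 => /eqP.
  apply: scal_inj.
  transitivity (\sum_(c in B) phi0 (w c) * (e c *: w c)); last first.
    rewrite scaler_suml; apply: eq_bigr => c Bc; have [_ NE] := N'P c Bc.
    by rewrite -scalerAr NE scalerA.
  transitivity (\sum_(a in A) \sum_(b in A) phi0 (v a) *
      (\sum_(c in B) phi0 (m c a) * (e c *: m c b)) * v b).
    rewrite scaler_suml; apply: eq_bigr => a Aa; rewrite (bigD1 a) //= forms // eqxx.
    rewrite big1 ?addr0 => [|b /andP[Ab nb]].
      have [_ [NE _]] := NP a.
      by rewrite mulr_algr -scalerAl NE scalerA.
    by rewrite forms // eq_sym (negPf nb) mulr0 mul0r.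
  transitivity (\sum_(a in A) \sum_(b in A) \sum_(c in B)
      phi0 (m c a * v a) * (e c *: (m c b * v b))).
    apply: eq_bigr => a _; apply: eq_bigr => b _; rewrite mulr_sumr mulr_suml.
    by apply: eq_bigr => c _; rewrite phi0M -!scalerAr -!scalerAl !mulrA.
  rewrite (eq_bigr _ (fun a _ => exchange_big _ _ _ _ _ _)) /= exchange_big /=.
  apply: eq_bigr => c _; rewrite /w raddf_sum mulr_suml; apply: eq_bigr => a _.
  by rewrite scaler_sumr mulr_sumr.
have Aa0 : a0 \in A by apply: contraNT va0 => /v_out ->.
have : 0 < \sum_(a in A) s a * N a.
  rewrite (bigD1 a0) //= ltr_wpDr //.
    by apply: sumr_ge0 => a /andP[Aa _]; rewrite mulr_ge0 ?(ltW (s_gt0 _ Aa)) //; case: (NP a).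
  by rewrite mulr_gt0 ?s_gt0 //; have [_ [_ ->]] := NP a0.
rewrite eq_forms ltNge => /negP; apply; apply: sumr_le0 => c Bc.
have [N0 NE] := N'P c Bc; have [e_gt0|e_le0] := ltP 0 (e c); last by rewrite mulr_le0_ge0.
suff -> : N' c = 0 by rewrite mulr0.
have w0 : w c = 0 by apply: v_ker; rewrite inE Bc.
move: NE; rewrite w0 mulr0 => /esym/eqP; rewrite scaler_eq0 oner_eq0 orbF => /eqP //.
Qed.

Section FiberCard.
Variables (p : triple D).
Hypothesis p_inX : inX E phi0 delta X xi p.
Variable o : support_order xi p.
Local Notation n := (model_size o).

Lemma card_fiber_interval x lo hi : (hi <= tr_kappa p x)%N ->
  #|[pred a : 'I_n | (cs a == x) && (lo <= ix a < hi)%N]| = (hi - lo)%N.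
Proof.
move=> le_hi.
have /choice[h hP] (i : 'I_(hi - lo)) : exists a : 'I_n, cs a = x /\ ix a = (lo + i)%N.
  have lt_i : (lo + i < tr_kappa p x)%N by have := ltn_ord i; lia.
  by have [a e1 e2] := at_ex o p_inX lt_i; exists a.
have h_inj : injective h.
  move=> i j eij; have [_ ei] := hP i; have [_ ej] := hP j; apply: val_inj.
  by move: ei; rewrite eij ej => /addnI.
rewrite -[RHS]card_ord -(card_codom h_inj); apply: eq_card => a; rewrite !inE.
apply/andP/codomP => [[/eqP cs_a /andP[le_lo lt_hi]]|[i ->]].
  have lt_i : (ix a - lo < hi - lo)%N by lia.
  exists (Ordinal lt_i); have [e1 e2] := hP (Ordinal lt_i).
  by apply: cs_ix_inj; rewrite ?e1 ?e2 //= subnKC.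
by have [-> ->] := hP i; rewrite eqxx leq_addr -ltn_subRL ltn_ord.
Qed.

Lemma card_fiber x : #|[pred a : 'I_n | cs a == x]| = tr_kappa p x.
Proof.
rewrite -[RHS]subn0 -(@card_fiber_interval x 0 (tr_kappa p x)) //.
by apply: eq_card => a; rewrite !inE; case: eqP => //= <-; rewrite ix_lt.
Qed.

Local Notation sp := (signature_place E phi0 delta X xi (tr_g0 p)).

Definition sign_at (a : 'I_n) : R := if (ix a < pos_size p (cs a))%N then 1 else -1.

Lemma card_positive x : x \in sp ->
  #|[pred a : 'I_n | (cs a == x) && (0 < sign_at a)]| = pos_size p x.
Proof.
move=> x_sp; have [sz _] := sizes p_inX x_sp.
have le_pos : (pos_size p x <= tr_kappa p x)%N by rewrite -sz leq_addr.
rewrite -[RHS]subn0 -(@card_fiber_interval x 0 _ le_pos); apply: eq_card => a; rewrite !inE.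
by rewrite /sign_at; case: eqP => //= ->; case: ifP; rewrite ?ltr01 ?ltr0N1.
Qed.

Lemma card_negative x : x \in sp ->
  #|[pred a : 'I_n | (cs a == x) && (0 < - sign_at a)]| = neg_size p x.
Proof.
move=> x_sp; have [sz _] := sizes p_inX x_sp.
rewrite -[RHS](addKn (pos_size p x)) sz -(@card_fiber_interval x (pos_size p x) _ (leqnn _)).
apply: eq_card => a; rewrite !inE /sign_at; case: eqP => //= <-; rewrite ix_lt // andbT [RHS]leqNgt.
by case: ifP; rewrite ?opprK ?ltr01 ?ltr0N1.
Qed.

End FiberCard.

(** * Invariants extracted from an isomorphism *)

Section ForwardDirection.
Variables (p p' : triple D).
Hypotheses (p_inX : inX E phi0 delta X xi p) (p'_inX : inX E phi0 delta X xi p').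
Variables (o : support_order xi p) (o' : support_order xi p').
Local Notation n := (model_size o).
Local Notation n' := (model_size o').
Local Notation sp := (signature_place E phi0 delta X xi (tr_g0 p)).

Definition star a b (A : 'M[D]_(a, b)) : 'M[D]_(b, a) := map_mx phi0 A^T.

Lemma starM a b c (A : 'M[D]_(a, b)) (B : 'M[D]_(b, c)) : star (A *m B) = star B *m star A.
Proof.
apply/matrixP => i j; rewrite !mxE raddf_sum; apply: eq_bigr => k _ /=.
by rewrite phi0M /star !mxE.
Qed.

Lemma starK a b (A : 'M[D]_(a, b)) : star (star A) = A.
Proof. by apply/matrixP => i j; rewrite !mxE phi0K. Qed.

Lemma star1 a : star (1%:M : 'M[D]_a) = 1%:M.
Proof.
apply/matrixP => i j; rewrite !mxE eq_sym; case: (_ == _); rewrite ?phi0_1 //.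
exact: linear0.
Qed.

Lemma model_nonempty : exists a : 'I_n, True.
Proof.
have [[[x x0] _ _ _] _] := p_inX; rewrite -lt0n in x0.
by have [a _ _] := at_ex o p_inX x0; exists a.
Qed.

Hypothesis D_central : 'Z({:D})%VS = 1%VS.

(** Comparing f with the two involutions on all matrices shows that P^* Phi' P Phi^-1 is central,
    hence a real scalar r. In the last clause the product with the monomial Phi' is written along
    [bar]. *)
Lemma isomorphism_form : isomorphic (M E phi0 delta X o) (M E phi0 delta X o') ->
  exists (g : G) (P : 'M[D]_(n', n)) (Q : 'M[D]_(n, n')) (r : R),
    [/\ Q *m P = 1%:M, P *m Q = 1%:M, r != 0,
      homog_mx (@row_degree _ _ _ _ _ o') (@row_degree _ _ _ _ _ o) g P /\
      homog_mx (@row_degree _ _ _ _ _ o) (@row_degree _ _ _ _ _ o') (- g) Q &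
      forall a b, \sum_c phi0 (P c a) * phi_at c * P (bar c) b
        = if b == bar a then r *: phi_at a else 0].
Proof.
case=> f [f_bij [fD [fM f1]] fZ fh f_inv].
have [a0 _] := model_nonempty.
have [g [P [Q [PQ QP fE hP hQ]]]] := graded_skolem_noether D_central a0 f_bij fD fM f1 fZ
  (fun g A hA => proj1 (fh g A) hA).
pose F := Phi E phi0 delta X o; pose F' := Phi E phi0 delta X o'.
pose V := Phi_inverse o; pose V' := Phi_inverse o'.
have FV : F *m V = 1%:M by apply: Phi_mulV.
have VF : V *m F = 1%:M by apply: Phi_Vmul.
have F'V' : F' *m V' = 1%:M by apply: Phi_mulV.
have V'F' : V' *m F' = 1%:M by apply: Phi_Vmul.
have inv_eq B : P *m (V *m B *m F) *m Q = V' *m (star Q *m B *m star P) *m F'.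
  have := f_inv (star B); rewrite fE /= /model_inv !matrix_inverse_Phi //.
  by rewrite -!/(star _) starK fE !starM starK => ->; rewrite !mulmxA.
pose N := star P *m F' *m P *m V.
have N_central B : N *m B = B *m N.
  have : (star P *m F') *m (P *m (V *m B *m F) *m Q) *m (P *m V)
       = (star P *m F') *m (V' *m (star Q *m B *m star P) *m F') *m (P *m V).
    by rewrite inv_eq.
  rewrite !mulmxA -[_ *m Q *m P]mulmxA QP mulmx1 -[_ *m F *m V]mulmxA FV mulmx1.
  rewrite -[_ *m F' *m V']mulmxA F'V' mulmx1 -starM QP star1 mul1mx.
  by rewrite /N; rewrite ?mulmxA.
have [r NE] := mx_central D_central a0 N_central.
have PFP : star P *m F' *m P = r%:A *: F.
  by rewrite -[LHS]mulmx1 -VF mulmxA -/N NE mul_scalar_mx.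
exists g, P, Q, r; split=> //.
(* If r = 0, then Phi' = Q^* P^* Phi' P Q = 0, which is impossible for an invertible matrix of
   nonzero size. *)
- apply: contraTneq (oner_neq0 D) => r0.
  have F'0 : F' = 0.
    have : star Q *m (star P *m F' *m P) *m Q = 0.
      by rewrite PFP r0 scale0r scale0r mulmx0 mul0mx.
    by rewrite !mulmxA -starM PQ star1 mul1mx -mulmxA PQ mulmx1.
  have P0 : P = 0 by rewrite -[P]mul1mx -V'F' F'0 mulmx0 mul0mx.
  by move: QP; rewrite P0 mulmx0 => /matrixP/(_ a0 a0); rewrite !mxE eqxx => e0;
    rewrite negbK eq_sym; apply/eqP; exact: e0.
- move=> a b; have /matrixP/(_ a b) := PFP; rewrite mxE [RHS]mxE Phi_barE //.
  move=> e; transitivity (\sum_c (star P *m F') a (bar c) * P (bar c) b).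
    apply: eq_bigr => c _; congr (_ * _); rewrite mxE (bigD1 c) //= Phi_barE // eqxx.
    rewrite big1 ?addr0 => [|c' nc']; first by rewrite !mxE.
    by rewrite Phi_barE // (inj_eq (can_inj (barK p'_inX))) eq_sym (negPf nc') mulr0.
  transitivity (\sum_j (star P *m F') a j * P j b).
    by rewrite [RHS](reindex_inj (can_inj (barK p'_inX))).
  by rewrite e mulr_algl; case: ifP => _; rewrite ?scaler0.
Qed.

Lemma left_inverse_injective k l (A : 'M[D]_(k, l)) (B : 'M[D]_(l, k)) (v : 'I_l -> D) :
  B *m A = 1%:M -> (forall i, \sum_j A i j * v j = 0) -> forall j, v j = 0.
Proof.
move=> BA Av j; have: B *m (A *m \col_i v i) = 0.
  suff -> : A *m \col_i v i = 0 by rewrite mulmx0.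
  apply/matrixP => i c; rewrite !mxE -[RHS](Av i); apply: eq_bigr => l' _.
  by rewrite mxE.
by rewrite mulmxA BA mul1mx => /matrixP/(_ j 0); rewrite !mxE.
Qed.

Section Equivalence.
Variables (g : G) (P : 'M[D]_(n', n)) (Q : 'M[D]_(n, n')) (r : R).
Hypotheses (QP : Q *m P = 1%:M) (PQ : P *m Q = 1%:M) (r0 : r != 0).
Hypothesis hP : homog_mx (@row_degree _ _ _ _ _ o') (@row_degree _ _ _ _ _ o) g P.
Hypothesis hQ : homog_mx (@row_degree _ _ _ _ _ o) (@row_degree _ _ _ _ _ o') (- g) Q.
Hypothesis form : forall a b, \sum_c phi0 (P c a) * phi_at c * P (bar c) b
  = if b == bar a then r *: phi_at a else 0.

Lemma P_comp c a : P c a \in 'D_ (g - row_degree c + row_degree a).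
Proof. exact: homog_mxE hP. Qed.

Lemma Q_comp a c : Q a c \in 'D_ (- g - row_degree a + row_degree c).
Proof. exact: homog_mxE hQ. Qed.

(** A nonzero entry has its degree in T; read modulo T, this is the equation between the cosets of
    its row and column. *)
Lemma P_block c a : cs c != cs a + pi g -> P c a = 0.
Proof.
move=> neq; apply: comp_out (P_comp c a); apply: contra neq.
rewrite coset_eq0 !cosetD cosetN !row_degreeE !coset_xi => /eqP e.
by rewrite eq_sym -subr_eq0; apply/eqP; rewrite -[RHS]e; zmod.
Qed.

Lemma Q_block a c : cs c != cs a + pi g -> Q a c = 0.
Proof.
move=> neq; apply: comp_out (Q_comp a c); apply: contra neq.
rewrite coset_eq0 !cosetD !cosetN !row_degreeE !coset_xi => /eqP e.
by rewrite -subr_eq0; apply/eqP; rewrite -[RHS]e; zmod.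
Qed.

(** The nonzero entry r phi_at a of the form has its degree computed from either side; the two
    copies of P contribute 2g. *)
Lemma base_shift : tr_g0 p' = tr_g0 p - g *+ 2.
Proof.
have [a _] := model_nonempty; have := form a (bar a); rewrite eqxx => e.
have n0 : r *: phi_at a != 0 by rewrite scaler_eq0 negb_or r0 phi_at_neq0.
have D1 : r *: phi_at a \in 'D_ (tr_g0 p + row_degree a + row_degree (bar a)).
  by apply: memvZ; apply: phi_at_comp.
have D2 : r *: phi_at a \in 'D_ (g *+ 2 + tr_g0 p' + row_degree a + row_degree (bar a)).
  rewrite -e; apply: memv_suml => c _.
  apply: comp_mem (compM (compM (phi0_comp (P_comp c a)) (phi_at_comp p'_inX c))
    (P_comp (bar c) (bar a))).
  by zmod.
by have e2 := comp_degree D1 D2 n0; zmod_from (esym e2).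
Qed.

Let u := shift_u g.

Lemma XP_De x c a : cs c = x + pi g -> cs a = x -> X (u x) * P c a \in De.
Proof.
move=> cs_c cs_a; apply: comp_mem (compM (X_comp (shift_u_T g x)) (P_comp c a)).
by rewrite !row_degreeE cs_c cs_a /shift_u; zmod.
Qed.

Lemma XQ_De x c a : cs c = x + pi g -> cs a = x -> (X (u x))^-1 * Q a c \in De.
Proof.
move=> cs_c cs_a; apply: comp_mem (compM (XV_comp (shift_u_T g x)) (Q_comp a c)).
by rewrite !row_degreeE cs_c cs_a /shift_u; zmod.
Qed.

(** The kernel of P can be studied one coset at a time, and X_u times a block has entries in D_e. A
    block with more columns than rows would have a kernel vector, against Q P = 1; the blocks of Q
    give the other inequality. *)
Lemma kappa_shift x : tr_kappa p' (x + pi g) = tr_kappa p x.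
Proof.
pose A : {pred 'I_n} := [pred a | cs a == x].
pose B : {pred 'I_n'} := [pred c | cs c == x + pi g].
have kA : #|A| = tr_kappa p x by apply: card_fiber.
have kB : #|B| = tr_kappa p' (x + pi g) by apply: card_fiber.
have Xu := X_unit (shift_u_T g x).
apply/eqP; rewrite eqn_leq -kA -kB; apply/andP; split; rewrite leqNgt; apply/negP => lt.
  have De_m a c : a \in A -> c \in B -> (X (u x))^-1 * Q a c \in De.
    by move=> /eqP cs_a /eqP cs_c; apply: XQ_De.
  have [v [[c0 vc0] _ v_out v_ker]] := more_unknowns De_m lt.
  case/eqP: vc0; have Qv a : \sum_c Q a c * v c = 0.
    have [Aa|nAa] := boolP (a \in A); last first.
      apply: big1 => c _; have [Bc|/v_out ->] := boolP (c \in B); last by rewrite mulr0.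
      rewrite Q_block ?mul0r //; apply: contra nAa => /eqP e.
      by move: Bc; rewrite !inE e (inj_eq (addIr _)).
    rewrite (bigID (fun c => c \in B)) /= [X in _ + X]big1 ?addr0 => [|c /v_out ->].
      apply: (mulrI (_ : (X (u x))^-1 \is a GRing.unit)); first by rewrite unitrV.
      rewrite mulr0 -[RHS](v_ker a Aa) mulr_sumr.
      by apply: eq_bigr => c _; rewrite mulrA.
    by rewrite mulr0.
  exact: left_inverse_injective PQ Qv c0.
have De_m c a : c \in B -> a \in A -> X (u x) * P c a \in De.
  by move=> /eqP cs_c /eqP cs_a; apply: XP_De.
have [v [[a0 va0] _ v_out v_ker]] := more_unknowns De_m lt.
case/eqP: va0; have Pv c : \sum_a P c a * v a = 0.
  have [Bc|nBc] := boolP (c \in B); last first.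
    apply: big1 => a _; have [Aa|/v_out ->] := boolP (a \in A); last by rewrite mulr0.
    by rewrite P_block ?mul0r //; rewrite (eqP Aa).
  rewrite (bigID (fun a => a \in A)) /= [X in _ + X]big1 ?addr0 => [|a /v_out ->].
    apply: (mulrI Xu); rewrite mulr0 -[RHS](v_ker c Bc) mulr_sumr.
    by apply: eq_bigr => a _; rewrite mulrA.
  by rewrite mulr0.
exact: left_inverse_injective QP Pv a0.
Qed.

Lemma fixed_phi_at p1 (p1_inX : inX E phi0 delta X xi p1) (o1 : support_order xi p1) x
    (c : 'I_(model_size o1)) :
  x \in signature_place E phi0 delta X xi (tr_g0 p1) -> cs c = x ->
  bar c = c /\ phi_at c = sign_at c *: X (tau xi (tr_g0 p1) x).
Proof.
move=> x_sp cs_c; have sd := sp_self_dual x_sp.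
have nsym : symplectic p1 x = false.
  by apply/negP => sym; apply: symplectic_sp sym x_sp.
split; first by apply/eqP; rewrite bar_fixed // cs_c sd nsym.
rewrite /phi_at cs_c sd /coef nsym x_sp /sign_at cs_c.
by case: ifP => _; rewrite ?mulr1 ?mulrN1 ?scale1r ?scaleN1r.
Qed.

Lemma sigma_shift x : x \in sp ->
  tr_sigma p' (x + pi g) = sgz r * (twist_sign p g x * tr_sigma p x).
Proof.
move=> x_sp; have x_sp' : x + pi g \in signature_place E phi0 delta X xi (tr_g0 p').
  by rewrite (sp_shift base_shift).
have Kt := sp_K x_sp; have Tu : u x \in T := shift_u_T g x.
have Tt := K_supp Kt.
set t := tau xi (tr_g0 p) x in Kt Tt.
have [z z0 zE] := twistE Tu Kt.
have -> : twist_sign p g x = eta (u x) * sgz z.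
  by rewrite /twist_sign (real_sign_twist Tu Kt zE).
pose A : {pred 'I_n} := [pred a | cs a == x].
pose B : {pred 'I_n'} := [pred c | cs c == x + pi g].
pose m c a := X (u x) * P c a.
have De_m c a : c \in B -> a \in A -> m c a \in De.
  by move=> /eqP cs_c /eqP cs_a; apply: XP_De.
have Xu := X_unit Tu.
pose h : R := (eta (u x))%:~R.
have hh : h * h = 1 by rewrite /h; case: (eta_sign (u x)) => ->; rewrite ?mulrNN mulr1.
have PE c a : P c a = (X (u x))^-1 * m c a by rewrite /m mulKr.
clearbody m.
(* Between the matrices m the two factors X_u^-1 surround X_(t+2u) and reduce it to X_t / z, while
   phi0 of the first one produces h. After cancelling X_t both forms are real and diagonal over
   D_e. *)
have forms a b : a \in A -> b \in A -> \sum_(c in B) phi0 (m c a) * (sign_at c *: m c b)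
    = if a == b then (r * z * h * sign_at a)%:A else 0.
  move=> Aa Ab; have [cs_a cs_b] := (eqP Aa, eqP Ab).
  have [bar_a phi_a] := fixed_phi_at p_inX x_sp cs_a.
  apply: (mulrI (X_unit Tt)).
  transitivity ((z * h) *: \sum_c phi0 (P c a) * phi_at c * P (bar c) b); last first.
    rewrite form bar_a eq_sym phi_a; case: eqP => _; last by rewrite scaler0 mulr0.
    by rewrite -scalerAr mulr1 !scalerA; congr (_ *: _); ring.
  rewrite [X in _ = _ *: X](bigID (fun c => c \in B)) /=.
  rewrite [X in _ *: (_ + X)]big1 ?addr0 => [|c nBc]; last first.
    by rewrite P_block ?linear0 ?mul0r // cs_a.
  rewrite mulr_sumr scaler_sumr; apply: eq_bigr => c Bc.
  have [bar_c ->] := fixed_phi_at p'_inX x_sp' (eqP Bc); rewrite bar_c !PE.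
  rewrite (tau_shift base_shift) -/t -/(u x) phi0M phi0_XV //.
  have -> : (X (u x))^-1 *~ eta (u x) = h *: (X (u x))^-1 by rewrite /h scaler_int.
  have De_pm : phi0 (m c a) \in De by apply: phi0_comp; apply: De_m.
  rewrite -!(scalerAl, scalerAr) !scalerA.
  have -> : phi0 (m c a) * (X (u x))^-1 * X (t + u x *+ 2) * ((X (u x))^-1 * m c b)
      = phi0 (m c a) * ((X (u x))^-1 * X (t + u x *+ 2) * (X (u x))^-1) * m c b.
    by rewrite !mulrA.
  rewrite (twistVE Tu z0 zE) -!(scalerAl, scalerAr) scalerA mulrA X_comm //; congr (_ *: _).
  have -> : z * h * (sign_at c * h) / z = (z * z^-1) * (h * h) * sign_at c by ring.
  by rewrite mulfV // hh !mul1r.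
(* [inertia] bounds only one number of positive entries. It is applied to the form and to its
   negative, w = 1 and w = -1; since the totals agree by [kappa_shift], both inequalities are
   equalities. *)
have ineq (w : R) : w * w = 1 ->
    (#|[pred a in A | (0 < w * (r * z * h * sign_at a))%R]|
      <= #|[pred c in B | (0 < w * sign_at c)%R]|)%N.
  move=> ww; apply: (@inertia _ _ [pred a in A | (0 < w * (r * z * h * sign_at a))%R] B m
      (fun a => w * (r * z * h * sign_at a)) (fun c => w * sign_at c)).
  - by move=> c a Bc /andP[Aa _]; apply: De_m.
  - move=> a b /andP[Aa _] /andP[Ab _].
    transitivity (w *: \sum_(c in B) phi0 (m c a) * (sign_at c *: m c b)).
      rewrite scaler_sumr; apply: eq_bigr => c _.
      by rewrite -scalerAr -!scalerAr scalerA.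
    by rewrite forms //; case: ifP => _; rewrite ?scaler0 ?scalerA.
  - by move=> a /andP[].
have [sz1 sz2] := sizes p_inX x_sp; have [sz1' sz2'] := sizes p'_inX x_sp'.
have cp := card_positive p_inX o x_sp; have cn := card_negative p_inX o x_sp.
have cp' := card_positive p'_inX o' x_sp'; have cn' := card_negative p'_inX o' x_sp'.
pose S := r * z * h.
have h_sgz : sgz h = eta (u x) by rewrite /h; case: (eta_sign (u x)) => ->; rewrite ?sgz1 ?sgzN1.
have S_sgz : sgz r * (eta (u x) * sgz z) = sgz S by rewrite /S !sgzM h_sgz; ring.
have ineq1 := ineq 1 (mulr1 1); have ineqN := ineq (-1) (etrans (mulrNN 1 1) (mulr1 1)).
have card_eq (J : finType) (C : {pred J}) (f1 f2 : J -> R) :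
    (forall j, (0 < f1 j) = (0 < f2 j)) ->
  #|[pred j | C j & 0 < f1 j]| = #|[pred j | C j & 0 < f2 j]|.
  by move=> ef; apply: eq_card => j; rewrite !inE ef.
have cardB1 : #|[pred c in B | (0 < 1 * sign_at c)%R]| = pos_size p' (x + pi g).
  by rewrite -cp'; apply: card_eq => c; rewrite mul1r.
have cardBN : #|[pred c in B | (0 < -1 * sign_at c)%R]| = neg_size p' (x + pi g).
  by rewrite -cn'; apply: card_eq => c; rewrite mulN1r.
have S0 : S != 0.
  rewrite !mulf_neq0 //; apply/eqP => h0.
  by have /eqP := hh; rewrite h0 mul0r eq_sym oner_eq0.
rewrite mulrA S_sgz -sz2 -sz2'; rewrite kappa_shift -sz1 in sz1'.
move: S0; rewrite neq_lt => /orP[S_lt0|S_gt0].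
  have cardA1 : #|[pred a in A | (0 < 1 * (r * z * h * sign_at a))%R]| = neg_size p x.
    by rewrite -cn; apply: card_eq => a; rewrite mul1r -/S nmulr_rgt0 ?oppr_gt0.
  have cardAN : #|[pred a in A | (0 < -1 * (r * z * h * sign_at a))%R]| = pos_size p x.
    by rewrite -cp; apply: card_eq => a; rewrite mulN1r -/S oppr_gt0 nmulr_rlt0.
  by rewrite ltr0_sgz //; rewrite cardA1 cardB1 in ineq1; rewrite cardAN cardBN in ineqN; lia.
have cardA1 : #|[pred a in A | (0 < 1 * (r * z * h * sign_at a))%R]| = pos_size p x.
  by rewrite -cp; apply: card_eq => a; rewrite mul1r -/S pmulr_rgt0.
have cardAN : #|[pred a in A | (0 < -1 * (r * z * h * sign_at a))%R]| = neg_size p x.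
  by rewrite -cn; apply: card_eq => a; rewrite mulN1r -/S !oppr_gt0 pmulr_rlt0.
by rewrite gtr0_sgz //; rewrite cardA1 cardB1 in ineq1; rewrite cardAN cardBN in ineqN; lia.
Qed.

End Equivalence.

Lemma same_orbit_of_isomorphic :
  isomorphic (M E phi0 delta X o) (M E phi0 delta X o') -> same_orbit phi0 X xi p p'.
Proof.
case/isomorphism_form => g [P [Q [r [QP PQ r0 [hP hQ] form]]]].
have g0'E := base_shift r0 hP form.
have kappa'E := kappa_shift QP PQ hP hQ.
have sigma'E := sigma_shift QP PQ r0 hP hQ form.
exists g, (sgz r); split; first exact: sgz_sign.
have -> : p' = Triple (tr_g0 p') (tr_kappa p') (tr_sigma p') by case: (p').
rewrite /sign_act /group_act /= -g0'E; congr Triple; apply/funext => y.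
  by rewrite -[y in LHS](subrK (pi g)) kappa'E.
have := sigma'E (y - pi g); rewrite /twist_sign /shift_u subrK.
(* Off the signature places both signatures vanish, and these places are preserved by the
   translation. *)
have [y_sp|y_nsp _] := boolP (y - pi g \in sp); first by apply.
have y_nsp' : y \notin signature_place E phi0 delta X xi (tr_g0 p').
  by rewrite -[y](subrK (pi g)) (sp_shift g0'E).
case: p_inX => _ /(_ (y - pi g))[_]; rewrite (negPf y_nsp) => ->.
by case: p'_inX => _ /(_ y)[_]; rewrite (negPf y_nsp') => ->; rewrite !mulr0.
Qed.

End ForwardDirection.

End Models.

Theorem corollary26 (R : realType) (G : zmodType) (D : grDivAlg R G)
    (D_central : 'Z({:D})%VS = 1%VS)
    (E : neutral_type D) (phi0 : {linear D -> D}) (delta : int)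
    (phi0_inv : degree_preserving_involution phi0)
    (phi0_conj : conjugation_on_De E phi0)
    (delta_sign : is_sign delta)
    (X : G -> D) (X_choice : homogeneous_choice E phi0 delta X)
    (xi : Quotient.quot (gd_supp D) -> G) (xi_section : coset_section xi)
    (p p' : triple D)
    (p_inX : inX E phi0 delta X xi p) (p'_inX : inX E phi0 delta X xi p')
    (o : support_order xi p) (o' : support_order xi p') :
  isomorphic (M E phi0 delta X o) (M E phi0 delta X o') <->
  same_orbit phi0 X xi p p'.
Proof.
split; first exact: same_orbit_of_isomorphic.
exact: isomorphic_of_same_orbit.
Qed.
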